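(* Let $p,q\ge0$, and let $1\le k_1\le\ldots\le k_p$ and $1\le j_1\le\ldots\le j_q$ be integers. Consider the complex random variable $$\mathcal{I}_{p,q}(e_{k_1}\otimes\cdots\otimes e_{k_p}\otimes\overline{e_{j_1}}\otimes\cdots\otimes\overline{e_{j_q}}):=F_1+\mathrm{i}F_2,$$ with $F_1,F_2$ real-valued. Then the law of the two-dimensional random vector $(F_1,F_2)$ is absolutely continuous with respect to Lebesgue measure on $\mathbb{R}^2$ if and only if $p\ne q$, or $p=q$ and there exists $1\le l\le p$ such that $k_l\ne j_l$.
   Context: $\mathfrak{H}$ is a real separable Hilbert space, $\mathfrak{H}_{\mathbb{C}}$ its complexification (inner product linear in the first variable); $^{\odot n}$ is the $n$-th symmetric tensor power, $\mathrm{symm}$ the symmetrization. $X$, $Y$ are two independent isonormal Gaussian processes over $\mathfrak{H}$ (centered Gaussian families with $\mathbb{E}[X(h)X(g)]=\langle h,g\rangle_{\mathfrak{H}}$, likewise $Y$). For $\mathfrak{h}=f+\mathrm{i}g\in\mathfrak{H}_{\mathbb{C}}$ put $X_{\mathbb{C}}(\mathfrak{h})=X(f)+\mathrm{i}X(g)$, similarly $Y_{\mathbb{C}}$, and $Z(\mathfrak{h})=(X_{\mathbb{C}}(\mathfrak{h})+\mathrm{i}Y_{\mathbb{C}}(\mathfrak{h}))/\sqrt2$ (complex isonormal Gaussian process). Complex Hermite polynomials are defined by $\exp\{\lambda\bar z+\bar\lambda z-2|\lambda|^2\}=\sum_{p,q\ge0}\frac{\bar\lambda^p\lambda^q}{p!q!}J_{p,q}(z)$.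 For a complete orthonormal system $\{\xi_k\}$ of $\mathfrak{H}_{\mathbb{C}}$, $\mathcal{I}_{p,q}$ is the linear isometry from $\mathfrak{H}_{\mathbb{C}}^{\odot p}\otimes\mathfrak{H}_{\mathbb{C}}^{\odot q}$ with norm $\sqrt{p!q!}\|\cdot\|$ into $L^2_{\mathbb{C}}(\Omega)$ given by $\mathcal{I}_{p,q}(\mathrm{symm}(\otimes_k\xi_k^{\otimes p_k})\otimes\mathrm{symm}(\otimes_k\overline{\xi}_k^{\otimes q_k}))=\prod_k2^{-(p_k+q_k)/2}J_{p_k,q_k}(\sqrt2Z(\xi_k))$, for sequences $\{p_k\},\{q_k\}$ of non-negative integers with sums $p$ and $q$. By convention $\mathcal{I}_{p,q}(e_{k_1}\otimes\cdots\otimes e_{k_p}\otimes\overline{e_{j_1}}\otimes\cdots\otimes\overline{e_{j_q}})=\mathcal{I}_{p,q}(\mathrm{symm}(e_{k_1}\otimes\cdots\otimes e_{k_p})\otimes\mathrm{symm}(\overline{e_{j_1}}\otimes\cdots\otimes\overline{e_{j_q}}))$. $\{e_k\}_{k\ge1}$ is a complete orthogonal system in $\mathfrak{H}_{\mathbb{C}}$ with $\|e_k\|_{\mathfrak{H}_{\mathbb{C}}}=\sqrt2$. *)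

(* Defs.v *)
From HB Require Import structures.
From mathcomp Require Import all_boot all_order all_algebra all_fingroup.
From mathcomp Require Import finmap complex.
From mathcomp Require Import all_classical all_reals all_analysis.
From mathcomp Require summability.
Set Implicit Arguments.
Unset Strict Implicit.
Unset Printing Implicit Defensive.
Import Order.TTheory GRing.Theory Num.Theory.
Import numFieldNormedType.Exports.

Local Open Scope classical_set_scope.
Local Open Scope ring_scope.
Local Open Scope complex_scope.

(* A Hilbert space is a complete normed module
   whose norm comes from an inner product: [{dot H for idfun}] over [R] and
   [{dot T for conjC}], linear in the first variable, over [R[i]]. *)

Definition norm_from_dot (K : numFieldType) (theta : K -> K)
    (V : normedModType K) (ip : {dot V for theta}) : Prop :=
  forall v : V, `|v| ^+ 2 = ip v v.

Definition separable (T : topologicalType) : Prop :=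
  exists2 D : set T, countable D & dense D.

Definition lin_span (K : pzRingType) (V : lmodType K) (A : set V) : set V :=
  [set t | exists n (c : 'I_n -> K) (a : 'I_n -> V),
     (forall i, A (a i)) /\ t = \sum_(i < n) c i *: a i].

(* The complexification of [H]: the pair [(f, g)] stands for [f + i g]. *)

Definition complexification (R : realType) (H : lmodType R) : Type :=
  (H * H)%type.

Section Complexification.
Context {R : realType} {H : lmodType R}.
Local Notation HC := (complexification H).

HB.instance Definition _ := GRing.Zmodule.copy HC (H * H)%type.

Definition cplx_scale (a : R[i]) (h : HC) : HC :=
  (complex.Re a *: h.1 - complex.Im a *: h.2,
   complex.Re a *: h.2 + complex.Im a *: h.1).

Fact cplx_scaleA a b (h : HC) :
  cplx_scale a (cplx_scale b h) = cplx_scale (a * b) h.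
Proof.
case: a b h => [a a'] [b b'] [f g]; congr pair => /=.
  rewrite scalerBr scalerDr !scalerA scalerBl scalerDl !opprD -!addrA.
  by congr (_ + _); rewrite addrA addrC.
rewrite scalerBr scalerDr !scalerA scalerBl scalerDl -!addrA.
by congr (_ + _); rewrite addrA addrC.
Qed.

Fact cplx_scale1 : left_id 1 cplx_scale.
Proof.
by case=> f g; congr pair => /=; rewrite scale1r scale0r ?subr0 ?addr0.
Qed.

Fact cplx_scaleDr : right_distributive cplx_scale +%R.
Proof.
move=> a [f g] [f' g']; congr pair => /=; rewrite !scalerDr ?opprD;
  exact: addrACA.
Qed.

Fact cplx_scaleDl (h : HC) : {morph cplx_scale^~ h : a b / a + b}.
Proof.
case: h => f g [a a'] [b b']; congr pair => /=; rewrite !scalerDl ?opprD;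
  exact: addrACA.
Qed.

HB.instance Definition _ := GRing.Zmodule_isLmodule.Build R[i] HC
  cplx_scaleA cplx_scale1 cplx_scaleDr cplx_scaleDl.

Definition cplx_conj (h : HC) : HC := (h.1, - h.2).

(* <f + i g, f' + i g'>, expanded linearly in the first variable and
   antilinearly in the second. *)
Definition cplx_dot (ip : H -> H -> R) (h h' : HC) : R[i] :=
  (ip h.1 h'.1 + ip h.2 h'.2) +i* (ip h.2 h'.1 - ip h.1 h'.2).

Definition cplx_norm (ip : H -> H -> R) (h : HC) : R :=
  Num.sqrt (complex.Re (cplx_dot ip h h)).

Definition complete_orthogonal (ip : H -> H -> R) (e : nat -> HC) : Prop :=
  (forall k l, k != l -> cplx_dot ip (e k) (e l) = 0) /\
  (forall h, (forall k, cplx_dot ip h (e k) = 0) -> h = 0).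

Definition complete_orthonormal (ip : H -> H -> R) (xi : nat -> HC) : Prop :=
  complete_orthogonal ip xi /\ forall k, cplx_norm ip (xi k) = 1.

End Complexification.

Section Tensor.
Context {R : realType} {H : lmodType R} (ip : H -> H -> R).
Local Notation HC := (complexification H).

(* [tens] exhibits the Hilbert space [T] as the [n]-th Hilbert tensor power of
   the complexification of [H]; this determines [T] up to a unitary isomorphism
   compatible with [tens]. *)
Record is_tensor_power (n : nat) (T : completeNormedModType R[i])
    (dotT : {dot T for @Num.conj R[i]}) (tens : ('I_n -> HC) -> T) : Prop := {
  tensor_norm : norm_from_dot dotT ;
  tensor_linear : forall (u : 'I_n -> HC) (i : 'I_n) (a : R[i]) (x y : HC),
    tens (dfwith u i (a *: x + y)) =
    a *: tens (dfwith u i x) + tens (dfwith u i y) ;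
  tensor_dot : forall u v : 'I_n -> HC,
    dotT (tens u) (tens v) = \prod_(i < n) cplx_dot ip (u i) (v i) ;
  tensor_total : dense (lin_span (range tens)) }.

Definition fcat (A : Type) (p q : nat) (u : 'I_p -> A) (v : 'I_q -> A) :
    'I_(p + q) -> A :=
  fun i => match fintype.split i with inl i1 => u i1 | inr i2 => v i2 end.

Context {p q : nat} {T : completeNormedModType R[i]}.
Variable tens : ('I_(p + q) -> HC) -> T.

(* symm(u_1 (x) ... (x) u_p) (x) symm(v_1 (x) ... (x) v_q), in the
   (p + q)-th tensor power. *)
Definition symm_tensor (u : 'I_p -> HC) (v : 'I_q -> HC) : T :=
  (p`! * q`!)%:R^-1 *:
    \sum_(s : 'S_p) \sum_(t : 'S_q)
      tens (fcat (fun i => u (s i)) (fun i => v (t i))).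

(* The tensor product of the [p]-th and [q]-th symmetric tensor powers, as a
   closed subspace of the (p + q)-th tensor power, with the induced norm. *)
Definition symm_tensor_space : set T :=
  closure (lin_span [set t | exists u v, t = symm_tensor u v]).

End Tensor.

Section Gaussian.
Context {d : measure_display} {Omega : measurableType d} {R : realType}.
Variable P : probability Omega R.

(* The library's [normal_prob 0 0] is a junk value (uniform on [0, 1]), hence
   the separate case of the degenerate law. *)
Definition has_centered_gaussian_law (U : Omega -> R) : Prop :=
  exists s : R, forall B : set R, measurable B ->
    pushforward P U B =
    if s == 0 then dirac (0 : R) B else normal_prob 0 s B.

Definition centered_gaussian_family (I : Type) (X : I -> {RV P >-> R}) : Prop :=
  forall (n : nat) (c : 'I_n -> R) (h : 'I_n -> I),
    has_centered_gaussian_law (fun w => \sum_(i < n) c i * X (h i) w).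

Definition isonormal (H : lmodType R) (ip : H -> H -> R)
    (X : H -> {RV P >-> R}) : Prop :=
  centered_gaussian_family X /\
  forall h g : H, 'E_P[fun w => (X h w * X g w)%R]%E = (ip h g)%:E.

Definition sigma_of_family (I : Type) (X : I -> {RV P >-> R}) :
    set (set Omega) :=
  <<s [set A | exists h (B : set R), measurable B /\ A = X h @^-1` B] >>.

Definition independent_families (I I' : Type) (X : I -> {RV P >-> R})
    (Y : I' -> {RV P >-> R}) : Prop :=
  forall A B, sigma_of_family X A -> sigma_of_family Y B ->
    P (A `&` B) = (P A * P B)%E.

Section ComplexProcess.
Context {H : lmodType R}.
Local Notation HC := (complexification H).

Definition complexify (X : H -> {RV P >-> R}) (h : HC) (w : Omega) : R[i] :=
  X h.1 w +i* X h.2 w.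

Definition complex_isonormal (X Y : H -> {RV P >-> R}) (h : HC) (w : Omega) :
    R[i] :=
  (complexify X h w + 'i * complexify Y h w) / (Num.sqrt 2)%:C.

End ComplexProcess.

End Gaussian.

Definition cexp (R : realType) (z : R[i]) : R[i] :=
  (expR (complex.Re z))%:C * (cos (complex.Im z) +i* sin (complex.Im z)).

(* [J p q] is J_{p,q}: the double series converges unconditionally, i.e. along
   the net of the finite sets of indices, so that it determines every J_{p,q}.
   The series is compared in [R[i]^o], which carries the normed topology. *)
Definition is_complex_hermite (R : realType) (J : nat -> nat -> R[i] -> R[i]) :
    Prop :=
  forall lambda z : R[i],
    summability.partial_sum (fun pq : nat * nat =>
        (lambda^* ^+ pq.1 * lambda ^+ pq.2) / (pq.1`! * pq.2`!)%:R
        * J pq.1 pq.2 z)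
      @ summability.totally
    --> (cexp (lambda * z^* + lambda^* * z - 2 * `|lambda| ^+ 2) : R[i]^o).

Section WienerIto.
Context {d : measure_display} {Omega : measurableType d} {R : realType}.
Variable P : probability Omega R.
Context {H : lmodType R}.
Local Notation HC := (complexification H).
Variables (J : nat -> nat -> R[i] -> R[i]) (Z : HC -> Omega -> R[i]).

(* The indices 0, ..., 0, 1, ..., 1, ..., N-1, each [k] occurring [m k] times,
   so that the tensor product of the [xi (multi_index N m i)] over [i] is the
   product over [k < N] of the tensor powers of order [m k] of the [xi k]. *)
Definition multi_index (N : nat) (m : nat -> nat) (i : nat) : nat :=
  nth 0%N (flatten [seq nseq (m k) k | k <- iota 0 N]) i.

Context {p q : nat} {T : completeNormedModType R[i]}.
Variables (tens : ('I_(p + q) -> HC) -> T) (xi : nat -> HC).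

(* [I t] is a version of the square-integrable random variable I_{p,q}(t), for
   [t] in the symmetric subspace. A sequence of non-negative integers of finite
   sum is given by a bound [N] on its support and its terms below [N]. *)
Record is_wiener_ito (I : T -> Omega -> R[i]) : Prop := {
  wiener_ito_measurable : forall t, symm_tensor_space tens t ->
    measurable_fun [set: Omega] (fun w => complex.Re (I t w)) /\
    measurable_fun [set: Omega] (fun w => complex.Im (I t w)) ;
  wiener_ito_linear : forall (a : R[i]) s t,
    symm_tensor_space tens s -> symm_tensor_space tens t ->
    {ae P, forall w, I (a *: s + t) w = a * I s w + I t w} ;
  wiener_ito_isometry : forall t, symm_tensor_space tens t ->
    'E_P[fun w => complex.Re (`|I t w| ^+ 2)%R]%E =
    (complex.Re ((p`! * q`!)%:R * `|t| ^+ 2))%:E ;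
  wiener_ito_hermite : forall (N : nat) (pk qk : nat -> nat),
    (\sum_(k < N) pk k)%N = p -> (\sum_(k < N) qk k)%N = q ->
    {ae P, forall w,
      I (symm_tensor tens (fun i => xi (multi_index N pk i))
                          (fun i => cplx_conj (xi (multi_index N qk i)))) w
      = \prod_(k < N) ((Num.sqrt 2)%:C ^- (pk k + qk k) *
                       J (pk k) (qk k) ((Num.sqrt 2)%:C * Z (xi k) w))} }.

End WienerIto.

(* I_{p,q}(u_1 (x) ... (x) u_p (x) v_1 (x) ... (x) v_q): the argument is by
   convention symmetrized separately in the first [p] and the last [q]
   variables. *)
Definition wiener_ito_tensor (R : realType) (H : lmodType R) (Omega : Type)
    (p q : nat) (T : completeNormedModType R[i])
    (tens : ('I_(p + q) -> complexification H) -> T)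
    (I : T -> Omega -> R[i])
    (u : 'I_p -> complexification H) (v : 'I_q -> complexification H) :
    Omega -> R[i] :=
  I (symm_tensor tens u v).

Definition absolutely_continuous_law2 (d : measure_display)
    (Omega : measurableType d) (R : realType) (P : probability Omega R)
    (F1 F2 : Omega -> R) : Prop :=
  pushforward P (fun w => (F1 w, F2 w) : R * R)
    `<< (@lebesgue_measure R \x @lebesgue_measure R)%E.

(* Main.v *)
Require Import Defs.
From HB Require Import structures.
From mathcomp Require Import all_boot all_order all_algebra all_fingroup.
From mathcomp Require Import finmap complex.
From mathcomp Require Import ring lra measurable_realfun.
From mathcomp Require Import all_classical all_reals all_analysis.
From mathcomp Require summability.
Import Order.TTheory GRing.Theory Num.Theory.
Import numFieldNormedType.Exports.
Local Open Scope classical_set_scope.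
Local Open Scope ring_scope.
Set Implicit Arguments.
Unset Strict Implicit.
Unset Printing Implicit Defensive.

(** Write [mult k l] for the number of occurrences of [l] among the indices
    [k_1, ..., k_p]. The variable [F = F1 + i F2] is almost surely the product,
    over [l], of the Wick powers [wick 2 (mult k l) (mult j l)] of the variables
    [Z (e_l)], where [wick c m n z] is [z^m z^*^n] minus lower order terms.
    The condition of the theorem says that the two multiplicities differ for
    some [l], and the theorem follows from two properties of Wick powers.

    - [wick c m n z] and [wick c n m z] are conjugate ([wick_conj]). If all
      multiplicities agree, then [F] is real, and its law, carried by a line,
      is singular ([not_absolutely_continuous_real]).

    - [wick c m n] has charge [m - n]: rotating the argument by an angle [b]
      rotates the value by [(m - n) b] ([wick_cis]). If [m <> n] for some [l],
      then the law of [F] is rotation invariant, because that of [Z (e_l)] is,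
      given the other factors. Such a law has a density as soon as that of the
      squared modulus charges no null set ([rotation_invariant_null]).
      Conditionally on the other factors and on the real part of [Z (e_l)],
      the squared modulus of [F] is a nonconstant polynomial in the imaginary
      part, which is Gaussian, and nonconstant polynomials pull null sets back
      to null sets ([polynomial_preimage_negligible]). This is the content of
      [wick_product_density].

    The factorization of [F] is obtained in three steps. A complex Hermite
    polynomial is a Wick power ([hermite_wick]): on each ray of the plane the
    generating function is a real exponential, whose coefficients obey the
    recursion of the Wick powers. Then, for arbitrary vectors, the integral of
    a symmetrized tensor is the Wick product of the corresponding variables,
    a product from which all contractions are subtracted ([wiener_ito_wick]):
    both sides are multilinear and continuous, outside null sets, and by the
    first step they agree on the orthonormal system that defines the integral.
    Finally distinct vectors of an orthogonal system do not contract, so that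
    there the Wick product is a product of Wick powers
    ([wick_prod_orthogonal]).

    Independence comes from the Fourier transform. The real part of [Z] is a
    Gaussian family that determines its imaginary part, and [fourier_indep]
    records that a variable is independent of the part of this family indexed
    by some set of vectors. The Gaussian variables are revealed one at a time
    ([fourier_indep_step]), the uniqueness theorem for the Fourier transform on
    the line ([fourier_measure_unique]) being applied at each step. *)

(** * Measures with a density *)

Section density.
Local Open Scope ereal_scope.
Context d (T : measurableType d) (R : realType).

(** The density is almost everywhere the Radon-Nikodym derivative. *)
Lemma ge0_integral_density (nu : {finite_measure set T -> \bar R})
    (mu : {sigma_finite_measure set T -> \bar R}) (k : T -> R) (f : T -> \bar R) :
  (forall x, (0 <= k x)%R) -> measurable_fun setT k ->
  (forall D, measurable D -> nu D = \int[mu]_(x in D) (k x)%:E) ->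
  measurable_fun setT f -> (forall x, 0 <= f x) ->
  \int[nu]_x f x = \int[mu]_x (f x * (k x)%:E).
Proof.
move=> k0 mk nuE mf f0.
have mkE : measurable_fun setT (fun x => (k x)%:E) by exact/measurable_EFinP.
have numu : nu `<< mu.
  apply/null_content_dominatesP => D mD D0; rewrite nuE//.
  by apply: null_set_integral => //; exact: measurable_funTS.
rewrite -(Radon_Nikodym_SigmaFinite.change_of_variables numu f0 measurableT mf).
have ig := Radon_Nikodym_SigmaFinite.f_integrable numu.
apply: ae_eq_integral => //; try by apply: emeasurable_funM => //; exact: (measurable_int mu).
have : ae_eq mu setT (Radon_Nikodym_SigmaFinite.f nu mu) (fun x => (k x)%:E).
  apply: integral_ae_eq => // E _ mE.
  by rewrite -nuE// -Radon_Nikodym_SigmaFinite.f_integral.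
by apply: filterS => x /= kE xT; rewrite kE.
Qed.

End density.

Section bounded.
Context d (T : measurableType d) (R : realType).

Lemma bounded_integrable (mu : {finite_measure set T -> \bar R}) (f : T -> R) M :
  measurable_fun setT f -> (forall x, `|f x| <= M) ->
  mu.-integrable setT (EFin \o f).
Proof.
move=> mf fM; apply: measurable_bounded_integrable => //.
  by rewrite -ge0_fin_numE// fin_num_measure.
by exists M; split; rewrite ?num_real// => x xM t _ /=; exact: le_trans (ltW xM).
Qed.

Lemma Rintegral_density (nu : {finite_measure set T -> \bar R})
    (mu : {sigma_finite_measure set T -> \bar R}) (k f : T -> R) M :
  (forall x, 0 <= k x) -> measurable_fun setT k ->
  mu.-integrable setT (EFin \o k) ->
  (forall D, measurable D -> nu D = \int[mu]_(x in D) (k x)%:E)%E ->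
  measurable_fun setT f -> (forall x, `|f x| <= M) ->
  \int[nu]_x f x = \int[mu]_x (f x * k x).
Proof.
move=> k0 mk ik nuE mf fM.
have M0 x : 0 <= f x + M.
  by have := fM x; rewrite ler_norml => /andP[]; rewrite -subr_ge0 opprK addrC.
have ifn : nu.-integrable setT (EFin \o f) by exact: bounded_integrable fM.
have ifk : mu.-integrable setT (EFin \o (fun x => f x * k x)).
  apply: (@le_integrable _ _ _ mu _ measurableT _ (fun x => (M * k x)%:E)).
  - by apply/measurable_EFinP/measurable_funM.
  - move=> x _; rewrite /= lee_fin !normrM (ger0_norm (k0 x)) ler_wpM2r//.
    by rewrite (le_trans (fM x))// ler_norm.
  - by under eq_fun do rewrite EFinM; apply: integrableZl.
have : (\int[nu]_x (f x + M)%:E = \int[mu]_x ((f x + M)%:E * (k x)%:E))%E.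
  apply: ge0_integral_density => //; first exact/measurable_EFinP/measurable_funD.
move/(congr1 fine).
rewrite -/(Rintegral nu setT (fun x => f x + M)) RintegralD//; last first.
  by apply: bounded_integrable => //= x; exact: lexx.
under eq_integral do rewrite -EFinM mulrDl.
rewrite -/(Rintegral mu setT (fun x => f x * k x + M * k x)) RintegralD//; last first.
  by rewrite /comp; under eq_fun do rewrite EFinM; apply: integrableZl.
rewrite RintegralZl// [X in M * X](_ : _ = fine (nu setT)); last first.
  by rewrite nuE.
by rewrite Rintegral_cst//; exact: addIr.
Qed.

End bounded.

(** * Gaussian integrals *)

Section trigonometric.
Context {R : realType}.

Lemma measurable_cos : measurable_fun setT (@cos R).
Proof. exact: continuous_measurable_fun (@continuous_cos R). Qed.

Lemma measurable_sin : measurable_fun setT (@sin R).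
Proof. exact: continuous_measurable_fun (@continuous_sin R). Qed.

Lemma measurable_cosZ (t : R) : measurable_fun setT (fun x : R => cos (t * x)).
Proof. by apply: measurableT_comp measurable_cos _; exact: measurable_funM. Qed.

Lemma measurable_sinZ (t : R) : measurable_fun setT (fun x : R => sin (t * x)).
Proof. by apply: measurableT_comp measurable_sin _; exact: measurable_funM. Qed.

End trigonometric.

Section whole_line.
Context {R : realType}.
Notation mu := (@lebesgue_measure R).

(** The fundamental theorem of calculus on [[-n, n]], in the limit. *)
Lemma Rintegral_derive_line (F f : R -> R) :
  (forall x, is_derive x (1 : R) F (f x)) -> continuous f ->
  mu.-integrable setT (EFin \o f) ->
  F n%:R @[n --> \oo] --> 0 -> F (- n%:R) @[n --> \oo] --> 0 ->
  \int[mu]_x f x = 0.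
Proof.
move=> dF cf If Fy FNy.
have mf : measurable_fun setT f by exact: continuous_measurable_fun.
pose I n : set R := [set` `[- n.+1%:R, n.+1%:R]].
have cF : continuous F.
  move=> x; apply: differentiable_continuous; apply/derivable1_diffP.
  exact: (@ex_derive _ _ _ _ _ _ _ (dF x)).
have IE n : (\int[mu]_x ((f \_ (I n)) x)%:E = (F n.+1%:R - F (- n.+1%:R))%:E)%E.
  transitivity (\int[mu]_(x in I n) (f x)%:E)%E.
    rewrite [RHS]integral_mkcond; apply: eq_integral => x _.
    by rewrite restrict_EFin.
  rewrite EFinB; apply: continuous_FTC2.
  - by rewrite gtrN// ltr0n.
  - exact: continuous_subspaceT.
  - split; first by move=> x _; exact: (@ex_derive _ _ _ _ _ _ _ (dF x)).
      exact/cvg_at_right_filter/cF.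
    exact/cvg_at_left_filter/cF.
  - by move=> x _; rewrite derive1E (@derive_val _ _ _ _ _ _ _ (dF x)).
have lim1 : (\int[mu]_x ((f \_ (I n)) x)%:E)%E @[n --> \oo] -->
    (\int[mu]_x (f x)%:E)%E.
  apply: (@dominated_cvg _ _ _ mu _ measurableT (fun n x => ((f \_ (I n)) x)%:E)
    (fun x => (f x)%:E) (fun x => `|(f x)%:E|%E)) => //.
  - move=> n; apply/measurable_EFinP/(measurable_restrictT _ _).1 => //.
      exact: measurable_itv.
    exact: measurable_funTS.
  - move=> x _; apply: cvg_near_cst.
    exists (Num.truncn `|x|) => // n /= xn; rewrite patchE ifT// inE /I /=.
    rewrite in_itv /= -ler_norml.
    have := real_truncnS_gt (num_real `|x|) => /ltW /le_trans; apply.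
    by rewrite ler_nat.
  - exact: integrable_abse.
  - by move=> n x _; rewrite patchE; case: ifP => // _; rewrite /= lee_fin normr0.
have lim2 : (\int[mu]_x ((f \_ (I n)) x)%:E)%E @[n --> \oo] --> (0%E : \bar R).
  apply: (@cvg_trans _ ((F n.+1%:R - F (- n.+1%:R))%:E @[n --> \oo])).
    by apply: near_eq_cvg; apply: nearW => n; rewrite IE.
  apply: cvg_EFin; first exact: nearW.
  rewrite -[X in _ --> X](subr0 0); apply: cvgB.
    by rewrite (cvg_shiftS (fun n => F n%:R)).
  by rewrite (cvg_shiftS (fun n => F (- n%:R))).
by rewrite /Rintegral (cvg_unique _ lim1 lim2).
Qed.

End whole_line.

Section gaussian.
Context {R : realType}.
Notation mu := (@lebesgue_measure R).
Variables (m s : R).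
Hypothesis s0 : s != 0.
Let phi := normal_pdf m s.

Let s2_gt0 : 0 < s ^+ 2. Proof. by rewrite exprn_even_gt0. Qed.

Let phiE x : phi x = normal_peak s * expR (- (x - m) ^+ 2 / (s ^+ 2 *+ 2)).
Proof. by rewrite /phi normal_pdfE. Qed.

Let phi_ge0 x : 0 <= phi x. Proof. exact: normal_pdf_ge0. Qed.

Let cphi : continuous phi. Proof. exact: continuous_normal_pdf. Qed.

Let mphi : measurable_fun setT phi. Proof. exact: measurable_normal_pdf. Qed.

Let dphi x : is_derive x (1 : R) phi (- ((x - m) / s ^+ 2) * phi x).
Proof.
have -> : phi = (fun x => normal_peak s * expR (- (x - m) ^+ 2 / (s ^+ 2 *+ 2))).
  exact/funext/phiE.
apply: is_derive_eq; rewrite !scaler0 !add0r.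
by rewrite /GRing.scale /=; field.
Qed.

(* a quadratic weight costs at most the square root of the Gaussian factor *)
Let quad_le (x : R) : 1 + (x - m) ^+ 2 <=
  (1 + 4 * s ^+ 2) * expR ((x - m) ^+ 2 / (s ^+ 2 * 4)).
Proof.
set v := _ / _.
have -> : (x - m) ^+ 2 = (s ^+ 2 * 4) * v.
  by rewrite /v mulrC divfK// mulf_neq0 ?gt_eqF.
have v0 : 0 <= v by rewrite divr_ge0 ?sqr_ge0// mulr_ge0// ltW.
apply: le_trans (_ : (1 + 4 * s ^+ 2) * (1 + v) <= _); last first.
  by rewrite ler_wpM2l ?expR_ge1Dx//; have := s2_gt0; lra.
have := s2_gt0; nra.
Qed.

Let quad_phi_integrable :
  mu.-integrable setT (EFin \o (fun x => (1 + (x - m) ^+ 2) * phi x)).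
Proof.
have s20 : s * Num.sqrt 2 != 0 by rewrite mulf_neq0// gt_eqF ?sqrtr_gt0.
pose C := (1 + 4 * s ^+ 2) * normal_peak s / normal_peak (s * Num.sqrt 2).
have [C0 p0] : 0 <= C /\ 0 < normal_peak (s * Num.sqrt 2).
  rewrite normal_peak_gt0// divr_ge0 ?normal_peak_ge0// mulr_ge0 ?normal_peak_ge0//.
  by have := s2_gt0; lra.
apply: (@le_integrable _ _ _ mu _ measurableT _
  (fun x => (C * normal_pdf m (s * Num.sqrt 2) x)%:E)).
- apply/measurable_EFinP/measurable_funM => //.
  by apply: measurable_funD => //; apply: measurable_funX; exact: measurable_funD.
- move=> x _ /=; rewrite lee_fin !ger0_norm; last 2 first.
    by rewrite mulr_ge0 ?normal_pdf_ge0.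
    by rewrite mulr_ge0 ?addr_ge0 ?sqr_ge0.
  rewrite (normal_pdfE _ s20) phiE /C.
  rewrite [leRHS](_ : _ = ((1 + 4 * s ^+ 2) * normal_peak s) *
    normal_fun m (s * Num.sqrt 2) x); last by field; rewrite gt_eqF.
  apply: le_trans (_ : ((1 + 4 * s ^+ 2) * expR ((x - m) ^+ 2 / (s ^+ 2 * 4))) *
     (normal_peak s * expR (- (x - m) ^+ 2 / (s ^+ 2 *+ 2))) <= _).
    by rewrite ler_wpM2r// mulr_ge0 ?expR_ge0// normal_peak_ge0.
  rewrite mulrACA -expRD /normal_fun le_eqVlt; apply/orP; left; apply/eqP.
  congr (_ * expR _); rewrite exprMn sqr_sqrtr//; by field.
- by under eq_fun do rewrite EFinM; apply: integrableZl => //; exact: integrable_normal_pdf.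
Qed.

Lemma affine_phi_integrable (h : R -> R) (A : R) :
  measurable_fun setT h -> (forall x, `|h x| <= A * (1 + (x - m) ^+ 2)) ->
  mu.-integrable setT (EFin \o (fun x => h x * normal_pdf m s x)).
Proof.
move=> mh hA; apply: (@le_integrable _ _ _ mu _ measurableT _
  (fun x => (A * ((1 + (x - m) ^+ 2) * phi x))%:E)).
- exact/measurable_EFinP/measurable_funM.
- move=> x _ /=; rewrite lee_fin normrM (ger0_norm (phi_ge0 x)).
  apply: le_trans (ler_norm _); rewrite mulrA.
  by rewrite ler_wpM2r.
- under eq_fun do rewrite EFinM.
  by apply: integrableZl => //; exact: quad_phi_integrable.
Qed.

Let phi_decay (x : R) : (1 + (x - m) ^+ 2) * phi x <=
  (1 + 4 * s ^+ 2) ^+ 2 * normal_peak s / (1 + (x - m) ^+ 2).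
Proof.
have t0 : 0 < 1 + (x - m) ^+ 2 by rewrite ltr_pwDl ?sqr_ge0.
have K0 : 0 <= 1 + 4 * s ^+ 2 by have := s2_gt0; lra.
rewrite ler_pdivlMr// mulrAC phiE -expr2.
apply: le_trans (_ : ((1 + 4 * s ^+ 2) * expR ((x - m) ^+ 2 / (s ^+ 2 * 4))) ^+ 2 *
   (normal_peak s * expR (- (x - m) ^+ 2 / (s ^+ 2 *+ 2))) <= _).
  rewrite ler_wpM2r ?mulr_ge0 ?expR_ge0 ?normal_peak_ge0//.
  by rewrite lerXn2r ?nnegrE ?mulr_ge0 ?expR_ge0 ?(ltW t0).
rewrite exprMn -expRM_natl mulrACA -expRD -[leRHS]mulr1 ler_wpM2l//.
  by rewrite mulr_ge0 ?exprn_ge0 ?normal_peak_ge0.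
rewrite expR_le1 le_eqVlt; apply/orP; left; apply/eqP; by field.
Qed.

(** The derivative of the density is [- (x - m) / s^2] times the density, and
    the growth conditions make the boundary terms vanish. *)
Lemma gaussian_by_parts (g g' : R -> R) (A : R) :
  (forall x, is_derive x (1 : R) g (g' x)) -> continuous g' ->
  (forall x, `|g x| <= A * (1 + `|x - m|)) -> (forall x, `|g' x| <= A) ->
  \int[mu]_x ((x - m) * g x * normal_pdf m s x) =
  s ^+ 2 * \int[mu]_x (g' x * normal_pdf m s x).
Proof.
move=> dg cg' gA g'A.
have A0 : 0 <= A by exact: le_trans (g'A 0).
have cg : continuous g.
  move=> x; apply: differentiable_continuous; apply/derivable1_diffP.
  exact: (@ex_derive _ _ _ _ _ _ _ (dg x)).
have mg := continuous_measurable_fun cg; have mg' := continuous_measurable_fun cg'.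
have mxm : measurable_fun setT (fun x : R => x - m) by exact: measurable_funD.
have absq (t : R) : 1 + `|t| <= 2 * (1 + t ^+ 2).
  by rewrite -[t ^+ 2]real_normK ?num_real//; have := sqr_ge0 (`|t| - 1); nra.
have absq2 (t : R) : `|t| * (1 + `|t|) <= 2 * (1 + t ^+ 2).
  by rewrite -[t ^+ 2]real_normK ?num_real//; have := sqr_ge0 (`|t| - 1); nra.
have i1 : mu.-integrable setT (EFin \o (fun x => (x - m) * g x * phi x)).
  apply: (@affine_phi_integrable _ (A * 2)); first exact: measurable_funM.
  move=> x; rewrite normrM; apply: le_trans (_ : `|x - m| * (A * (1 + `|x - m|)) <= _).
    by rewrite ler_wpM2l.
  by rewrite mulrCA -mulrA ler_wpM2l.
have i2 : mu.-integrable setT (EFin \o (fun x => g' x * phi x)).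
  apply: (@affine_phi_integrable _ A) => // x; apply: (le_trans (g'A x)).
  by rewrite ler_peMr// lerDl sqr_ge0.
have i3 : mu.-integrable setT (EFin \o (fun x => s ^+ 2 * (g' x * phi x))).
  by rewrite /comp; under eq_fun do rewrite EFinM; apply: integrableZl.
apply/eqP; rewrite -RintegralZl// eq_sym -subr_eq0 -RintegralB//; apply/eqP.
pose F x := s ^+ 2 * (g x * phi x).
have decay x : `|F x| <= (s ^+ 2 * A * 2 * ((1 + 4 * s ^+ 2) ^+ 2 * normal_peak s)) *
    (1 + (x - m) ^+ 2)^-1.
  rewrite /F normrM (gtr0_norm s2_gt0) normrM (ger0_norm (phi_ge0 x)).
  set K := _ * normal_peak s; set D := _^-1.
  rewrite [leRHS](_ : _ = s ^+ 2 * (A * (2 * (K * D)))); last by ring.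
  rewrite ler_wpM2l ?(ltW s2_gt0)//.
  apply: le_trans (_ : A * (1 + `|x - m|) * phi x <= _).
    by rewrite ler_wpM2r.
  rewrite -mulrA ler_wpM2l//; apply: le_trans (_ : 2 * ((1 + (x - m) ^+ 2) * phi x) <= _).
    by rewrite mulrA ler_wpM2r.
  by rewrite ler_wpM2l// phi_decay.
have cvgF (u : nat -> R) : (forall n, (n%:R - `|m|) <= `|u n - m|) ->
    F (u n) @[n --> \oo] --> 0.
  move=> un; apply/cvgr0Pnorm_le => e e0.
  set C := (s ^+ 2 * A * 2 * ((1 + 4 * s ^+ 2) ^+ 2 * normal_peak s)) in decay.
  have C0 : 0 <= C.
    apply: mulr_ge0; last by apply: mulr_ge0; rewrite ?sqr_ge0 ?normal_peak_ge0.
    by apply: mulr_ge0 => //; apply: mulr_ge0 => //; exact: ltW.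
  exists (Num.truncn (C / e + `|m|)).+1 => // n /= ln; apply: (le_trans (decay _)).
  have : C / e + `|m| < n%:R.
    apply: (lt_le_trans (real_truncnS_gt (num_real _))); by rewrite ler_nat.
  rewrite -ltrBrDr => /lt_le_trans /(_ (un n)) h.
  rewrite ler_pdivrMr ?ltr_pwDl ?sqr_ge0// mulrC -ler_pdivrMr//.
  apply: (le_trans (ltW h)); rewrite -[(_ - m) ^+ 2]real_normK ?num_real//.
  by have := sqr_ge0 (`|u n - m| - 1); have := normr_ge0 (u n - m); nra.
apply: (@Rintegral_derive_line _ F
  (fun x => s ^+ 2 * (g' x * phi x) - (x - m) * g x * phi x)).
- move=> x; have dgx := dg x; have dpx := dphi x.
  rewrite /F -/(phi x); apply: is_derive_eq; rewrite /GRing.scale /=.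
  by field.
- move=> x; apply: cvgB; apply: cvgM.
  + exact: cvg_cst.
  + by apply: cvgM; [exact: cg'|exact: cphi].
  + by apply: cvgM; [apply: cvgB; [exact: cvg_id|exact: cvg_cst]|exact: cg].
  + exact: cphi.
- by rewrite /comp; under eq_fun do rewrite EFinB; exact: integrableB.
- apply: cvgF => n; apply: (le_trans _ (lerB_dist _ _)).
  by rewrite lerB// ger0_norm.
- apply: cvgF => n; rewrite -opprD normrN; apply: (le_trans _ (lerB_normD _ _)).
  by rewrite lerB// ger0_norm.
Qed.

Lemma gaussian_moment2 :
  \int[mu]_x ((x - m) ^+ 2 * normal_pdf m s x) = s ^+ 2.
Proof.
transitivity (\int[mu]_x ((x - m) * (x - m) * normal_pdf m s x)).
  by apply: eq_Rintegral => x _; rewrite expr2.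
rewrite (@gaussian_by_parts (fun x => x - m) (fun=> 1) 1 _).
- rewrite -[RHS]mulr1; congr (_ * _); rewrite /Rintegral.
  under eq_integral do rewrite mul1r.
  by rewrite integral_normal_pdf.
- by move=> x; apply: is_derive_eq; rewrite subr0.
- by move=> x; exact: cvg_cst.
- by move=> x; rewrite mul1r lerDr.
- by move=> x; rewrite normr1.
Qed.

End gaussian.

Section gaussian_fourier.
Context {R : realType}.
Notation mu := (@lebesgue_measure R).
Variable s : R.
Hypothesis s0 : s != 0.
Notation phi := (normal_pdf 0 s).

(** The Fourier transform of a centered Gaussian solves [F' = - s^2 t F]; the
    cosine and the sine are treated at once. *)
Lemma gaussian_fourier_ode (c c' : R -> R) :
  (forall x, is_derive x (1 : R) c (c' x)) ->
  (forall x, is_derive x (1 : R) c' (- c x)) ->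
  (forall x, `|c x| <= 1) -> (forall x, `|c' x| <= 1) ->
  forall t, \int[mu]_x (c (t * x) * phi x) = c 0 * expR (- (s ^+ 2 * t ^+ 2) / 2).
Proof.
move=> dc dc' c1 c'1.
have cc : continuous c.
  move=> x; apply: differentiable_continuous; apply/derivable1_diffP.
  exact: (@ex_derive _ _ _ _ _ _ _ (dc x)).
have cc' : continuous c'.
  move=> x; apply: differentiable_continuous; apply/derivable1_diffP.
  exact: (@ex_derive _ _ _ _ _ _ _ (dc' x)).
have ctx (t : R) : continuous (fun x : R => t * x) by exact: mulrl_continuous.
have mc (t : R) : measurable_fun setT (fun x : R => c (t * x)).
  by apply: continuous_measurable_fun => x; apply: continuous_comp; [exact: ctx|exact: cc].
have mc' (t : R) : measurable_fun setT (fun x : R => c' (t * x)).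
  by apply: continuous_measurable_fun => x; apply: continuous_comp; [exact: ctx|exact: cc'].
have i1 (t : R) : mu.-integrable setT (EFin \o (fun x => c (t * x) * phi x)).
  apply: (@affine_phi_integrable _ 0 s s0 _ 1) => // x.
  by rewrite (le_trans (c1 _))// mul1r lerDl sqr_ge0.
pose F t := \int[mu]_x (c (t * x) * phi x).
have d1 (t x : R) : is_derive t (1 : R) (fun u => c (u * x) * phi x) (x * c' (t * x) * phi x).
  have d0 : is_derive t (1 : R) (fun u : R => u * x) x.
    by apply: is_derive_eq; rewrite /GRing.scale /=; ring.
  have d1 : is_derive t (1 : R) (c \o (fun u => u * x)) (x * c' (t * x)).
    have := dc (t * x) => dcx.
    by rewrite mulrC; exact: is_derive1_comp.
  apply: is_derive_eq; rewrite /GRing.scale /=; ring.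
have dF (t : R) : is_derive t (1 : R) F (- (s ^+ 2 * t) * F t).
  have iG : mu.-integrable setT (EFin \o (fun x => `|x| * phi x)).
    apply: (@affine_phi_integrable _ 0 s s0 _ 1) => [//|x].
    rewrite normr_id mul1r subr0 -[x ^+ 2]real_normK ?num_real//.
    by have := sqr_ge0 (`|x| - 1); nra.
  have h1 : forall x : R, `]t - 1, t + 1[%classic x ->
     mu.-integrable setT (EFin \o (fun y => c (x * y) * phi y)) by move=> x _.
  have h2 : forall x y : R, `]t - 1, t + 1[%classic x -> setT y ->
     derivable ((fun u y => c (u * y) * phi y)^~ y) x 1.
    by move=> x y _ _; exact: (@ex_derive _ _ _ _ _ _ _ (d1 x y)).
  have h3 : forall x y : R, `]t - 1, t + 1[%classic x -> setT y ->
     `|partial1of2 (fun u y => c (u * y) * phi y) x y| <= `|y| * phi y.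
    move=> x y _ _; rewrite partial1of2E (@derive_val _ _ _ _ _ _ _ (d1 x y)).
    rewrite !normrM (ger0_norm (normal_pdf_ge0 _ _ _)) ler_wpM2r ?normal_pdf_ge0//.
    by rewrite ler_piMr.
  have It : (`]t - 1, t + 1[%classic : set R) t by rewrite /= in_itv /=; lra.
  have G0 (y : R) : 0 <= `|y| * phi y by rewrite mulr_ge0 ?normal_pdf_ge0.
  apply: DeriveDef.
    exact: (derivable_under_integral measurableT It h1 h2 G0 iG h3).
  rewrite -derive1E.
  rewrite (differentiation_under_integral measurableT It h1 h2 G0 iG h3).
  transitivity (\int[mu]_x ((x - 0) * c' (t * x) * phi x)).
    apply: eq_Rintegral => x _; rewrite partial1of2E.
    by rewrite (@derive_val _ _ _ _ _ _ _ (d1 t x)) subr0.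
  rewrite (@gaussian_by_parts _ 0 s s0 (fun x => c' (t * x)) (fun x => - (t * c (t * x)))
    (1 + `|t|) _).
  - under eq_Rintegral do rewrite mulNr -mulrA -mulNr.
    by rewrite RintegralZl// -/(F t); ring.
  - move=> x; have d0 : is_derive x (1 : R) (fun u : R => t * u) t.
      by apply: is_derive_eq; rewrite /GRing.scale /=; ring.
    have -> : (fun x => c' (t * x)) = c' \o (fun u => t * u) by [].
    have := dc' (t * x) => dcx.
    by rewrite -mulrN mulrC; exact: is_derive1_comp.
  - move=> x; apply: cvgN; apply: cvgM; first exact: cvg_cst.
    by apply: continuous_comp; [exact: ctx|exact: cc].
  - move=> x; apply: (le_trans (c'1 _)); rewrite subr0.
    by have := normr_ge0 t; have := normr_ge0 x; nra.
  - move=> x; rewrite normrN normrM; have := c1 (t * x).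
    by have := normr_ge0 t; nra.
pose E t : R := expR (s ^+ 2 * t ^+ 2 / 2).
have dE (t : R) : is_derive t (1 : R) E (s ^+ 2 * t * E t).
  apply: is_derive_eq; rewrite /GRing.scale /= /E; by field.
have dFE (t : R) : is_derive t (1 : R) (fun t => F t * E t) 0.
  by apply: is_derive_eq; rewrite /GRing.scale /=; ring.
have F0 : F 0 = c 0.
  rewrite /F; under eq_Rintegral do rewrite mul0r mulrC.
  rewrite RintegralZr//; last exact: integrable_normal_pdf.
  by rewrite /Rintegral integral_normal_pdf mul1r.
move=> t; rewrite -/(F t).
have := @is_derive_0_is_cst _ (fun t => F t * E t) t 0 dFE.
rewrite F0 [E 0]/E expr0n mulr0 mul0r expR0 mulr1 => <-.
by rewrite -mulrA /E -expRD mulNr addrN expR0 mulr1.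
Qed.

Lemma gaussian_cos t :
  \int[mu]_x (cos (t * x) * phi x) = expR (- (s ^+ 2 * t ^+ 2) / 2).
Proof.
rewrite (@gaussian_fourier_ode cos (fun x => - sin x) _ _) ?cos0 ?mul1r//.
- by move=> x; rewrite cos_max.
- by move=> x; rewrite normrN sin_max.
Qed.

Lemma gaussian_sin t : \int[mu]_x (sin (t * x) * phi x) = 0.
Proof.
rewrite (@gaussian_fourier_ode sin cos _ _) ?sin0 ?mul0r//.
- by move=> x; rewrite sin_max.
- by move=> x; rewrite cos_max.
Qed.

End gaussian_fourier.

(** * Uniqueness of a finite measure with given Fourier transform *)

Lemma Rintegral_Fubini d1 d2 (T1 : measurableType d1) (T2 : measurableType d2)
    (R : realType) (m1 : {finite_measure set T1 -> \bar R})
    (m2 : {finite_measure set T2 -> \bar R}) (f : T1 * T2 -> R) (M : R) :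
  measurable_fun setT f -> (forall z, `|f z| <= M) ->
  \int[m1]_x (\int[m2]_y f (x, y)) = \int[m2]_y (\int[m1]_x f (x, y)).
Proof.
move=> mf fM.
have mfE : measurable_fun setT (EFin \o f) by exact/measurable_EFinP.
have i12 : (m1 \x m2)%E.-integrable setT (EFin \o f).
  apply/integrable12ltyP => //.
  apply: (@le_lt_trans _ _ (\int[m1]_x \int[m2]_y (cst (`|M|)%:E y))%E).
    apply: ge0_le_integral => //.
    - by move=> x _; apply: integral_ge0.
    - apply: (measurable_fun_fubini_tonelli_F (m2 := m2) (fun z => `|(f z)%:E|%E)) => //.
      exact: measurableT_comp.
    - move=> x _; apply: ge0_le_integral => //.
      + apply: measurableT_comp => //; apply: measurableT_comp => //.
      + by move=> y _; rewrite /= lee_fin; apply: le_trans (fM _) (ler_norm _).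
  under eq_integral do rewrite integral_cst//.
  by rewrite integral_cst// ltey_eq !fin_numM//; exact: fin_num_measure.
have E1 x : m2.-integrable setT (fun y => (f (x, y))%:E).
  by apply: (@bounded_integrable _ _ _ m2 (fun y => f (x, y)) M) => //; apply: measurableT_comp.
have E2 y : m1.-integrable setT (fun x => (f (x, y))%:E).
  by apply: (@bounded_integrable _ _ _ m1 (fun x => f (x, y)) M) => //; apply: measurableT_comp.
rewrite /Rintegral; congr fine.
transitivity (\int[m1]_x (\int[m2]_y (f (x, y))%:E))%E.
  by apply: eq_integral => x _; rewrite fineK// integrable_fin_num.
transitivity (\int[m2]_y (\int[m1]_x (f (x, y))%:E))%E; first exact: (Fubini i12).
by apply: eq_integral => x _; rewrite fineK// integrable_fin_num.
Qed.

Section normal_concentration.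
Context {R : realType}.
Notation mu := (@lebesgue_measure R).

(** Chebyshev's inequality. *)
Lemma normal_prob_far (x s e : R) (A : set R) : s != 0 -> 0 < e ->
  measurable A -> (forall u, A u -> e <= `|u - x|) ->
  (normal_prob x s A <= (s ^+ 2 / e ^+ 2)%:E)%E.
Proof.
move=> s0 e0 mA Ae.
have i2 : mu.-integrable setT (fun u => ((u - x) ^+ 2 * normal_pdf x s u)%:E).
  apply: (@affine_phi_integrable _ x s s0 (fun u => (u - x) ^+ 2) 1).
    by apply: measurable_funX; exact: measurable_funD.
  by move=> u; rewrite mul1r ger0_norm ?sqr_ge0// lerDr.
have -> : (s ^+ 2 / e ^+ 2)%:E = (\int[mu]_u ((e ^- 2)%:E * ((u - x) ^+ 2 * normal_pdf x s u)%:E))%E.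
  rewrite integralZl//.
  rewrite -[X in (_ * X)%E]fineK ?integrable_fin_num//.
  rewrite -EFinM mulrC; congr (_ * _)%:E; exact/esym/gaussian_moment2.
rewrite /normal_prob integral_mkcond; apply: ge0_le_integral => //.
- by move=> u _; rewrite patchE; case: ifP => //; rewrite lee_fin normal_pdf_ge0.
- apply/(measurable_restrictT _ _).1 => //.
  by apply: measurable_funTS; apply/measurable_EFinP; exact: measurable_normal_pdf.
- by apply: emeasurable_funM => //; exact: (measurable_int mu).
- move=> u _; rewrite patchE -EFinM; case: ifP => [|_]; last first.
    rewrite [point](_ : _ = 0%E)// lee_fin mulr_ge0 ?invr_ge0 ?sqr_ge0//.
    by rewrite mulr_ge0 ?sqr_ge0 ?normal_pdf_ge0.
  rewrite inE => /Ae eu; rewrite lee_fin mulrA ler_peMl ?normal_pdf_ge0//.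
  rewrite mulrC ler_pdivlMr ?exprn_gt0// mul1r -[leRHS]real_normK ?num_real//.
  by rewrite lerXn2r ?nnegrE//; exact: ltW.
Qed.

End normal_concentration.

Section fourier_unique.
Context {R : realType}.
Notation mu := (@lebesgue_measure R).

Lemma measurable_normal_pdf2 (s : R) : s != 0 ->
  measurable_fun setT (fun z : R * R => normal_pdf z.1 s z.2).
Proof.
move=> s0; under eq_fun do rewrite normal_pdfE//.
apply: measurable_funM => //; apply: measurableT_comp => //.
apply: measurable_funM => //; apply: measurableT_comp => //.
by apply: measurable_funX; apply: measurable_funB => //.
Qed.

Definition normal_kernel (s : R) (A : set R) (z : R * R) : \bar R :=
  ((normal_pdf z.1 s z.2)%:E * (\1_A z.2)%:E)%E.

Lemma measurable_normal_kernel s A : s != 0 -> measurable A ->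
  measurable_fun setT (normal_kernel s A).
Proof.
move=> s0 mA; apply: emeasurable_funM; apply/measurable_EFinP.
  exact: measurable_normal_pdf2.
exact: measurableT_comp.
Qed.

Lemma normal_kernel_ge0 s A z : (0 <= normal_kernel s A z)%E.
Proof. by rewrite mule_ge0 ?lee_fin ?normal_pdf_ge0. Qed.

Lemma normal_probE s A x :
  (normal_prob x s A = \int[mu]_u normal_kernel s A (x, u))%E.
Proof.
rewrite /normal_prob integral_mkcond; apply: eq_integral => u _.
rewrite patchE /normal_kernel /= indicE.
by case: ifP => _; rewrite ?mule1 ?mule0.
Qed.

(** Up to a factor the Gaussian density is its own Fourier transform, so that
    its integrals against a measure are determined by those of cosines. *)
Lemma normal_pdf_fourier (s x u : R) : s != 0 ->
  normal_pdf x s u = normal_peak s * \int[normal_prob 0 1]_g cos ((u - x) / s * g).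
Proof.
move=> s0; rewrite normal_pdfE//; congr (_ * _).
rewrite (Rintegral_density (mu := mu) (k := normal_pdf 0 1) (M := 1)).
- rewrite gaussian_cos ?oner_neq0//; congr expR.
  by field; rewrite s0.
- by move=> y; exact: normal_pdf_ge0.
- exact: measurable_normal_pdf.
- exact: integrable_normal_pdf.
- by [].
- exact: measurable_cosZ.
- by move=> y; rewrite cos_max.
Qed.

Section half.
Variables m1 m2 : {finite_measure set R -> \bar R}.
Hypothesis mcos : forall t, \int[m1]_x cos (t * x) = \int[m2]_x cos (t * x).
Hypothesis msin : forall t, \int[m1]_x sin (t * x) = \int[m2]_x sin (t * x).

Let icos (m : {finite_measure set R -> \bar R}) (c t : R) :
  m.-integrable setT (EFin \o (fun x => c * cos (t * x))).
Proof.
apply: (@bounded_integrable _ _ _ _ _ `|c|).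
  by apply: measurable_funM => //; exact: measurable_cosZ.
by move=> x; rewrite normrM ler_piMr// cos_max.
Qed.

Let isin (m : {finite_measure set R -> \bar R}) (c t : R) :
  m.-integrable setT (EFin \o (fun x => c * sin (t * x))).
Proof.
apply: (@bounded_integrable _ _ _ _ _ `|c|).
  by apply: measurable_funM => //; exact: measurable_sinZ.
by move=> x; rewrite normrM ler_piMr// sin_max.
Qed.

Let shifted_cos a t : \int[m1]_x cos (t * (a - x)) = \int[m2]_x cos (t * (a - x)).
Proof.
have E (m : {finite_measure set R -> \bar R}) : \int[m]_x cos (t * (a - x)) =
    cos (t * a) * \int[m]_x cos (t * x) + sin (t * a) * \int[m]_x sin (t * x).
  rewrite -!RintegralZl//; last 2 first.
  - by have := isin m 1 t; under [X in _.-integrable _ X]eq_fun do rewrite /= mul1r.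
  - by have := icos m 1 t; under [X in _.-integrable _ X]eq_fun do rewrite /= mul1r.
  rewrite -RintegralD//; [|exact: icos|exact: isin]; apply: eq_Rintegral => x _.
  by rewrite mulrBr cosB.
by rewrite !E mcos msin.
Qed.

Let smooth_eq (s u : R) : s != 0 ->
  (\int[m1]_x (normal_pdf x s u)%:E = \int[m2]_x (normal_pdf x s u)%:E)%E.
Proof.
move=> s0.
have E (m : {finite_measure set R -> \bar R}) : (\int[m]_x (normal_pdf x s u)%:E =
    (normal_peak s * \int[normal_prob 0 1]_g \int[m]_x cos ((g / s) * (u - x)))%:E)%E.
  have mF : measurable_fun setT (fun z : R * R => cos ((u - z.1) / s * z.2)).
    apply: measurableT_comp; first exact: measurable_cos.
    apply: measurable_funM => //; apply: measurable_funM => //.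
    exact: measurable_funB.
  have iI : m.-integrable setT (EFin \o (fun x => \int[normal_prob 0 1]_g cos ((u - x) / s * g))).
    have -> : (fun x => \int[normal_prob 0 1]_g cos ((u - x) / s * g)) =
        (fun x => (normal_peak s)^-1 * normal_pdf x s u).
      apply/funext => x; rewrite normal_pdf_fourier// mulKf//.
      by rewrite gt_eqF// normal_peak_gt0.
    apply: (@bounded_integrable _ _ _ m _ 1).
      apply: measurable_funM => //.
      exact: (measurableT_comp (measurable_normal_pdf2 s0) (measurable_pair2 u)).
    move=> x; rewrite normal_pdfE// mulKf ?gt_eqF ?normal_peak_gt0//.
    rewrite ger0_norm ?expR_ge0// /normal_fun expR_le1.
    by rewrite mulNr oppr_le0 divr_ge0 ?sqr_ge0// mulrn_wge0 ?sqr_ge0.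
  transitivity (\int[m]_x (normal_peak s * \int[normal_prob 0 1]_g cos ((u - x) / s * g))%:E)%E.
    by apply: eq_integral => x _; rewrite normal_pdf_fourier.
  rewrite -[LHS]fineK; last first.
    apply: integrable_fin_num => //; under eq_fun do rewrite EFinM.
    exact: integrableZl.
  congr EFin; rewrite -/(Rintegral _ _ _) RintegralZl//; congr (_ * _).
  rewrite (@Rintegral_Fubini _ _ _ _ _ m (normal_prob 0 1)
    (fun z => cos ((u - z.1) / s * z.2)) 1)//=; last by move=> z; rewrite cos_max.
  apply: eq_Rintegral => g _; apply: eq_Rintegral => x _; congr cos; ring.
rewrite !E; congr (_ * _)%:E; apply: eq_Rintegral => g _; exact: shifted_cos.
Qed.

Let smooth_meas_eq (s : R) (A : set R) : s != 0 -> measurable A ->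
  (\int[m1]_x normal_prob x s A = \int[m2]_x normal_prob x s A)%E.
Proof.
move=> s0 mA.
have E (m : {finite_measure set R -> \bar R}) : (\int[m]_x normal_prob x s A =
    \int[mu]_(u in A) \int[m]_x (normal_pdf x s u)%:E)%E.
  rewrite [RHS]integral_mkcond; under [LHS]eq_integral do rewrite normal_probE.
  have mf := measurable_normal_kernel s0 mA; have f0 := normal_kernel_ge0 s A.
  rewrite fubini_tonelli//; apply: eq_integral => u _.
  rewrite patchE /normal_kernel /= indicE; case: ifP => _.
    by apply: eq_integral => x _; rewrite mule1.
  by under eq_integral do rewrite mule0; rewrite integral0.
rewrite !E; apply: eq_integral => u _; exact: smooth_eq.
Qed.

(** Smoothing by a Gaussian law of scale [s] makes the two measures equal; it
    moves mass across a margin [e] with probability at most [s^2 / e^2]. *)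
Lemma fourier_ray_le a : (m1 `[a, +oo[%classic <= m2 `[a, +oo[%classic)%E.
Proof.
have mray (c : R) : measurable (`[c, +oo[%classic : set R) by exact: measurable_itv.
have mK (m : {finite_measure set R -> \bar R}) s A : s != 0 -> measurable A ->
    measurable_fun setT (fun x => normal_prob x s A : \bar R).
  move=> s0 mA; apply: (eq_measurable_fun (fubini_F mu (normal_kernel s A))).
    by move=> x _; rewrite normal_probE.
  apply: measurable_fun_fubini_tonelli_F; last exact: normal_kernel_ge0.
  exact: measurable_normal_kernel.
(* comparison at the scale of [s], with a margin [e] *)
have cmp s e : s != 0 -> 0 < e ->
  ((1 - s ^+ 2 / e ^+ 2)%:E * m1 `[a, +oo[%classic <=
   m2 `[(a - e - e)%R, +oo[%classic + (s ^+ 2 / e ^+ 2)%:E * m2 setT)%E.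
  move=> s0 e0; set r := s ^+ 2 / e ^+ 2.
  have r0 : 0 <= r by rewrite divr_ge0 ?sqr_ge0.
  pose A : set R := `[a - e, +oo[%classic.
  apply: (@le_trans _ _ (\int[m1]_x normal_prob x s A)%E).
    have [r1|r1] := leP 1 r.
      apply: (@le_trans _ _ 0%E); last by apply: integral_ge0.
      by rewrite mule_le0_ge0// lee_fin subr_le0.
    rewrite -[X in (X * _)%E]/(EFin (1 - r)) -integral_cst//.
    rewrite integral_mkcond; apply: ge0_le_integral => //.
    - by move=> x _; rewrite patchE; case: ifP => // _; rewrite lee_fin subr_ge0 ltW.
    - by apply/(measurable_restrictT _ _).1.
    - exact: (mK m1 s A s0 (mray _)).
    - move=> x _; rewrite patchE; case: ifPn => [|_]; last exact: measure_ge0.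
      rewrite inE /= in_itv /= andbT => ax.
      have mA : measurable A by exact: mray.
      rewrite -[A]setCK probability_setC; last exact: measurableC.
      rewrite EFinB leeB//; apply: normal_prob_far => //; first exact: measurableC.
      move=> u; rewrite /A /= in_itv /= andbT => /negP; rewrite -ltNge => ua.
      by rewrite ler0_norm; lra.
  rewrite smooth_meas_eq//; last exact: mray.
  apply: (@le_trans _ _ (\int[m2]_x ((\1_(`[(a - e - e)%R, +oo[%classic) x)%:E + r%:E))%E).
    apply: ge0_le_integral => //.
    - exact: (mK m2 s A s0 (mray _)).
    - apply: emeasurable_funD => //; apply/measurable_EFinP; exact: measurable_indic.
    - move=> x _; rewrite indicE; case: (boolP (x \in _)) => [_|].
        apply: (@le_trans _ _ 1%E); last by rewrite leeDl.
        by apply: probability_le1; exact: mray.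
      move=> /negP; rewrite inE /= in_itv /= andbT => /negP; rewrite -ltNge => xa.
      rewrite add0e; apply: normal_prob_far => // [|u]; first exact: mray.
      rewrite /A /= in_itv /= andbT => ua.
      by rewrite ger0_norm; lra.
  rewrite ge0_integralD//; last by apply/measurable_EFinP; exact: measurable_indic.
  by rewrite integral_indic// setIT integral_cst.
have cmp2 e : 0 < e -> (m1 `[a, +oo[%classic <= m2 `[(a - e - e)%R, +oo[%classic)%E.
  move=> e0.
  have f1 := fineK (fin_num_measure m1 _ (mray a)).
  have f2 := fineK (fin_num_measure m2 _ (mray (a - e - e))).
  have f3 := fineK (fin_num_measure m2 _ measurableT).
  rewrite -f1 -f2 lee_fin; apply/ler_addgt0Pr => d d0.
  set x := fine (m1 _); set y := fine (m2 _); set z := fine (m2 setT) in f3.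
  have x0 : 0 <= x by rewrite fine_ge0.
  have z0 : 0 <= z by rewrite fine_ge0.
  (* choose the scale so that the error terms are below [d] *)
  pose s := e * Num.sqrt (d / (x + z + 1)).
  have q0 : 0 < d / (x + z + 1) by rewrite divr_gt0//; lra.
  have s0 : s != 0 by rewrite mulf_neq0 ?gt_eqF ?sqrtr_gt0.
  have := cmp s e s0 e0.
  have -> : s ^+ 2 / e ^+ 2 = d / (x + z + 1).
    rewrite exprMn sqr_sqrtr ?ltW// mulrC mulKf// gt_eqF// exprn_gt0//.
  rewrite -f1 -f2 -f3 -/x -/y -/z -!EFinM -EFinD lee_fin.
  set r := d / _.
  have rE : r * (x + z) <= d.
    by rewrite /r mulrAC ler_pdivrMr; [rewrite ler_wpM2l; lra|lra].
  by nra.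
(* let the margin go to 0 *)
pose B n : set R := [set` `[a - n.+1%:R^-1 - n.+1%:R^-1, +oo[].
have rayE : [set` `[a, +oo[] = \bigcap_n B n.
  apply/seteqP; split => x; rewrite /B /=.
    rewrite in_itv /= andbT => ax n _ /=; rewrite in_itv /= andbT.
    have : 0 < n.+1%:R^-1 :> R by rewrite invr_gt0.
    by move: (n.+1%:R^-1) => y; lra.
  move=> H; rewrite in_itv /= andbT leNgt; apply/negP => xa.
  have [n] := ltr_add_invr xa.
  have := H (n.*2.+1)%N I; rewrite /= in_itv /= andbT.
  have -> : n.*2.+2 = (2 * n.+1)%N by rewrite mul2n doubleS.
  rewrite natrM invfM.
  by move: (n.+1%:R^-1) => y; lra.
have mB n : measurable (B n) by exact: mray.
have cv : m2 (B n) @[n --> \oo] --> m2 (\bigcap_n B n).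
  apply: nonincreasing_cvg_mu => //.
  - by rewrite -ge0_fin_numE// fin_num_measure.
  - exact: bigcap_measurableType.
  - apply/nonincreasing_seqP => n; apply/subsetPset => x.
    rewrite /B /= !in_itv /= !andbT; apply: le_trans.
    have : (n.+2%:R^-1 : R) <= n.+1%:R^-1 by rewrite lef_pV2 ?posrE// ler_nat.
    by move: (n.+1%:R^-1) (n.+2%:R^-1) => y z; lra.
rewrite [X in (_ <= m2 X)%E]rayE; apply: (cvge_ge _ cv); apply: nearW => n.
by apply: cmp2; rewrite invr_gt0.
Qed.

End half.

(** Smoothing both measures at scale [s] turns them into mixtures of their
    Fourier transforms; the smoothed measures converge back as [s] goes to 0. *)
Lemma fourier_measure_unique (m1 m2 : {finite_measure set R -> \bar R}) :
  (forall t, \int[m1]_x cos (t * x) = \int[m2]_x cos (t * x)) ->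
  (forall t, \int[m1]_x sin (t * x) = \int[m2]_x sin (t * x)) ->
  forall A, measurable A -> m1 A = m2 A.
Proof.
move=> hc hs A mA.
apply: (measure_unique (@RGenCInfty.G R) (fun n => `[- n%:R, +oo[%classic)) => //.
- exact: RGenCInfty.measurableE.
- move=> _ _ [x ->] [y ->]; exists (Num.max x y); apply/seteqP; split => z /=.
    by rewrite !in_itv /= !andbT ge_max => -[-> ->].
  by rewrite !in_itv /= !andbT ge_max => /andP[].
- by move=> n; exists (- n%:R).
- apply/seteqP; split=> // x _; exists (Num.truncn `|x|).+1 => //=.
  rewrite in_itv /= andbT lerNl; apply: le_trans (ler_norm _) _.
  by rewrite normrN ltW// real_truncnS_gt// num_real.
- move=> _ [x ->]; apply/eqP; rewrite eq_le; apply/andP; split;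
    exact: fourier_ray_le.
- by move=> k; rewrite -ge0_fin_numE// fin_num_measure.
Qed.

End fourier_unique.

(** * Weighted laws *)

Section weighted_law.
Context d (Om : measurableType d) (R : realType) (P : probability Om R).
Variables (k : Om -> R) (M : R).
Hypotheses (k_ge0 : forall w, 0 <= k w) (kM : forall w, k w <= M).
Hypothesis mk : measurable_fun setT k.

Let ik : P.-integrable setT (EFin \o k).
Proof. by apply: (@bounded_integrable _ _ _ P k M mk) => w; rewrite ger0_norm. Qed.

Let dens (D : set Om) : \bar R := (\int[P]_(w in D) (k w)%:E)%E.

Let dens0 : dens set0 = 0%E. Proof. exact: integral_set0. Qed.

Let dens_ge0 A : (0 <= dens A)%E.
Proof. by apply: integral_ge0 => w _; rewrite lee_fin. Qed.

Let dens_sigma_additive : semi_sigma_additive dens.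
Proof.
move=> A mA tA mUA; rewrite /dens integral_bigcup//=; last first.
  by apply: (integrableS measurableT) => //; exact: bigcup_measurable.
apply: is_cvg_ereal_nneg_natsum_cond => n _ _.
by apply: integral_ge0 => w _; rewrite lee_fin.
Qed.

HB.instance Definition _ := isMeasure.Build _ _ _ dens dens0 dens_ge0 dens_sigma_additive.

Context d' (S : measurableType d') (U : Om -> S).
Hypothesis mU : measurable_fun setT U.

Let law : set S -> \bar R := pushforward dens U.

Let law0 : law set0 = 0%E. Proof. by rewrite /law /pushforward preimage_set0. Qed.

Let law_ge0 A : (0 <= law A)%E. Proof. exact: dens_ge0. Qed.

Let law_sigma_additive : semi_sigma_additive law.
Proof.
by have := @measure_semi_sigma_additive _ _ _
  (measure_function_pushforward__canonical__measure_function_Measure dens mU).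
Qed.

HB.instance Definition _ := isMeasure.Build _ _ _ law law0 law_ge0 law_sigma_additive.

Let law_fin : fin_num_fun law.
Proof.
move=> A mA; rewrite /law /pushforward /dens.
have mUA : measurable (U @^-1` A) by rewrite -[X in measurable X]setTI; exact: mU.
by apply: integrable_fin_num => //; exact: (integrableS measurableT).
Qed.

HB.instance Definition _ := Measure_isFinite.Build _ _ _ law law_fin.

(** A weighted expectation of functions of [U] is an integral against a finite
    measure, to which the uniqueness theorems for measures apply. *)
Lemma weighted_law : exists m : {finite_measure set S -> \bar R},
  (forall D, measurable D -> fine (m D) = \int[P]_w (\1_D (U w) * k w)) /\
  (forall (f : S -> R) (c : R), measurable_fun setT f -> (forall x, `|f x| <= c) ->
     \int[m]_x f x = \int[P]_w (f (U w) * k w)).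
Proof.
have mIf (D : set S) (f : S -> R) (c : R) : measurable D -> measurable_fun setT f -> (forall x, `|f x| <= c) ->
    \int[law]_x f x = \int[P]_w (f (U w) * k w).
  move=> mD mf fc.
  have Uf : measurable_fun setT (f \o U) by exact: measurableT_comp.
  have densfin : fin_num_fun dens.
    move=> A mA; apply: integrable_fin_num => //; exact: (integrableS measurableT).
  pose densF := HB.pack_for {finite_measure set Om -> \bar R} dens
    (Measure_isFinite.Build _ _ _ dens densfin).
  rewrite -(@Rintegral_density _ _ _ densF P k (f \o U) c) //; last by move=> w; exact: fc.
  congr fine.
  have := @integral_pushforward _ _ Om S R U mU dens setT (EFin \o f).
  rewrite preimage_setT; apply => //.
  + exact/measurable_EFinP.
  + exact: (@bounded_integrable _ _ _ densF (f \o U) c Uf (fun w => fc (U w))).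
exists law; split => [D mD|f c mf fc]; last exact: (mIf setT f c).
rewrite -(mIf D _ 1) //.
  by rewrite /Rintegral integral_indic// setIT.
by move=> x; rewrite ger0_norm// indic_le1.
Qed.

End weighted_law.

Lemma indicator_expectation d (Om : measurableType d) (R : realType)
    (P : probability Om R) (T : Type) (f : Om -> T) (D : set T) :
  measurable (f @^-1` D) -> \int[P]_w \1_D (f w) = fine (P (f @^-1` D)).
Proof. by move=> mfD; rewrite -[in RHS](setIT (f @^-1` D)) -integral_indic. Qed.

Lemma law_measure d (Om : measurableType d) (R : realType) (P : probability Om R)
    d' (S : measurableType d') (U : Om -> S) : measurable_fun setT U ->
  exists m : {finite_measure set S -> \bar R},
  (forall D, measurable D -> m D = P (U @^-1` D)) /\
  (forall (f : S -> R) (c : R), measurable_fun setT f -> (forall x, `|f x| <= c) ->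
     \int[P]_w f (U w) = \int[m]_x f x).
Proof.
move=> mU; have m1 : measurable_fun setT (fun _ : Om => 1 : R) by [].
have [m [mD mI]] := weighted_law P (fun=> ler01) (fun=> lexx 1) m1 mU.
exists m; split=> [D mD'|f c mf fc].
  have mp : measurable (U @^-1` D) by rewrite -[X in measurable X]setTI; exact: mU.
  rewrite -[LHS]fineK ?fin_num_measure// mD//; under eq_Rintegral do rewrite mulr1.
  by rewrite indicator_expectation// fineK// fin_num_measure.
by rewrite (mI f c)//; apply: eq_Rintegral => w _; rewrite mulr1.
Qed.

Section weighted_functionals.
Context d (Om : measurableType d) (R : realType) (P : probability Om R).

(** The Fourier transform identifies the weighted law of [V] with a multiple of
    the standard Gaussian law. *)
Lemma fourier_weighted (k V : Om -> R) (M C : R) :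
  (forall w, 0 <= k w) -> (forall w, k w <= M) ->
  measurable_fun setT k -> measurable_fun setT V ->
  (forall t, \int[P]_w (k w * cos (t * V w)) = C * expR (- t ^+ 2 / 2)) ->
  (forall t, \int[P]_w (k w * sin (t * V w)) = 0) ->
  forall B : set R, measurable B ->
  \int[P]_w (\1_B (V w) * k w) = C * fine (normal_prob 0 1 B).
Proof.
move=> k0 kM mk mV hcos hsin B mB.
have mc := @measurable_cosZ R; have ms := @measurable_sinZ R.
have C0 : 0 <= C.
  have := hcos 0; rewrite expr0n oppr0 mul0r expR0 mulr1 => <-.
  by apply: Rintegral_ge0 => w _; rewrite mul0r cos0 mulr1.
have [m1 [m1E m1I]] := weighted_law P k0 kM mk mV.
have mid : measurable_fun setT (fun x : R => x) by exact: measurable_id.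
have [m2 [m2E m2I]] := @weighted_law _ _ _ (normal_prob 0 1) (fun=> C) C
  (fun=> C0) (fun=> lexx C) (@measurable_cst _ _ _ _ setT C) _ _ _ mid.
have normI (f : R -> R) (c : R) : measurable_fun setT f -> (forall x, `|f x| <= c) ->
    \int[normal_prob 0 1]_x f x = \int[lebesgue_measure]_x (f x * normal_pdf 0 1 x).
  move=> mf fc; apply: (Rintegral_density (M := c)) => //.
  - by move=> y; exact: normal_pdf_ge0.
  - exact: measurable_normal_pdf.
  - exact: integrable_normal_pdf.
have intb (f : R -> R) (c : R) : measurable_fun setT f -> (forall x, `|f x| <= c) ->
    (normal_prob 0 1).-integrable setT (EFin \o f).
  by move=> mf fc; exact: (@bounded_integrable _ _ _ (normal_prob 0 1) f c).
have n10 : (1 : R) != 0 by exact: oner_neq0.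
rewrite -m1E// (_ : m1 B = m2 B) ?m2E//.
  rewrite RintegralZr//; last first.
    by apply: (intb \1_B 1) => // x; rewrite ger0_norm// indic_le1.
  by rewrite mulrC; congr (_ * _); rewrite /Rintegral integral_indic// setIT.
apply: fourier_measure_unique => // t.
  rewrite (m1I _ 1)//; last by move=> x; rewrite cos_max.
  rewrite (m2I _ 1)//; last by move=> x; rewrite cos_max.
  under eq_Rintegral do rewrite mulrC.
  rewrite hcos RintegralZr//; last by apply: (intb _ 1) => // x; rewrite cos_max.
  rewrite mulrC; congr (_ * _); rewrite (normI _ 1)//; last by move=> x; rewrite cos_max.
  by rewrite gaussian_cos// expr1n mul1r.
rewrite (m1I _ 1)//; last by move=> x; rewrite sin_max.
rewrite (m2I _ 1)//; last by move=> x; rewrite sin_max.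
under eq_Rintegral do rewrite mulrC.
rewrite hsin RintegralZr//; last by apply: (intb _ 1) => // x; rewrite sin_max.
rewrite (normI _ 1)//; last by move=> x; rewrite sin_max.
by rewrite gaussian_sin// mul0r.
Qed.

Lemma rectangle_measure_unique d1 d2 (S1 : measurableType d1) (S2 : measurableType d2)
    (m1 m2 : {finite_measure set (S1 * S2)%type -> \bar R}) :
  (forall A B, measurable A -> measurable B -> m1 (A `*` B) = m2 (A `*` B)) ->
  forall E, measurable E -> m1 E = m2 E.
Proof.
move=> m12 E mE.
pose C : set (set (S1 * S2)) :=
  [set C | exists A, measurable A /\ exists B, measurable B /\ C = A `*` B].
apply: (measure_unique C (fun n => setT)) => //.
- rewrite measurable_prod_measurableType //; congr (<<s _ >>).
  rewrite predeqE; split => [[A mA [B mB <-]]|[A [mA [B [mB ->]]]]].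
    by exists A; split => //; exists B.
  by exists A => //; exists B.
- move=> /= _ _ [X1 [mX1 [X2 [mX2 ->]]]] [Y1 [mY1 [Y2 [mY2 ->]]]].
  rewrite -setXI; exists (X1 `&` Y1); split; first exact: measurableI.
  by exists (X2 `&` Y2); split => //; exact: measurableI.
- by move=> n; exists setT; split => //; exists setT; rewrite setXTT.
- by rewrite bigcup_const//; exists 0%N.
- by move=> A [A1 [mA1 [A2 [mA2 ->]]]]; exact: m12.
- by move=> k; rewrite -ge0_fin_numE// fin_num_measure.
Qed.

Lemma rectangle_weighted d1 (S1 : measurableType d1) (k1 k2 : Om -> R) (M : R)
    (U : Om -> S1) (V : Om -> R) :
  (forall w, 0 <= k1 w) -> (forall w, k1 w <= M) -> measurable_fun setT k1 ->
  (forall w, 0 <= k2 w) -> (forall w, k2 w <= M) -> measurable_fun setT k2 ->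
  measurable_fun setT U -> measurable_fun setT V ->
  (forall A B, measurable A -> measurable B ->
     \int[P]_w (\1_A (U w) * \1_B (V w) * k1 w) = \int[P]_w (\1_A (U w) * \1_B (V w) * k2 w)) ->
  forall E, measurable E ->
    \int[P]_w (\1_E (U w, V w) * k1 w) = \int[P]_w (\1_E (U w, V w) * k2 w).
Proof.
move=> k10 k1M mk1 k20 k2M mk2 mU mV h E mE.
have mUV : measurable_fun setT (fun w => (U w, V w)) by exact: measurable_fun_pair.
have [m1 [m1E _]] := weighted_law P k10 k1M mk1 mUV.
have [m2 [m2E _]] := weighted_law P k20 k2M mk2 mUV.
rewrite -m1E// -m2E//; congr fine; apply: rectangle_measure_unique => // A B mA mB.
have mAB : measurable (A `*` B) by exact: measurableX.
rewrite -[LHS]fineK ?fin_num_measure// -[RHS]fineK ?fin_num_measure//.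
rewrite m1E// m2E//; congr EFin.
have E1 (k : Om -> R) w : \1_(A `*` B) (U w, V w) * k w = \1_A (U w) * \1_B (V w) * k w.
  by congr (_ * _); rewrite !indicE in_setX /= -natrM mulnb.
under eq_Rintegral do rewrite E1.
by rewrite h//; apply: eq_Rintegral => w _; rewrite E1.
Qed.

End weighted_functionals.

(** * Gaussian families *)

Lemma ae_eq_Rintegral d (T : measurableType d) (R : realType)
    (mu : {measure set T -> \bar R}) (f g : T -> R) :
  measurable_fun setT f -> measurable_fun setT g ->
  {ae mu, forall w, f w = g w} -> \int[mu]_w f w = \int[mu]_w g w.
Proof.
move=> mf mg fg; congr fine; apply: ae_eq_integral => //.
- exact/measurable_EFinP.
- exact/measurable_EFinP.
- by apply: filterS fg => w /= -> _.
Qed.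

Section gaussian_family.
Context d (Om : measurableType d) (R : realType) (P : probability Om R).
Context (V : lmodType R) (G : V -> Om -> R) (b : V -> V -> R).
Hypothesis mG : forall h, measurable_fun setT (G h).
Hypothesis G_lin : forall (a : R) h v,
  {ae P, forall w, G (h + a *: v) w = G h w + a * G v w}.
Hypothesis b_pyth : forall (a : R) h v, b h v = 0 ->
  b (h + a *: v) (h + a *: v) = b h h + a ^+ 2 * b v v.
Hypothesis b0 : forall v, b 0 v = 0.

(** Independence of [U] and of the centered Gaussian variable [G h] of variance
    [b h h], for each [h] in [M]. It is expressed through Fourier transforms,
    which are well behaved under the linear combinations of the [G h]. *)
Definition fourier_indep d' (S : measurableType d') (U : Om -> S) (M : set V) :=
  forall D, measurable D -> forall h, M h ->
    \int[P]_w (\1_D (U w) * cos (G h w)) =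
      fine (P (U @^-1` D)) * expR (- b h h / 2) /\
    \int[P]_w (\1_D (U w) * sin (G h w)) = 0.

Lemma fourier_indep_comp d1 d2 (S1 : measurableType d1) (S2 : measurableType d2)
    (U : Om -> S1) (g : S1 -> S2) (M : set V) :
  measurable_fun setT g -> fourier_indep U M -> fourier_indep (g \o U) M.
Proof.
move=> mg UM D mD h Mh.
have := UM (g @^-1` D) _ h Mh; apply.
by rewrite -[X in measurable X]setTI; exact: mg.
Qed.

Section step.
Context d' (S : measurableType d') (U : Om -> S) (M : set V) (v : V).
Hypothesis mU : measurable_fun setT U.
Hypothesis UM : fourier_indep U M.
Hypothesis v1 : b v v = 1.
Hypothesis Mv : forall (a : R) h, M h -> M (h + a *: v).
Hypothesis M0 : M 0.

Let mcos1 h : measurable_fun setT (fun w => cos (G h w)).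
Proof. exact: measurableT_comp (@measurable_cos R) (mG h). Qed.

Let msin1 h : measurable_fun setT (fun w => sin (G h w)).
Proof. exact: measurableT_comp (@measurable_sin R) (mG h). Qed.

Let mD D : measurable D -> measurable_fun setT (fun w => \1_D (U w) : R).
Proof. by move=> mD; apply: measurableT_comp => //. Qed.

Let transl (a : R) h D : measurable D -> M h -> b h v = 0 ->
  \int[P]_w (\1_D (U w) * cos (G h w + a * G v w)) =
    fine (P (U @^-1` D)) * expR (- (b h h + a ^+ 2) / 2) /\
  \int[P]_w (\1_D (U w) * sin (G h w + a * G v w)) = 0.
Proof.
move=> mD' Mh hv; have [h1 h2] := UM mD' (Mv a Mh).
rewrite b_pyth// v1 mulr1 in h1; rewrite -h1.
have mGa : measurable_fun setT (fun w => G h w + a * G v w).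
  by apply: measurable_funD => //; exact: measurable_funM.
have mc := @measurable_cos R; have ms := @measurable_sin R.
split; last rewrite -[RHS]h2; apply: ae_eq_Rintegral;
  try (by apply: measurable_funM; [exact: mD|exact: measurableT_comp]);
  by have := G_lin a h v; apply: filterS => w ->.
Qed.

Let int1 (D : set S) (f : Om -> R) : measurable D -> measurable_fun setT f ->
  (forall w, `|f w| <= 1) -> P.-integrable setT (EFin \o (fun w => \1_D (U w) * f w)).
Proof.
move=> mD' mf f1; apply: (@bounded_integrable _ _ _ P _ 1).
  by apply: measurable_funM => //; exact: mD.
by move=> w; rewrite normrM mulr_ile1// ger0_norm// indic_le1.
Qed.

Let intf (f : R -> R) D (a : R) h : measurable D -> measurable_fun setT f ->
  (forall x, `|f x| <= 1) ->
  P.-integrable setT (EFin \o (fun w => \1_D (U w) * f (G h w + a * G v w))).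
Proof.
move=> mD' mf f1; apply: int1 => //; apply: measurableT_comp => //.
by apply: measurable_funD => //; exact: measurable_funM.
Qed.

Let G0 : {ae P, forall w, G 0 w = 0}.
Proof.
by have := G_lin (-1) 0 0; rewrite scaler0 addr0; apply: filterS => w E; lra.
Qed.

(* The product-to-sum formulas turn the Fourier coefficients of the weights
   below into combinations of this form. *)
Let trig_sum (f g : R -> R) D h (t c1 c2 : R) : measurable D ->
  measurable_fun setT f -> measurable_fun setT g ->
  (forall x, `|f x| <= 1) -> (forall x, `|g x| <= 1) ->
  \int[P]_w (\1_D (U w) * (f (t * G v w) +
    (c1 * g (G h w + t * G v w) + c2 * g (G h w + - t * G v w)))) =
  \int[P]_w (\1_D (U w) * f (G 0 w + t * G v w)) +
  (c1 * \int[P]_w (\1_D (U w) * g (G h w + t * G v w)) +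
   c2 * \int[P]_w (\1_D (U w) * g (G h w + - t * G v w))).
Proof.
move=> mD' mf mg f1 g1.
have i1 := intf t 0 mD' mf f1.
have i2 := intf t h mD' mg g1; have i3 := intf (- t) h mD' mg g1.
have iZ (c : R) (k : Om -> R) : P.-integrable setT (EFin \o k) ->
    P.-integrable setT (EFin \o (fun w => c * k w)).
  by move=> ik; rewrite /comp; under eq_fun do rewrite EFinM; exact: integrableZl.
have i23 : P.-integrable setT (EFin \o (fun w =>
    c1 * (\1_D (U w) * g (G h w + t * G v w)) +
    c2 * (\1_D (U w) * g (G h w + - t * G v w)))).
  exact: (integrableD measurableT (iZ _ _ i2) (iZ _ _ i3)).
rewrite -RintegralZl// -[X in _ = _ + (_ + X)]RintegralZl//.
rewrite -RintegralD//; [|exact: iZ|exact: iZ]; rewrite -RintegralD//.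
have mGa (a : R) k : measurable_fun setT (fun w => G k w + a * G v w).
  by apply: measurable_funD => //; exact: measurable_funM.
apply: ae_eq_Rintegral; last by apply: filterS G0 => w ->; rewrite add0r; ring.
- apply: measurable_funM; first exact: mD.
  apply: measurable_funD; first by apply: measurableT_comp => //; exact: measurable_funM.
  by apply: measurable_funD; apply: measurable_funM => //; apply: measurableT_comp => //; exact: mGa.
- by apply: measurable_funD; [exact/measurable_EFinP/(measurable_int P i1)|exact/measurable_EFinP/(measurable_int P i23)].
Qed.

(* Both weights below are nonnegative, so that the uniqueness theorem applies
   to measures. *)
Let weight_cos h D B : measurable D -> measurable (B : set R) -> M h -> b h v = 0 ->
  \int[P]_w (\1_B (G v w) * (\1_D (U w) * (1 + cos (G h w)))) =
  fine (P (U @^-1` D)) * (1 + expR (- b h h / 2)) * fine (normal_prob 0 1 B).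
Proof.
move=> mD' mB Mh hv; have mc := @measurable_cos R; have ms := @measurable_sin R.
apply: (@fourier_weighted _ _ _ P _ _ 2) => //.
- move=> w; apply: le_trans (_ : 1 * (1 + cos (G h w)) <= 2).
    by rewrite ler_wpM2r ?indic_le1// -lerBlDl sub0r cos_geN1.
  by rewrite mul1r; have := cos_le1 (G h w); lra.
- by apply: measurable_funM; [exact: mD|exact: measurable_funD].
- move=> t; have [a1 _] := transl t mD' M0 (b0 v).
  have [a2 _] := transl t mD' Mh hv; have [a3 _] := transl (- t) mD' Mh hv.
  have := trig_sum h t 2^-1 2^-1 mD' mc mc (@cos_max R) (@cos_max R).
  rewrite a1 a2 a3 b0 sqrrN add0r opprD mulrDl expRD => H.
  apply: etrans (etrans H _); last by field.
  by apply: eq_Rintegral => w _; rewrite mulNr !cosD cosN sinN; field.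
- move=> t; have [_ a1] := transl t mD' M0 (b0 v).
  have [_ a2] := transl t mD' Mh hv; have [_ a3] := transl (- t) mD' Mh hv.
  have := trig_sum h t 2^-1 (- 2^-1) mD' ms ms (@sin_max R) (@sin_max R).
  rewrite a1 a2 a3 !mulr0 !addr0 => H; apply: etrans H.
  by apply: eq_Rintegral => w _; rewrite !mulNr !sinD cosN sinN; field.
Qed.

Let weight_sin h D B : measurable D -> measurable (B : set R) -> M h -> b h v = 0 ->
  \int[P]_w (\1_B (G v w) * (\1_D (U w) * (1 + sin (G h w)))) =
  fine (P (U @^-1` D)) * fine (normal_prob 0 1 B).
Proof.
move=> mD' mB Mh hv; have mc := @measurable_cos R; have ms := @measurable_sin R.
apply: (@fourier_weighted _ _ _ P _ _ 2) => //.
- move=> w; apply: le_trans (_ : 1 * (1 + sin (G h w)) <= 2).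
    by rewrite ler_wpM2r ?indic_le1// -lerBlDl sub0r sin_geN1.
  by rewrite mul1r; have := sin_le1 (G h w); lra.
- by apply: measurable_funM; [exact: mD|exact: measurable_funD].
- move=> t; have [a1 _] := transl t mD' M0 (b0 v).
  have [_ a2] := transl t mD' Mh hv; have [_ a3] := transl (- t) mD' Mh hv.
  have := trig_sum h t 2^-1 2^-1 mD' mc ms (@cos_max R) (@sin_max R).
  rewrite a1 a2 a3 b0 !mulr0 !addr0 add0r => H; apply: etrans H.
  by apply: eq_Rintegral => w _; rewrite mulNr !sinD cosN sinN; field.
- move=> t; have [_ a1] := transl t mD' M0 (b0 v).
  have [a2 _] := transl t mD' Mh hv; have [a3 _] := transl (- t) mD' Mh hv.
  have := trig_sum h t (- 2^-1) 2^-1 mD' ms mc (@sin_max R) (@cos_max R).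
  rewrite a1 a2 a3 sqrrN add0r mulNr addNr => H; apply: etrans H.
  by apply: eq_Rintegral => w _; rewrite !mulNr !cosD cosN sinN; field.
Qed.

Let PUB D B : measurable D -> measurable (B : set R) ->
  \int[P]_w (\1_B (G v w) * \1_D (U w)) =
  fine (P (U @^-1` D)) * fine (normal_prob 0 1 B).
Proof.
move=> mD' mB; rewrite -(weight_sin mD' mB M0 (b0 v)); apply: ae_eq_Rintegral.
- by apply: measurable_funM; [apply: measurableT_comp|exact: mD].
- apply: measurable_funM; first exact: measurableT_comp.
  by apply: measurable_funM; [exact: mD|exact: measurable_funD].
- by apply: filterS G0 => w ->; rewrite sin0 addr0 mulr1.
Qed.

Lemma fourier_indep_law D (B : set R) : measurable D -> measurable B ->
  P (U @^-1` D `&` G v @^-1` B) = (P (U @^-1` D) * normal_prob 0 1 B)%E.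
Proof.
move=> mD' mB.
have mUD : measurable (U @^-1` D) by rewrite -[X in measurable X]setTI; exact: mU.
have mVB : measurable (G v @^-1` B) by rewrite -[X in measurable X]setTI; exact: mG.
rewrite -[LHS]fineK ?fin_num_measure//; last exact: measurableI.
rewrite -[X in (X * _)%E]fineK ?fin_num_measure//.
rewrite -[X in (_ * X)%E]fineK ?fin_num_measure// -EFinM -PUB//.
congr EFin; rewrite -[in LHS](setIT (_ `&` _)) -integral_indic//; last exact: measurableI.
congr fine; apply: eq_integral => w _; congr EFin.
by rewrite !indicE in_setI /= andbC -natrM mulnb.
Qed.

(** Testing [U] against all [G (h + a *: v)], which is [G h + a * G v], gives the
    independence of [U], [G v] and [G h] when [h] is orthogonal to [v]. *)
Lemma fourier_indep_step :
  fourier_indep (fun w => (U w, G v w)) [set h | M h /\ b h v = 0].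
Proof.
move=> E mE h [Mh hv].
have cos1 (x : R) : 0 <= 1 + cos x by have := cos_geN1 x; lra.
have cos2 (x : R) : 1 + cos x <= 2 by have := cos_le1 x; lra.
have sin1 (x : R) : 0 <= 1 + sin x by have := sin_geN1 x; lra.
have sin2 (x : R) : 1 + sin x <= 2 by have := sin_le1 x; lra.
pose c := expR (- b h h / 2).
have c1 : 0 <= 1 + c by rewrite addr_ge0// expR_ge0.
pose K := 2 + (1 + c).
have mUV : measurable_fun setT (fun w => (U w, G v w)) by exact: measurable_fun_pair.
have mE1 : measurable_fun setT (fun w => \1_E (U w, G v w) : R).
  exact: measurableT_comp.
have iE (f : Om -> R) : measurable_fun setT f -> (forall w, `|f w| <= 1) ->
    P.-integrable setT (EFin \o (fun w => \1_E (U w, G v w) * f w)).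
  move=> mf f1; apply: (@bounded_integrable _ _ _ P _ 1).
    exact: measurable_funM.
  by move=> w; rewrite normrM mulr_ile1// ger0_norm// indic_le1.
have iE1 : P.-integrable setT (EFin \o (fun w => \1_E (U w, G v w))).
  have := iE (fun=> 1) (@measurable_cst _ _ _ _ _ _); rewrite /comp.
  by under eq_fun do rewrite mulr1; apply => w; rewrite normr1.
have PE : \int[P]_w \1_E (U w, G v w) = fine (P ((fun w => (U w, G v w)) @^-1` E)).
  by apply: indicator_expectation; rewrite -[X in measurable X]setTI; exact: mUV.
have iD D B : measurable D -> measurable (B : set R) ->
    P.-integrable setT (EFin \o (fun w => \1_D (U w) * \1_B (G v w))).
  move=> mD' mB; apply: int1 => //; first exact: measurableT_comp.
  by move=> w; rewrite ger0_norm// indic_le1.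
split.
  have := @rectangle_weighted _ _ _ P _ S (fun w => 1 + cos (G h w)) (fun=> 1 + c) K U (G v).
  move=> /(_ _ _ _ _ _ _ mU (mG v) _ E mE).
  rewrite RintegralZr// PE.
  under eq_Rintegral do rewrite mulrDr mulr1.
  rewrite RintegralD//; last by apply: iE => // w; exact: cos_max.
  rewrite PE -/c => H; suff : fine (P ((fun w => (U w, G v w)) @^-1` E)) +
      \int[P]_w (\1_E (U w, G v w) * cos (G h w)) =
      fine (P ((fun w => (U w, G v w)) @^-1` E)) * (1 + c).
    by rewrite mulrDr mulr1 => /addrI.
  apply: H => //.
  - by move=> w; apply: (le_trans (cos2 _)); rewrite /K lerDl.
  - exact: measurable_funD.
  - by move=> w; rewrite /K lerDr.
  - move=> A B mA mB; rewrite RintegralZr//; last exact: iD.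
    under eq_Rintegral do rewrite (mulrC (\1_A _)) -mulrA.
    rewrite weight_cos// -/c mulrAC -(PUB mA mB); congr (_ * _).
    by apply: eq_Rintegral => w _; rewrite mulrC.
have := @rectangle_weighted _ _ _ P _ S (fun w => 1 + sin (G h w)) (fun=> 1) K U (G v).
move=> /(_ _ _ _ _ _ _ mU (mG v) _ E mE).
rewrite RintegralZr// mulr1 PE.
under eq_Rintegral do rewrite mulrDr mulr1.
rewrite RintegralD//; last by apply: iE => // w; exact: sin_max.
rewrite PE => H; suff : fine (P ((fun w => (U w, G v w)) @^-1` E)) +
    \int[P]_w (\1_E (U w, G v w) * sin (G h w)) =
    fine (P ((fun w => (U w, G v w)) @^-1` E)).
  by move=> /eqP; rewrite -subr_eq0 addrC addKr => /eqP.
apply: H => //.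
- by move=> w; apply: (le_trans (sin2 _)); rewrite /K lerDl.
- exact: measurable_funD.
- by move=> w; rewrite /K; lra.
- move=> A B mA mB.
  under eq_Rintegral do rewrite (mulrC (\1_A _)) -mulrA.
  rewrite weight_sin// -(PUB mA mB).
  by apply: eq_Rintegral => w _; rewrite mulrC mulr1.
Qed.

End step.

End gaussian_family.

(** * Preimages of null sets *)

Section null_preimages.
Context {R : realType}.
Notation mu := (@lebesgue_measure R).

Let l := (@wlength R idfun).

Let l_itv (a b : R) : l `]a, b[%classic = lebesgue_measure `]a, b[%classic.
Proof. by rewrite /l wlength_itv/= -(@lebesgue_measure_itv R `]a, b[). Qed.

(** A function that contracts no distance by more than a factor [c] pulls an
    interval back to a set of comparable diameter. *)
Lemma expanding_preimage_negligible (f : R -> R) (D : set R) (c : R) (N : set R) :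
  0 < c -> (forall x y, D x -> D y -> c * `|x - y| <= `|f x - f y|) ->
  mu.-negligible N -> mu.-negligible (D `&` f @^-1` N).
Proof.
move=> c0 Df /negligible_outer_measure N0.
apply/negligible_outer_measure/eqP; rewrite eq_le outer_measure_ge0 andbT.
apply/lee_addgt0Pr => e e0; rewrite add0e.
have d0 : 0 < e * c / 2 by rewrite divr_gt0// mulr_gt0.
have [F [Fitv NF] Fe] : exists2 F, open_itv_cover N F &
    (\sum_(0 <= k <oo) l (F k) <= (e * c / 2)%:E)%E.
  have : (l^* N)%mu \is a fin_num by rewrite N0.
  rewrite outer_measure_open_itv_cover.
  move=> /lb_ereal_inf_adherent-/(_ _ d0)[_/= [F]] AF <-.
  rewrite -outer_measure_open_itv_cover N0 add0e => Fe.
  by exists F => //; exact/ltW.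
have step k : ((l^* (D `&` f @^-1` (F k)))%mu <= (2 / c)%:E * l (F k))%E.
  have [[a b] /= FE] := Fitv k.
  have [ab|ba] := ltP a b; last first.
    rewrite FE set_itv_ge ?bnd_simp -?leNgt// preimage_set0 setI0.
    by rewrite (_ : l set0 = 0%E) ?mule0 ?outer_measure0// /l wlength0.
  have [[x0 [Dx0 fx0]]|empty] := pselect (exists x, D x /\ F k (f x)); last first.
    rewrite (_ : _ `&` _ = set0) ?outer_measure0.
      by rewrite FE l_itv mule_ge0// lee_fin divr_ge0// ltW.
    by apply/seteqP; split => // x [Dx Fx]; apply: empty; exists x.
  pose r := (b - a) / c.
  have r0 : 0 < r by rewrite divr_gt0 ?subr_gt0.
  apply: (@le_trans _ _ (l^* `[x0 - r, x0 + r]%classic)%mu).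
    apply: le_outer_measure => x [Dx Fx] /=; rewrite in_itv /=.
    rewrite -ler_distlC distrC.
    have := Df _ _ Dx Dx0; rewrite -ler_pdivlMl// => /le_trans; apply.
    rewrite /r mulrC ler_pM2r ?invr_gt0//.
    move: fx0 Fx; rewrite /preimage FE /= !in_itv /= => /andP[h1 h2] /andP[h3 h4].
    by rewrite ler_norml; apply/andP; split; lra.
  rewrite [X in (X <= _)%E](_ : _ = mu `[x0 - r, x0 + r]%classic)//.
  rewrite FE l_itv !lebesgue_measure_itv /= !lte_fin ab.
  rewrite ifT; last by lra.
  rewrite -!EFinD -EFinM lee_fin /r le_eqVlt; apply/orP; left; apply/eqP.
  by field; rewrite gt_eqF.
apply: (@le_trans _ _ (l^* (\bigcup_k (D `&` f @^-1` (F k))))%mu).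
  apply: le_outer_measure => x [Dx /NF [k _ Fk]]; by exists k.
apply: (le_trans (outer_measure_sigma_subadditive _ _)).
apply: (@le_trans _ _ (\sum_(0 <= k <oo) (2 / c)%:E * l (F k)))%E.
  by apply: lee_nneseries => // k _; exact: step.
rewrite nneseriesZl; last by move=> k _; have [[a b] /= ->] := Fitv k; rewrite l_itv.
apply: le_trans (_ : ((2 / c)%:E * (e * c / 2)%:E <= _)%E).
  by rewrite lee_wpmul2l// lee_fin divr_ge0// ltW.
rewrite -EFinM lee_fin le_eqVlt; apply/orP; left; apply/eqP.
by field; rewrite gt_eqF.
Qed.

Lemma polynomial_locally_expanding (q : {poly R}) (x0 : R) : (q^`()).[x0] != 0 ->
  exists e c : R, [/\ 0 < e, 0 < c & forall x y, `|x - x0| < e -> `|y - x0| < e ->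
    c * `|x - y| <= `|q.[x] - q.[y]|].
Proof.
move=> q0.
have [e /= e0 He] : exists2 e : R, 0 < e &
    forall z, `|z - x0| < e -> `|(q^`()).[x0]| / 2 <= `|(q^`()).[z]|.
  have := @continuous_horner R (deriv q) x0.
  have h : 0 < `|(q^`()).[x0]| / 2 by rewrite divr_gt0 ?normr_gt0.
  move=> /cvgrPdist_le /(_ _ h) [e /= e0 He].
  exists e => // z zx0; have := He z; rewrite /ball_ /= distrC => /(_ zx0).
  have := ler_dist_dist (q^`()).[x0] (q^`()).[z].
  by have := lerB_dist (q^`()).[x0] (q^`()).[z]; lra.
exists e, (`|(q^`()).[x0]| / 2); split => //.
  by rewrite divr_gt0 ?normr_gt0.
have H x y : x < y -> `|x - x0| < e -> `|y - x0| < e ->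
    `|(q^`()).[x0]| / 2 * `|x - y| <= `|q.[x] - q.[y]|.
  move=> xy xe ye.
  have dq z : z \in `]x, y[ -> is_derive z (1 : R) (horner q) (q^`()).[z].
    move=> _; apply: DeriveDef; first exact: derivable_horner.
    by rewrite derivE derive1E.
  have cq : {within `[x, y], continuous (horner q)}.
    exact/continuous_subspaceT/continuous_horner.
  have [c cxy E] := MVT xy dq cq.
  rewrite distrC [leRHS]distrC E normrM ler_wpM2r//; apply: He.
  move: cxy xe ye; rewrite in_itv /= => /andP[xc cy].
  by rewrite !ltr_norml => /andP[h1 h2] /andP[h3 h4]; apply/andP; split; lra.
move=> x y xe ye; have [xy|xy|->] := ltgtP x y.
- exact: H.
- by rewrite distrC [leRHS]distrC; exact: H.
- by rewrite !subrr normr0 mulr0.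
Qed.

Lemma null_subset (A B : set R) : B `<=` A -> mu.-negligible A -> mu.-negligible B.
Proof.
by move=> BA [N [mN N0 AN]]; exists N; split => //; exact: subset_trans AN.
Qed.

Lemma negligible_bigcup_count (I : countType) (D : I -> set R) :
  (forall i, mu.-negligible (D i)) -> mu.-negligible (\bigcup_i D i).
Proof.
move=> D0; pose E n := [set x | exists i, choice.pickle i = n /\ D i x].
apply: (@null_subset (\bigcup_n E n)).
  by move=> x [i _ Dx]; exists (choice.pickle i) => //; exists i.
apply: negligible_bigcup => n.
have [[i <-]|no] := pselect (exists i : I, choice.pickle i = n); last first.
  apply: (@null_subset set0); last exact: negligible_set0.
  by move=> x [i [ni _]]; apply: no; exists i.
by apply: null_subset (D0 i) => x [j [/(pcan_inj (@choice.pickleK I)) ->]].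
Qed.

(** Off the finitely many critical points, a polynomial is locally expanding. *)
Lemma polynomial_preimage_negligible (q : {poly R}) (N : set R) : (1 < size q)%N ->
  mu.-negligible N -> mu.-negligible [set x | N q.[x]].
Proof.
move=> sq N0.
have q'0 : q^`() != 0.
  apply/eqP => /(congr1 (fun p : {poly R} => p`_(size q).-2)).
  rewrite coef_deriv coef0 prednK; last by case: (size q) sq => // -[].
  move/eqP; rewrite mulrn_eq0 -/(lead_coef q) lead_coef_eq0 -size_poly_eq0.
  by case: (size q) sq => // -[].
pose I := (rat * rat * nat)%type.
pose D (i : I) : set R := [set x | ratr i.1.1 < x < ratr i.1.2 /\
   (forall y z : R, ratr i.1.1 < y < ratr i.1.2 -> ratr i.1.1 < z < ratr i.1.2 ->
      i.2.+1%:R^-1 * `|y - z| <= `|q.[y] - q.[z]|)].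
have cover : [set x | N q.[x]] `<=`
    [set x | root q^`() x] `|` \bigcup_i (D i `&` [set x | N q.[x]]).
  move=> x Nx; have [rx|rx] := boolP (root q^`() x); first by left.
  right; have [e [c [e0 c0 H]]] := polynomial_locally_expanding rx.
  have [r1 /andP[r11 r12]] : exists r1 : rat, x - e < ratr r1 < x.
    by have [r r1] := @rat_in_itvoo R (x - e) x (ltac:(lra)); exists r; move: r1; rewrite in_itv.
  have [r2 /andP[r21 r22]] : exists r2 : rat, x < ratr r2 < x + e.
    by have [r r2] := @rat_in_itvoo R x (x + e) (ltac:(lra)); exists r; move: r2; rewrite in_itv.
  have [n nc] : exists n, (n.+1%:R^-1 : R) < c.
    by have [n] := ltr_add_invr c0; rewrite add0r; exists n.
  have Dx : D (r1, r2, n) x.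
    split => /=; first by apply/andP.
    move=> y z /andP[y1 y2] /andP[z1 z2].
    apply: le_trans (H y z _ _).
    - by rewrite ler_wpM2r// ltW.
    - by rewrite ltr_norml; apply/andP; split; lra.
    - by rewrite ltr_norml; apply/andP; split; lra.
  by exists (r1, r2, n).
apply: null_subset cover _; apply: negligibleU.
  have fin : finite_set [set x | root q^`() x].
    apply: contrapT => /(infinite_set_fset (size q^`())) [B BA].
    have := @max_poly_roots _ q^`() (enum_fset B) q'0.
    rewrite fset_uniq => H sB; have Ball : all (root q^`()) B by apply/allP => x /BA.
    by have := H Ball isT; rewrite ltnNge sB.
  apply/negligibleP.
    exact/countable_measurable/finite_set_countable.
  exact/countable_lebesgue_measure0/finite_set_countable.
apply: negligible_bigcup_count => -[[r1 r2] m].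
apply: (@expanding_preimage_negligible (horner q) _ (m.+1%:R^-1) N) => //.
move=> y z [/= yi H] [zi _]; exact: H.
Qed.

End null_preimages.

(** * Rotation invariant laws in the plane *)

Section plane.
Context {R : realType}.
Notation mu := (@lebesgue_measure R).

Definition plane_rot (b : R) (z : R * R) : R * R :=
  (cos b * z.1 - sin b * z.2, sin b * z.1 + cos b * z.2).

Definition sqnorm (z : R * R) : R := z.1 ^+ 2 + z.2 ^+ 2.

Lemma measurable_sqnorm : measurable_fun setT sqnorm.
Proof. by apply: measurable_funD; apply: measurable_funX. Qed.

Lemma rotD a b z : plane_rot a (plane_rot b z) = plane_rot (a + b) z.
Proof. by rewrite /plane_rot cosD sinD /=; congr pair; ring. Qed.

Lemma polar_form (z : R * R) : exists b, z = plane_rot b (Num.sqrt (sqnorm z), 0).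
Proof.
case: z => x y; rewrite /sqnorm /=; set r := Num.sqrt _.
have r2 : r ^+ 2 = x ^+ 2 + y ^+ 2 by rewrite sqr_sqrtr// addr_ge0 ?sqr_ge0.
have r0 : 0 <= r by exact: sqrtr_ge0.
have [r0'|rn0] := eqVneq r 0.
  exists 0; move: r2; rewrite r0' expr0n => /esym/eqP.
  rewrite paddr_eq0 ?sqr_ge0// !sqrf_eq0 => /andP[/eqP-> /eqP->].
  by rewrite /plane_rot /= !mulr0 subrr addr0.
have rp : 0 < r by rewrite lt_neqAle eq_sym rn0.
have xr : -1 <= x / r <= 1.
  rewrite -ler_norml normrM normfV (ger0_norm r0) ler_pdivrMr// mul1r.
  rewrite -(@ler_pXn2r _ 2) ?nnegrE// real_normK ?num_real// r2 lerDl sqr_ge0//.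
have cosa : cos (acos (x / r)) = x / r by rewrite acosK// in_itv.
have sina : sin (acos (x / r)) = `|y| / r.
  rewrite sin_acos//; apply/eqP; rewrite -(@eqrXn2 _ 2) ?sqrtr_ge0//; last first.
    by rewrite divr_ge0.
  rewrite sqr_sqrtr; last first.
    by move/andP: xr => [h1 h2]; nra.
  apply/eqP; rewrite !expr_div_n real_normK ?num_real//.
  have -> : y ^+ 2 = r ^+ 2 - x ^+ 2 by rewrite r2; ring.
  by field.
have [y0|y0] := leP 0 y.
  exists (acos (x / r)); rewrite /plane_rot /= cosa sina ger0_norm//.
  by congr pair; field.
exists (- acos (x / r)); rewrite /plane_rot /= cosN sinN cosa sina ltr0_norm//.
by congr pair; field.
Qed.

Lemma measurable_rot (N : set (R * R)) : measurable N ->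
  measurable [set bz : R * (R * R) | N (plane_rot bz.1 bz.2)].
Proof.
move=> mN.
have m1 : measurable_fun setT (fun bz : R * (R * R) => plane_rot bz.1 bz.2).
  have mc : measurable_fun setT (fun bz : R * (R * R) => cos bz.1).
    by apply: measurableT_comp; first exact: measurable_cos.
  have ms : measurable_fun setT (fun bz : R * (R * R) => sin bz.1).
    by apply: measurableT_comp; first exact: measurable_sin.
  have mx : measurable_fun setT (fun bz : R * (R * R) => bz.2.1).
    by apply: measurableT_comp.
  have my : measurable_fun setT (fun bz : R * (R * R) => bz.2.2).
    by apply: measurableT_comp.
  apply: measurable_fun_pair.
    by apply: measurable_funB; apply: measurable_funM.
  by apply: measurable_funD; apply: measurable_funM.
by rewrite -[X in measurable X]setTI; exact: m1.
Qed.

Section radial.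
Context d (Om : measurableType d) (P : probability Om R).

(** Angles range over the whole line, on which translations need no reduction
    modulo [2 pi]; only the vanishing of this measure matters. *)
Definition arc (N : set (R * R)) (z : R * R) : \bar R := mu [set b | N (plane_rot b z)].

Lemma measurable_arc N : measurable N -> measurable_fun setT (arc N).
Proof.
move=> mN; have mE := measurable_rot mN.
set E := [set bz : R * (R * R) | _] in mE.
have mf : measurable_fun setT (fun bz => (\1_E bz : R)%:E).
  by apply/measurable_EFinP; exact: measurable_indic.
have f0 bz : (0 <= (\1_E bz : R)%:E)%E by rewrite lee_fin.
apply: (eq_measurable_fun (fubini_G mu (fun bz => (\1_E bz : R)%:E))); last first.
  exact: measurable_fun_fubini_tonelli_G.
move=> z _; rewrite /fubini_G /arc -[X in mu X]setIT -integral_indic//.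
rewrite -[X in measurable X]setTI.
exact: (measurable_pair2 z measurableT mE).
Qed.

Lemma arc_rot N a z : measurable N -> arc N z = 0%E -> arc N (plane_rot a z) = 0%E.
Proof.
move=> mN; rewrite /arc => z0.
have mz y : measurable [set b | N (plane_rot b y)].
  rewrite -[X in measurable X]setTI.
  exact: (measurable_pair2 y measurableT (measurable_rot mN)).
apply/negligibleP; first exact: mz.
have -> : [set b | N (plane_rot b (plane_rot a z))] = setT `&` (fun b => b + a) @^-1` [set b | N (plane_rot b z)].
  by apply/seteqP; split => b /=; rewrite rotD => //; case.
apply: (@expanding_preimage_negligible _ _ _ 1) => //; last first.
  by apply/negligibleP; [exact: mz|exact: z0].
by move=> x y _ _; rewrite mul1r opprD addrACA subrr addr0.
Qed.

Lemma arc_sqnorm N z : measurable N ->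
  arc N z = 0%E <-> arc N (Num.sqrt (sqnorm z), 0) = 0%E.
Proof.
move=> mN; have [b zE] := polar_form z; split => h; last by rewrite zE; exact: arc_rot.
have -> : (Num.sqrt (sqnorm z), 0) = plane_rot (- b) z; last exact: arc_rot.
by rewrite {2}zE rotD addNr /plane_rot cos0 sin0 /= !mul1r !mul0r subr0 addr0.
Qed.

Lemma integral_arc N (Z : Om -> R * R) : measurable N -> measurable_fun setT Z ->
  (\int[P]_w arc N (Z w) = \int[mu]_b P [set w | N (plane_rot b (Z w))])%E.
Proof.
move=> mN mZ; have mE0 := measurable_rot mN.
set E0 := [set bz : R * (R * R) | _] in mE0.
pose E := [set bw : R * Om | N (plane_rot bw.1 (Z bw.2))].
have mE : measurable E.
  have mZ' : measurable_fun setT (fun bw : R * Om => (bw.1, Z bw.2)).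
    apply: measurable_fun_pair => //.
    exact: measurableT_comp.
  by have := mZ' measurableT _ mE0; rewrite setTI.
have mf : measurable_fun setT (fun bz => (\1_E bz : R)%:E).
  by apply/measurable_EFinP; exact: measurable_indic.
have f0 bz : (0 <= (\1_E bz : R)%:E)%E by rewrite lee_fin.
transitivity (\int[P]_w \int[mu]_b (\1_E (b, w))%:E)%E.
  apply: eq_integral => w _; rewrite /arc -[X in mu X]setIT -integral_indic//.
  rewrite -[X in measurable X]setTI.
  exact: (measurable_pair2 w measurableT mE).
transitivity (\int[mu]_b \int[P]_w (\1_E (b, w))%:E)%E.
  exact/esym/(fubini_tonelli (m1 := mu) (m2 := P) (fun bz => (\1_E bz : R)%:E)).
apply: eq_integral => b _.
rewrite -[X in P X]setIT -integral_indic//.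
rewrite -[X in measurable X]setTI.
exact: (measurable_pair1 b measurableT mE).
Qed.

(** [Z] is a reference variable, in the application a Gaussian one. As the law
    of [F] is rotation invariant, [P (F \in N)] vanishes if [N] meets almost
    every circle through [F] in a null set of angles. Whether it does depends
    on the squared modulus only, and the exceptional values of the latter form
    a null set [B], as is seen on the circles through [Z]. *)
Lemma rotation_invariant_null (Z F : Om -> R * R) (N : set (R * R)) :
  measurable N -> measurable_fun setT Z -> measurable_fun setT F ->
  (forall b, P [set w | N (plane_rot b (Z w))] = 0%E) ->
  (forall B : set R, measurable B -> P [set w | B (sqnorm (Z w))] = 0%E ->
     mu.-negligible (B `&` [set s | 0 < s])) ->
  (forall b, P [set w | N (plane_rot b (F w))] = P [set w | N (F w)]) ->
  (forall B : set R, measurable B -> mu.-negligible B ->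
     P [set w | B (sqnorm (F w))] = 0%E) ->
  P [set w | N (F w)] = 0%E.
Proof.
move=> mN mZ mF ZN Zr FN Fr.
pose B : set R := [set s | 0 < s /\ arc N (Num.sqrt s, 0) != 0%E].
have marc := measurable_arc mN.
have m1 : measurable_fun setT (fun s : R => arc N (Num.sqrt s, 0)).
  apply: measurableT_comp => //; apply: measurable_fun_pair => //.
  exact: (continuous_measurable_fun (@sqrt_continuous R)).
have mpos : measurable [set s : R | 0 < s].
  by rewrite (_ : [set s | _] = `]0, +oo[%classic) // ; apply/seteqP; split => s /=; rewrite in_itv /= andbT.
have mB : measurable B.
  have -> : B = [set s | 0 < s] `&` [set s | arc N (Num.sqrt s, 0) != 0%E] by [].
  apply: measurableI => //.
  by have := emeasurable_neq measurableT m1 0%E; rewrite setTI.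
have mq := measurable_sqnorm.
have arc0 z : arc N z <> 0%E -> B (sqnorm z) \/ sqnorm z = 0.
  move=> az; have [z0|zn0] := eqVneq (sqnorm z) 0; [by right|left].
  split; first by rewrite lt_neqAle eq_sym zn0 addr_ge0 ?sqr_ge0.
  by apply/eqP => /(arc_sqnorm z mN).
have B0 : mu.-negligible B.
  apply: (@null_subset _ (B `&` [set s | 0 < s])); first by move=> s [].
  apply: Zr => //.
  have : (\int[P]_w `|arc N (Z w)| = 0)%E.
    under eq_integral do rewrite gee0_abs ?measure_ge0//.
    by rewrite integral_arc//; apply: integral0_eq => b _; exact: ZN.
  have marcZ : measurable_fun setT (fun w => arc N (Z w)) by exact: measurableT_comp.
  move/(ae_eq_integral_abs P measurableT marcZ) => ae0.
  have mBZ : measurable [set w | B (sqnorm (Z w))].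
    have mqZ : measurable_fun setT (fun w => sqnorm (Z w)) by exact: measurableT_comp.
    by have := mqZ measurableT _ mB; rewrite setTI.
  apply/negligibleP => //; apply: negligibleS ae0 => w [s0 /eqP h] /= H; apply: h.
  by apply/(arc_sqnorm (Z w) mN); exact: H.
have B00 : P [set w | (B `|` [set 0]) (sqnorm (F w))] = 0%E.
  apply: Fr; first exact: measurableU.
  apply: negligibleU => //; apply/negligibleP => //; exact: lebesgue_measure_set1.
have marcF : measurable_fun setT (fun w => arc N (F w)) by exact: measurableT_comp.
have mqF : measurable_fun setT (fun w => sqnorm (F w)) by exact: measurableT_comp.
have ae0 : (\int[P]_w arc N (F w) = 0)%E.
  rewrite -(integral0 P setT); apply: ae_eq_integral => //.
  exists [set w | (B `|` [set 0]) (sqnorm (F w))]; split => //.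
    have mB0 : measurable (B `|` [set 0]) by apply: measurableU.
    by have := mqF measurableT _ mB0; rewrite setTI.
  by move=> w /= /not_implyP[_ /arc0].
move: ae0; rewrite integral_arc//; under eq_integral do rewrite FN.
rewrite integral_cst//.
have muT : mu [set: R] = +oo%E by rewrite -set_itvNyy lebesgue_measure_itv.
move=> H; have {H} : (P [set w | N (F w)] * mu [set: R] = 0)%E := H; rewrite muT.

have := measure_ge0 P [set w | N (F w)].
rewrite le_eqVlt => /orP[/eqP <- //|p0].
by rewrite gt0_muley.
Qed.

End radial.
End plane.

(** * Complex Hermite polynomials *)

Section wick.
Context {R : realType}.
Local Notation C := R[i].
Local Notation ii := ((0 : R) +i* 1)%C.
Implicit Types (z zeta : C).

(** The Wick power of [z^m z^*^n] for a complex Gaussian variable of covariance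
    [c]; see [hermite_wick] for the relation with the generating function. *)
Fixpoint wick (c m n : nat) z : C :=
  if m is m'.+1 then z * wick c m' n z - (c * n)%:R * wick c m' n.-1 z
  else z^* ^+ n.

Lemma wick0r c m z : wick c m 0 z = z ^+ m.
Proof. by elim: m => //= m ->; rewrite muln0 mul0r subr0 exprS. Qed.

Lemma wickSr c m n z :
  wick c m n.+1 z = z^* * wick c m n z - (c * m)%:R * wick c m.-1 n z.
Proof.
elim: m n => [|m IHm] n; first by rewrite muln0 mul0r subr0 /= exprS.
have E : (c * m)%:R * (z * wick c m.-1 n z) =
    (c * m)%:R * (wick c m n z + (c * n)%:R * wick c m.-1 n.-1 z).
  by case: m {IHm} => [|m /=]; rewrite ?muln0 ?mul0r// subrK.
have E2 : (c * n)%:R * (z^* * wick c m n.-1 z) =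
    (c * n)%:R * (wick c m n z + (c * m)%:R * wick c m.-1 n.-1 z).
  by case: n {E} => [|n /=]; rewrite ?muln0 ?mul0r// IHm subrK.
rewrite /= IHm.
move: E E2; rewrite !natrM -!natr1.
move: (wick c m n z) (wick c m.-1 n z) (wick c m n.-1 z) (wick c m.-1 n.-1 z).
move=> a b d e E E2.
have -> : z * (z^* * a - c%:R * m%:R * b) - c%:R * (n%:R + 1) * a =
  z * z^* * a - c%:R * m%:R * (z * b) - c%:R * (n%:R + 1) * a by ring.
rewrite E.
have -> : z^* * (z * a - c%:R * n%:R * d) - c%:R * (m%:R + 1) * a =
  z * z^* * a - c%:R * n%:R * (z^* * d) - c%:R * (m%:R + 1) * a by ring.
rewrite E2; ring.
Qed.

Lemma wick_conj c m n z : (wick c m n z)^* = wick c n m z.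
Proof.
elim: m n => [|m IHm] n /=; first by rewrite wick0r rmorphXn /= conjCK.
by rewrite wickSr rmorphB !rmorphM /= !IHm !rmorph_nat.
Qed.

Lemma wick_rot c m n zeta z : zeta * zeta^* = 1 ->
  zeta ^+ n * wick c m n (zeta * z) = zeta ^+ m * wick c m n z.
Proof.
move=> z1; elim: m n => [|m IHm] n /=.
  by rewrite expr0 mul1r rmorphM /= exprMn mulrA -exprMn z1 expr1n mul1r.
have H : (c * n)%:R * (zeta ^+ n * wick c m n.-1 (zeta * z)) =
    (c * n)%:R * (zeta ^+ m.+1 * wick c m n.-1 z).
  case: n => [|n]; first by rewrite muln0 !mul0r.
  by rewrite !exprS -!mulrA IHm.
transitivity (zeta * z * (zeta ^+ n * wick c m n (zeta * z)) -
    (c * n)%:R * (zeta ^+ n * wick c m n.-1 (zeta * z))); first by ring.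
by rewrite H IHm exprS; ring.
Qed.

Lemma wick_scale m n (s : C) z : s^* = s -> s * s = 2 ->
  wick 2 m n (s * z) = s ^+ (m + n) * wick 1 m n z.
Proof.
move=> sr s2; elim: m n => [|m IHm] n /=.
  by rewrite rmorphM /= sr exprMn.
rewrite !IHm mul1n natrM -s2.
have H : (s * s * n%:R) * (s ^+ (m + n.-1) * wick 1 m n.-1 z) =
    n%:R * (s ^+ (m.+1 + n) * wick 1 m n.-1 z).
  case: n => [|n]; first by rewrite !mulr0 !mul0r.
  by rewrite addSn addnS !exprS /=; ring.
by rewrite H addSn exprS; ring.
Qed.

(** The leading term on a vertical line is that of [z ^+ m * z^* ^+ n]. *)
Lemma wick_vertical_poly c m n (a : R) : exists p : {poly C},
  [/\ size p = (m + n).+1, lead_coef p = ii ^+ m * (- ii) ^+ n &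
      forall b : R, p.[b%:C%C] = wick c m n (a +i* b)%C].
Proof.
have zE (b : R) : (a +i* b)%C = a%:C%C + ii * b%:C%C by apply/eqP; rewrite eq_complex /=; simpc.
have iC : ii * ii = -1 :> C by apply/eqP; rewrite eq_complex /=; simpc.
pose L : {poly C} := ii%:P * 'X + (a%:C%C)%:P.
pose L' : {poly C} := (- ii)%:P * 'X + (a%:C%C)%:P.
have i0 : ii != 0 :> C by rewrite eq_complex /= oner_eq0 andbF.
have sL : size L = 2 by rewrite size_MXaddC polyC_eq0 (negPf i0) size_polyC i0.
have lL : lead_coef L = ii.
  by rewrite lead_coefE sL /= coefD coefMX coefC /= coefC addr0.
have sL' : size L' = 2 by rewrite size_MXaddC polyC_eq0 oppr_eq0 (negPf i0) size_polyC oppr_eq0 i0.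
have lL' : lead_coef L' = - ii.
  by rewrite lead_coefE sL' /= coefD coefMX coefC /= coefC addr0.
elim: m n => [|m IHm] n.
  exists (L' ^+ n); split.
  - rewrite -(prednK (n := size (L' ^+ n))) ?size_exp ?sL' ?mul1n//.
    by rewrite size_poly_gt0 expf_neq0// -size_poly_eq0 sL'.
  - by rewrite lead_coef_exp lL' expr0 mul1r.
  - move=> b; rewrite horner_exp /L' !hornerE /=; congr (_ ^+ n).
    by apply/eqP; rewrite eq_complex /=; simpc.
have [p [sp lp pE]] := IHm n.
have p0 : p != 0 by rewrite -size_poly_eq0 sp.
have L0 : L != 0 by rewrite -size_poly_eq0 sL.
have sLp : size (L * p) = (m.+1 + n).+1 by rewrite size_mul// sL sp.
have lLp : lead_coef (L * p) = ii ^+ m.+1 * (- ii) ^+ n.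
  by rewrite lead_coefM lL lp mulrA exprS.
have LpE (b : R) : (L * p).[b%:C%C] = (a +i* b)%C * wick c m n (a +i* b)%C.
  rewrite hornerM pE /L !hornerE /=; congr (_ * _).
  by rewrite zE addrC.
case: n IHm p sp lp pE p0 sLp lLp LpE => [|n] IHm p sp lp pE p0 sLp lLp LpE.
  by exists (L * p); split => // b; rewrite LpE /= muln0 mul0r subr0.
have [q [sq _ qE]] := IHm n.
have lt : (size (- ((c * n.+1)%:R%:P * q)%R) < size (L * p)%R)%N.
  rewrite size_polyN sLp mul_polyC; apply: leq_ltn_trans (size_scale_leq _ _) _.
  by rewrite sq addSn addnS; apply: leqnSn.
exists (L * p - (c * n.+1)%:R%:P * q); split.
- by rewrite size_polyDl.
- by rewrite lead_coefDl.
- by move=> b; rewrite hornerD hornerN LpE hornerM hornerC qE.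
Qed.

Definition sqmod z : R := complex.Re z ^+ 2 + complex.Im z ^+ 2.

Lemma sqmodE z : (sqmod z)%:C%C = z * z^*.
Proof. by case: z => x y; rewrite /sqmod /=; apply/eqP; rewrite eq_complex /=; apply/andP; split; apply/eqP; ring. Qed.

Lemma sqmodM z1 z2 : sqmod (z1 * z2) = sqmod z1 * sqmod z2.
Proof. by case: z1 => a b; case: z2 => x y; rewrite /sqmod /=; ring. Qed.

Lemma sqmod_ge0 z : 0 <= sqmod z. Proof. by rewrite addr_ge0 ?sqr_ge0. Qed.

Lemma sqmod_eq0 z : (sqmod z == 0) = (z == 0).
Proof.
case: z => x y; rewrite /sqmod /= eq_complex /= paddr_eq0 ?sqr_ge0//.
by rewrite !sqrf_eq0.
Qed.

Lemma sqmodD z1 z2 : sqmod (z1 + z2) <= 2 * sqmod z1 + 2 * sqmod z2.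
Proof.
case: z1 => a b; case: z2 => x y; rewrite /sqmod /=.
by have := sqr_ge0 (a - x); have := sqr_ge0 (b - y); nra.
Qed.

(** Multiplying a polynomial by the conjugate polynomial doubles its degree. *)
Lemma sqmod_wick_poly c m n (a : R) : exists r : {poly R},
  size r = (2 * (m + n)).+1 /\ forall b : R, sqmod (wick c m n (a +i* b)%C) = r.[b].
Proof.
have [p [sp lp pE]] := wick_vertical_poly c m n a.
pose q := p * map_poly (@Num.conj C) p.
have sq : size q = (2 * (m + n)).+1.
  have p0 : p != 0 by rewrite -size_poly_eq0 sp.
  rewrite size_mul// ?map_poly_eq0// size_map_poly sp /=.
  by rewrite mul2n -addnn addnS.
have lq : lead_coef q = 1.
  rewrite lead_coefM lead_coef_map lp.
  have i1 : ii * ii^* = 1 :> C by apply/eqP; rewrite eq_complex /=; simpc.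
  rewrite rmorphM !rmorphXn /= rmorphN mulrACA -!exprMn mulrNN i1.
  by rewrite !expr1n mul1r.
pose r := \poly_(k < size q) complex.Re q`_k.
have rE (b : R) : r.[b] = complex.Re q.[b%:C%C].
  rewrite horner_poly horner_coef raddf_sum; apply: eq_bigr => k _.
  rewrite -rmorphXn /=; case: (q`_k) => x y /=; by rewrite mulr0 subr0.
exists r; split.
  rewrite -sq; apply: size_poly_eq; rewrite -lead_coefE lq /=; exact: oner_neq0.
move=> b; rewrite rE /q hornerM.
have -> : (map_poly (@Num.conj C) p).[b%:C%C] = (p.[b%:C%C])^*.
  have bE : b%:C%C = (b%:C%C)^* by apply/eqP; rewrite eq_complex /= oppr0 !eqxx.
  by rewrite {1}bE horner_map.
by rewrite -sqmodE pE.
Qed.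

End wick.

(** * Functions of an independent Gaussian variable *)

Section independent_gaussian.
Context {R : realType}.
Notation mu := (@lebesgue_measure R).
Notation gamma := (@normal_prob R 0 1).

(** The standard Gaussian density is positive. *)
Lemma normal_prob_null (A : set R) : measurable A ->
  gamma A = 0%E <-> mu.-negligible A.
Proof.
move=> mA; split => [A0|]; last first.
  move=> /(negligibleP mu mA) A0.
  exact: (null_content_dominatesP _ _).1 (normal_prob_dominates 0 1) _ mA A0.
have mk : measurable_fun A (fun x : R => (normal_pdf 0 1 x)%:E).
  by apply: measurable_funTS; apply/measurable_EFinP; exact: measurable_normal_pdf.
have : (\int[mu]_(x in A) `|(normal_pdf 0 1 x)%:E| = 0)%E.
  by rewrite -[RHS]A0; apply: eq_integral => x _; rewrite gee0_abs// lee_fin normal_pdf_ge0.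
move/(ae_eq_integral_abs mu mA mk).1; apply: negligibleS => x Ax H.
have := H Ax; rewrite normal_pdfE ?oner_neq0//= => -[] /eqP.
by rewrite mulf_eq0 gt_eqF ?normal_peak_gt0 ?oner_neq0//= gt_eqF// /normal_fun expR_gt0.
Qed.

Context d (Om : measurableType d) (P : probability Om R).
Context d' (S : measurableType d') (U : Om -> S) (V : Om -> R).
Hypotheses (mU : measurable_fun setT U) (mV : measurable_fun setT V).
Hypothesis UV : forall D B, measurable D -> measurable B ->
  P (U @^-1` D `&` V @^-1` B) = (P (U @^-1` D) * gamma B)%E.

Lemma indep_section (E : set (S * R)) : measurable E ->
  fine (P [set w | E (U w, V w)]) = \int[P]_w fine (gamma (xsection E (U w))).
Proof.
move=> mE.
have [m [mE' mI]] := law_measure P mU.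
pose UVR w : S * measurableTypeR R := (U w, V w).
have mUV : measurable_fun setT UVR by apply: measurable_fun_pair.
have [n [nE' _]] := law_measure P mUV.
have -> : fine (P [set w | E (U w, V w)]) = fine (n E) by rewrite nE'.
rewrite -(@product_measure_unique _ _ _ _ R m (normal_prob 0 1) n)//; last first.
  move=> A B mA mB; transitivity (P (UVR @^-1` (A `*` B))); first exact: (nE' _ (measurableX mA mB)).
  transitivity (P (U @^-1` A) * gamma B)%E; first exact: UV.
  by congr (_ * _)%E; exact/esym/mE'.
have mX : measurable_fun setT (fun x => gamma (xsection E x)).
  exact: (measurable_fun_xsection (normal_prob 0 1)).
have mf : measurable_fun setT (fun x => fine (gamma (xsection E x))) by exact: measurableT_comp.
rewrite (mI (fun x => fine (gamma (xsection E x))) 1) //.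
  rewrite /Rintegral; congr fine; apply: eq_integral => x _ /=.
  by rewrite fineK// fin_num_measure//; exact: measurable_xsection.
move=> x; have mEx := measurable_xsection x mE.
rewrite ger0_norm ?fine_ge0 ?measure_ge0// -lee_fin fineK ?fin_num_measure//.
exact: probability_le1.
Qed.

Let mUV : measurable_fun setT (fun w => (U w, V w)).
Proof. exact: measurable_fun_pair. Qed.

Let mgamma (E : set (S * R)) : measurable E ->
  measurable_fun setT (fun w => gamma (xsection E (U w))).
Proof.
move=> mE; apply: (measurableT_comp (f := fun x => gamma (xsection E x))) => //.
exact: (measurable_fun_xsection (normal_prob 0 1)).
Qed.

(** By Fubini's theorem the probability is the expectation of the Gaussian
    measure of the section of [E] at [U]. *)
Lemma indep_section_null (E : set (S * R)) : measurable E ->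
  P [set w | E (U w, V w)] = 0%E <->
  {ae P, forall w, mu.-negligible [set v | E (U w, v)]}.
Proof.
move=> mE.
have mP : measurable [set w | E (U w, V w)].
  by rewrite -[X in measurable X]setTI; exact: mUV.
have xE u : [set v | E (u, v)] = xsection E u.
  by apply/seteqP; split=> v; rewrite /xsection /= inE.
have g0 u : gamma (xsection E u) = 0%E <-> mu.-negligible [set v | E (u, v)].
  by rewrite xE; apply: normal_prob_null; exact: measurable_xsection.
have gfin u : fine (gamma (xsection E u)) = 0 <-> gamma (xsection E u) = 0%E.
  split=> [h|->//]; rewrite -[LHS]fineK ?h// fin_num_measure//; exact: measurable_xsection.
have := ae_eq_integral_abs P measurableT (mgamma mE).
have <- : (P [set w | E (U w, V w)] = \int[P]_w `|gamma (xsection E (U w))|)%E.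
  rewrite -[LHS]fineK ?fin_num_measure// indep_section// /Rintegral.
  have gfn u : gamma (xsection E u) \is a fin_num.
    by rewrite fin_num_measure//; exact: measurable_xsection.
  rewrite fineK.
    by apply: eq_integral => w _; rewrite fineK// gee0_abs// measure_ge0.
  apply: integrable_fin_num => //; apply: (@bounded_integrable _ _ _ P _ 1).
    by apply: measurableT_comp => //; exact: mgamma.
  move=> w; rewrite ger0_norm ?fine_ge0 ?measure_ge0// -lee_fin fineK//.
  apply: probability_le1; exact: measurable_xsection.
move=> H; rewrite H; split; apply: filterS => w /=; first by move/(_ I)/g0.
by move/g0.
Qed.

End independent_gaussian.

(** * Complex random variables *)

Section complex_measurable.
Context {R : realType} d (Om : measurableType d).
Local Notation C := R[i].
Implicit Types (f g : Om -> C).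

Definition c2r (z : C) : R * R := (complex.Re z, complex.Im z).
Definition r2c (z : R * R) : C := (z.1 +i* z.2)%C.

Lemma r2cK : cancel r2c c2r. Proof. by case. Qed.
Lemma c2rK : cancel c2r r2c. Proof. by case. Qed.

Definition cmeasurable f := measurable_fun setT (fun w => c2r (f w)).

Lemma cmeasurableP f : cmeasurable f <->
  measurable_fun setT (fun w => complex.Re (f w)) /\
  measurable_fun setT (fun w => complex.Im (f w)).
Proof.
split=> [mf|[mr mi]]; last exact: measurable_fun_pair.
by split; [have := measurableT_comp measurable_fst mf|have := measurableT_comp measurable_snd mf].
Qed.

Lemma cmeasurable_cst (c : C) : cmeasurable (fun=> c).
Proof. exact: measurable_cst. Qed.

Lemma cmeasurableB f g : cmeasurable f -> cmeasurable g ->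
  cmeasurable (fun w => f w - g w).
Proof.
move=> /cmeasurableP[fr fi] /cmeasurableP[gr gi]; apply/cmeasurableP; split.
  apply: eq_measurable_fun (measurable_funB fr gr) => w _ /=.
  by case: (f w) (g w) => [? ?] [? ?].
apply: eq_measurable_fun (measurable_funB fi gi) => w _ /=.
by case: (f w) (g w) => [? ?] [? ?].
Qed.

Lemma cmeasurableM f g : cmeasurable f -> cmeasurable g ->
  cmeasurable (fun w => f w * g w).
Proof.
move=> /cmeasurableP[fr fi] /cmeasurableP[gr gi]; apply/cmeasurableP; split.
  apply: eq_measurable_fun (measurable_funB (measurable_funM fr gr) (measurable_funM fi gi)) => w _ /=.
  by case: (f w) (g w) => [? ?] [? ?].
apply: eq_measurable_fun (measurable_funD (measurable_funM fr gi) (measurable_funM fi gr)) => w _ /=.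
by case: (f w) (g w) => [? ?] [? ?].
Qed.

Lemma cmeasurable_conj f : cmeasurable f -> cmeasurable (fun w => (f w)^*).
Proof.
move=> /cmeasurableP[fr fi]; apply/cmeasurableP; split.
  by apply: eq_measurable_fun fr => w _; case: (f w).
apply: (eq_measurable_fun (fun w => - complex.Im (f w))); first by move=> w _; case: (f w).
exact: measurableT_comp.
Qed.

Lemma cmeasurableX f n : cmeasurable f -> cmeasurable (fun w => f w ^+ n).
Proof.
move=> mf; elim: n => [|n IHn]; first exact: cmeasurable_cst.
by under [X in cmeasurable X]eq_fun do rewrite exprS; exact: cmeasurableM.
Qed.

Lemma cmeasurable_wick c m n f : cmeasurable f -> cmeasurable (fun w => wick c m n (f w)).
Proof.
move=> mf; elim: m n => [|m IHm] n /=.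
  by apply: cmeasurableX; exact: cmeasurable_conj.
apply: cmeasurableB; apply: cmeasurableM => //; exact: cmeasurable_cst.
Qed.

Lemma measurable_sqmod f : cmeasurable f -> measurable_fun setT (fun w => sqmod (f w)).
Proof.
by move=> /cmeasurableP[fr fi]; apply: measurable_funD; apply: measurable_funX.
Qed.

End complex_measurable.

Section laws.
Context {R : realType} d (Om : measurableType d) (P : probability Om R).

Lemma rectangle_law_unique d1 d2 (S1 : measurableType d1) (S2 : measurableType d2)
    (U U' : Om -> S1) (V V' : Om -> S2) :
  measurable_fun setT U -> measurable_fun setT U' ->
  measurable_fun setT V -> measurable_fun setT V' ->
  (forall A B, measurable A -> measurable B ->
     P (U @^-1` A `&` V @^-1` B) = P (U' @^-1` A `&` V' @^-1` B)) ->
  forall E, measurable E -> P [set w | E (U w, V w)] = P [set w | E (U' w, V' w)].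
Proof.
move=> mU mU' mV mV' UV E mE.
have mUV : measurable_fun setT (fun w => (U w, V w)) by exact: measurable_fun_pair.
have mUV' : measurable_fun setT (fun w => (U' w, V' w)) by exact: measurable_fun_pair.
have [n [nD _]] := law_measure P mUV; have [n' [nD' _]] := law_measure P mUV'.
transitivity (n E); first by rewrite nD.
transitivity (n' E); last by rewrite nD'.
apply: rectangle_measure_unique => // A B mA mB.
by rewrite nD ?nD'; [exact: UV|exact: measurableX|exact: measurableX].
Qed.

End laws.

Lemma measurable_last_pair {R : realType} d (S : measurableType d) :
  measurable_fun setT (fun z : (S * R) * R => (z.1.2, z.2)).
Proof.
apply: measurable_fun_pair; last exact: measurable_snd.
exact: (measurableT_comp measurable_snd).
Qed.

Section two_gaussians.
Context {R : realType} d (Om : measurableType d) (P : probability Om R).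
Notation mu := (@lebesgue_measure R).
Notation gamma := (@normal_prob R 0 1).
Local Notation C := R[i].
Context d' (S : measurableType d') (U : Om -> S) (A B : Om -> R).
Hypotheses (mU : measurable_fun setT U) (mA : measurable_fun setT A)
  (mB : measurable_fun setT B).
Hypothesis UA : forall D E, measurable D -> measurable E ->
  P (U @^-1` D `&` A @^-1` E) = (P (U @^-1` D) * gamma E)%E.
Hypothesis UAB : forall D E, measurable D -> measurable E ->
  P ((fun w => (U w, A w)) @^-1` D `&` B @^-1` E) =
  (P ((fun w => (U w, A w)) @^-1` D) * gamma E)%E.

Let mUA : measurable_fun setT (fun w => (U w, A w)).
Proof. exact: measurable_fun_pair. Qed.

Let law_A E : measurable E -> P (A @^-1` E) = gamma E.
Proof.
by move=> mE; have := UA measurableT mE; rewrite preimage_setT setTI probability_setT mul1e.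
Qed.

Lemma gaussian_pair_null (E : set ((S * R) * R)) : measurable E ->
  P [set w | E (U w, A w, B w)] = 0%E <->
  {ae P, forall w, mu.-negligible [set b | E (U w, A w, b)]}.
Proof. by move=> mE; exact: (indep_section_null mUA mB UAB mE). Qed.

(** For almost every small [a > 0] the set of the [b] with [T (a^2 + b^2)] is
    null, and its preimage under the locally expanding map that sends [s] to
    the square root of [s - a^2] contains the part of [T] above [a^2]. *)
Lemma gaussian_pair_sqnorm (T : set R) : measurable T ->
  P [set w | T (sqnorm (A w, B w))] = 0%E -> mu.-negligible (T `&` [set s | 0 < s]).
Proof.
move=> mT PT.
pose E : set ((S * R) * R) := [set z | T (sqnorm (z.1.2, z.2))].
have mE : measurable E.
  have ms := measurableT_comp (measurable_sqnorm (R := R)) (@measurable_last_pair R _ S).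
  by have := ms measurableT _ mT; rewrite setTI.
have ae0 := (gaussian_pair_null mE).1 PT.
have good n : exists2 a : R, 0 < a < n.+1%:R^-1 & mu.-negligible [set b | T (a ^+ 2 + b ^+ 2)].
  apply: contrapT => no.
  have : P (A @^-1` `]0, n.+1%:R^-1[%classic) = 0%E.
    have mI : measurable (A @^-1` `]0, n.+1%:R^-1[%classic).
      by rewrite -[X in measurable X]setTI; exact: mA.
    apply/(negligibleP P mI); apply: negligibleS ae0 => w /=.
    by rewrite in_itv /= => Aw neg; apply: no; exists (A w).
  rewrite law_A// => /normal_prob_null -/(_ (measurable_itv _)).
  move=> /(negligibleP mu (measurable_itv _)) h.
  have /eqP : n.+1%:R^-1 != 0 :> R by rewrite invr_eq0 pnatr_eq0.
  apply.
  have : mu `]0, n.+1%:R^-1[%classic = (n.+1%:R^-1)%:E.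
    etransitivity; first exact: lebesgue_measure_itv.
    by rewrite /= lte_fin invr_gt0 ltr0n /= oppr0 adde0.
  by rewrite h => -[<-].
apply: (@null_subset R (\bigcup_n (`]n.+1%:R^-1, n.+1%:R[%classic `&` T))).
  move=> s [Ts s0].
  have [n] := ltr_add_invr s0; rewrite add0r => ns.
  have si0 : 0 < s^-1 by rewrite invr_gt0.
  have [m ms] := ltr_add_invr si0.
  exists (maxn n m) => //; split => //=; rewrite in_itv /=; apply/andP; split.
    apply: le_lt_trans ns; rewrite lef_pV2 ?posrE ?ltr0n// ler_nat ltnS leq_maxl//.
  rewrite -[s]invrK -[ltRHS]invrK ltf_pV2 ?posrE ?invr_gt0 ?ltr0n//.
  apply: le_lt_trans ms; rewrite add0r lef_pV2 ?posrE ?ltr0n// ler_nat ltnS leq_maxr//.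
suff main (n : nat) : mu.-negligible (`]n.+1%:R^-1, n.+1%:R[%classic `&` T).
  by apply: negligible_bigcup_count => n; exact: main.
have [a /andP[a0 an] aT] := good n.
pose M : R := n.+1%:R; have M0 : 0 < M by rewrite ltr0n.
have a2 : a ^+ 2 < n.+1%:R^-1.
  have n1 : (n.+1%:R^-1 : R) <= 1 by rewrite invf_le1// ?ler1n.
  have a1 := le_trans (ltW an) n1.
  by apply: le_lt_trans an; rewrite expr2 ler_piMr ?(ltW a0).
have := @expanding_preimage_negligible R (fun s => Num.sqrt (s - a ^+ 2))
  (`]n.+1%:R^-1, M[%classic `&` T) (2 * Num.sqrt M)^-1 _ _ _ aT.
move=> H; apply: (null_subset _ (H _ _)).
- move=> s [si Ts]; split => //=; rewrite sqr_sqrtr ?subrKC//.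
  by move: si; rewrite /= in_itv /= => /andP[h _]; rewrite subr_ge0 ltW// (lt_trans a2).
- by rewrite invr_gt0 mulr_gt0// sqrtr_gt0.
move=> x y [xi _] [yi _]; move: xi yi; rewrite /= !in_itv /= => /andP[x1 x2] /andP[y1 y2].
set u : R := Num.sqrt (x - _); set v : R := Num.sqrt (y - _).
have uE : u ^+ 2 = x - a ^+ 2 by rewrite sqr_sqrtr// subr_ge0 ltW// (lt_trans a2).
have vE : v ^+ 2 = y - a ^+ 2 by rewrite sqr_sqrtr// subr_ge0 ltW// (lt_trans a2).
have -> : x - y = (u - v) * (u + v) by rewrite -subr_sqr uE vE; ring.
have u0 : 0 <= u by exact: sqrtr_ge0.
have v0 : 0 <= v by exact: sqrtr_ge0.
have uM : u <= Num.sqrt M by rewrite ler_wsqrtr//; have := sqr_ge0 a; lra.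
have vM : v <= Num.sqrt M by rewrite ler_wsqrtr//; have := sqr_ge0 a; lra.
rewrite normrM (ger0_norm (addr_ge0 u0 v0)) mulrC -mulrA ler_piMr//.
by rewrite ler_pdivrMr ?mul1r ?mulr_gt0 ?sqrtr_gt0//; lra.
Qed.

(** Almost every vertical section of a planar null set is null. *)
Lemma gaussian_pair_density (N : set (R * R)) : measurable N ->
  (mu \x mu)%E N = 0%E -> P [set w | N (A w, B w)] = 0%E.
Proof.
move=> mN N0.
pose E : set ((S * R) * R) := [set z | N (z.1.2, z.2)].
have mE : measurable E by have := @measurable_last_pair R _ S measurableT _ mN; rewrite setTI.
have mx : measurable_fun setT (fun a => mu (xsection N a)).
  exact: (measurable_fun_xsection mu).
have : (\int[mu]_a `|mu (xsection N a)| = 0)%E.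
  by under eq_integral do rewrite gee0_abs ?measure_ge0//.
move=> /(ae_eq_integral_abs mu measurableT mx).1 [M [mM M0 bad]].
apply/(gaussian_pair_null mE); exists (A @^-1` M); split.
- by rewrite -[X in measurable X]setTI; exact: mA.
- by rewrite law_A//; apply/normal_prob_null => //; exact/(negligibleP mu mM).
move=> w /= nw; apply: bad => /= h; apply: nw.
have xE : [set b | N (A w, b)] = xsection N (A w).
  by apply/seteqP; split=> v; rewrite /xsection /= inE.
rewrite /E /= xE; apply/(negligibleP mu); last exact: h.
exact: measurable_xsection.
Qed.

End two_gaussians.

Section cis.
Context {R : realType}.
Implicit Types (a b : R).

Definition cis b : R[i] := (cos b +i* sin b)%C.

Lemma cisD a b : cis (a + b) = cis a * cis b.
Proof. by apply/eqP; rewrite /cis cosD sinD eq_complex /= eqxx/= addrC. Qed.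

Lemma cis0 : cis 0 = 1. Proof. by rewrite /cis cos0 sin0. Qed.

Lemma cis_conj b : (cis b)^* = cis (- b).
Proof. by rewrite /cis cosN sinN. Qed.

Lemma cis_unit b : cis b * (cis b)^* = 1.
Proof. by rewrite cis_conj -cisD subrr cis0. Qed.

Lemma cisX b n : cis b ^+ n = cis (n%:R * b).
Proof.
elim: n => [|n IHn]; first by rewrite mul0r cis0.
by rewrite exprS IHn -cisD -natr1 mulrDl mul1r addrC.
Qed.

Lemma r2c_rot b z : r2c (plane_rot b z) = cis b * r2c z.
Proof. by apply/eqP; rewrite eq_complex /= eqxx /= addrC. Qed.

Lemma rot_c2r b z : plane_rot b (c2r z) = c2r (cis b * z).
Proof. by rewrite -{2}[z]c2rK -r2c_rot r2cK. Qed.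

(** A Wick power of type [(m, n)] has charge [m - n]. *)
Lemma wick_cis c m n b z :
  wick c m n (cis b * z) = cis ((m%:R - n%:R) * b) * wick c m n z.
Proof.
have := wick_rot c m n z (cis_unit b).
move/(congr1 (fun x => (cis b)^* ^+ n * x)).
rewrite !mulrA -exprMn [(cis b)^* * _]mulrC cis_unit expr1n mul1r => ->.
by rewrite cis_conj !cisX -cisD; congr (cis _ * _); ring.
Qed.

End cis.

Section wick_factor.
Context {R : realType}.

(** The product below as a function of its three independent ingredients. *)
Definition wick_factor c m n (z : (R * R) * R * R) : R[i] :=
  r2c z.1.1 * wick c m n (r2c (z.1.2, z.2)).

Lemma cmeasurable_wick_factor c m n : cmeasurable (wick_factor c m n).
Proof.
have m1 : cmeasurable (fun z : (R * R) * R * R => r2c z.1.1).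
  rewrite /cmeasurable; under eq_fun do rewrite r2cK.
  exact: (measurableT_comp measurable_fst).
apply: cmeasurableM => //; apply: cmeasurable_wick; apply/cmeasurableP; split => /=.
  exact: (measurableT_comp measurable_snd).
exact: measurable_snd.
Qed.

End wick_factor.

Section wick_product.
Context {R : realType} d (Om : measurableType d) (P : probability Om R).
Notation mu := (@lebesgue_measure R).
Notation gamma := (@normal_prob R 0 1).
Local Notation C := R[i].
Variables (W : Om -> C) (A B : Om -> R) (c m n : nat).
Hypotheses (mW : cmeasurable W) (mA : measurable_fun setT A)
  (mB : measurable_fun setT B).
Let U w := c2r (W w).
Hypothesis UA : forall D E, measurable D -> measurable E ->
  P (U @^-1` D `&` A @^-1` E) = (P (U @^-1` D) * gamma E)%E.
Hypothesis UAB : forall D E, measurable D -> measurable E ->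
  P ((fun w => (U w, A w)) @^-1` D `&` B @^-1` E) =
  (P ((fun w => (U w, A w)) @^-1` D) * gamma E)%E.
Hypothesis W0 : P [set w | W w = 0] = 0%E.

Let F w := W w * wick c m n (r2c (A w, B w)).

Let G := @wick_factor R c m n.

Let mG : cmeasurable G. Proof. exact: cmeasurable_wick_factor. Qed.

Let mAB : cmeasurable (fun w => r2c (A w, B w)).
Proof. exact/cmeasurableP. Qed.

Let mF : cmeasurable F.
Proof. by apply: cmeasurableM => //; exact: cmeasurable_wick. Qed.

(** Given [W] and [A], the squared modulus is a nonconstant polynomial in the
    independent Gaussian variable [B]. *)
Lemma wick_product_sqmod (T : set R) : (0 < m + n)%N -> measurable T ->
  mu.-negligible T -> P [set w | T (sqmod (F w))] = 0%E.
Proof.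
move=> mn mT T0.
pose E : set ((R * R) * R * R) := [set z | T (sqmod (G z))].
have mE : measurable E by have := measurable_sqmod mG measurableT mT; rewrite setTI.
have EE w : T (sqmod (F w)) = E (U w, A w, B w) by rewrite /E /= /G /wick_factor /= c2rK.
rewrite (_ : [set w | _] = [set w | E (U w, A w, B w)]); last first.
  by apply/funext => w; exact: EE.
apply: (gaussian_pair_null mW mA mB UAB mE).2.
have mW0 : measurable [set w | W w = 0].
  rewrite (_ : [set w | _] = setT `&` (fun w => sqmod (W w)) @^-1` [set 0]); last first.
    by rewrite setTI; apply/seteqP; split=> w /= /eqP; [rewrite -sqmod_eq0 => /eqP|rewrite sqmod_eq0 => /eqP].
  exact: (measurable_sqmod mW).
exists [set w | W w = 0]; split => // w /= neg; apply: contrapT => w0; apply: neg.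
have [r [sr rE]] := sqmod_wick_poly c m n (A w).
have s0 : sqmod (W w) != 0 by rewrite sqmod_eq0; exact/eqP.
rewrite (_ : [set b | _] = [set b | T (sqmod (W w) *: r).[b]]).
  apply: polynomial_preimage_negligible => //.
  by rewrite size_scale// sr ltnS muln_gt0.
apply/seteqP; split => b; rewrite /E /= hornerZ -rE /G /wick_factor /= c2rK sqmodM//.
Qed.

Lemma wick_product_neq0 : P [set w | F w = 0] = 0%E.
Proof.
have [/eqP|mn] := posnP (m + n)%N.
  rewrite addn_eq0 => /andP[/eqP m0 /eqP n0].
  by rewrite -[RHS]W0; congr (P _); apply/funext => w; rewrite /F m0 n0 /= mulr1.
rewrite (_ : [set w | _] = [set w | [set 0] (sqmod (F w))]).
  apply: wick_product_sqmod => //; apply/(negligibleP mu) => //.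
  exact: lebesgue_measure_set1.
by apply/seteqP; split=> w /= /eqP; [rewrite -sqmod_eq0 => /eqP|rewrite sqmod_eq0 => /eqP].
Qed.

Hypothesis law_rot : forall b E, measurable E ->
  P [set w | E (U w, (plane_rot b (A w, B w)).1, (plane_rot b (A w, B w)).2)] =
  P [set w | E (U w, A w, B w)].

(** The law of the product is invariant under rotations, since a Wick power of
    nonzero charge turns a rotation of its argument into one of its value; its
    modulus has a density, conditionally on [W] and on the real part [A]. *)
Lemma wick_product_density (N : set (R * R)) : m <> n -> measurable N ->
  (mu \x mu)%E N = 0%E -> P [set w | N (c2r (F w))] = 0%E.
Proof.
move=> mn mN N0.
have mn0 : (0 < m + n)%N by rewrite lt0n addn_eq0; apply/negP => /andP[/eqP m0 /eqP n0]; apply: mn; rewrite m0.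
have k0 : m%:R - n%:R != 0 :> R by rewrite subr_eq0 eqr_nat; exact/eqP.
have mrot b : measurable_fun setT (plane_rot b : R * R -> R * R).
  apply: measurable_fun_pair.
    by apply: measurable_funB; apply: measurable_funM.
  by apply: measurable_funD; apply: measurable_funM.
apply: (@rotation_invariant_null R _ _ P (fun w => (A w, B w))) => //.
- move=> b.
  pose E : set ((R * R) * R * R) := [set z | N (z.1.2, z.2)].
  have mE : measurable E.
    by have := @measurable_last_pair R _ (R * R)%type measurableT _ mN; rewrite setTI.
  have := law_rot b mE; rewrite {1}/E /= => ->.
  exact: (gaussian_pair_density mW mA mB UA UAB mN N0).
- exact: (gaussian_pair_sqnorm mW mA mB UA UAB).
- move=> b; pose be := b / (m%:R - n%:R).
  have kb : (m%:R - n%:R) * be = b by rewrite /be mulrCA divff// mulr1.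
  pose E : set ((R * R) * R * R) := [set z | N (c2r (G z))].
  have mE : measurable E by have := mG measurableT mN; rewrite setTI.
  have := law_rot be mE; rewrite /E /= /G /wick_factor /= => H.
  rewrite [RHS](_ : _ = P [set w | N (c2r (r2c (U w) * wick c m n (r2c (A w, B w))))]); last first.
    by congr (P _); apply/funext => w; rewrite /= /U c2rK.
  rewrite -H; congr (P _); apply/funext => w /=.
  rewrite -/(plane_rot be (A w, B w)) r2c_rot wick_cis kb.
  by rewrite rot_c2r /F /U c2rK mulrCA.
- by move=> T mT T0; exact: (wick_product_sqmod mn0 mT T0).
Qed.

End wick_product.

(** * Products of Wick powers of independent complex Gaussian variables *)

Lemma ae_eq_measure d (T : measurableType d) (R : realType)
    (mu : {measure set T -> \bar R}) (A B : set T) :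
  measurable A -> measurable B -> {ae mu, forall w, A w = B w} -> mu A = mu B.
Proof.
move=> mA mB AB; rewrite -[A]setIT -[B]setIT -!integral_indic//.
apply: ae_eq_integral => //; try by apply/measurable_EFinP; exact: measurable_indic.
apply: filterS AB => w /= AB _; rewrite !indicE (_ : (w \in A) = (w \in B))//.
by apply/idP/idP; rewrite !inE AB.
Qed.

Section complex_gaussian_family.
Context d (Om : measurableType d) (R : realType) (P : probability Om R).
Notation mu := (@lebesgue_measure R).
Notation gamma := (@normal_prob R 0 1).
Local Notation C := R[i].
Context (V : lmodType R) (G : V -> Om -> R) (b : V -> V -> R) (J : V -> V).
Hypothesis mG : forall h, measurable_fun setT (G h).
Hypothesis G_lin : forall (a : R) h v,
  {ae P, forall w, G (h + a *: v) w = G h w + a * G v w}.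
Hypothesis bDl : forall (a : R) h v u, b (h + a *: v) u = b h u + a * b v u.
Hypothesis bC : forall h v, b h v = b v h.
Hypothesis JD : forall (a : R) h v, J (h + a *: v) = J h + a *: J v.
Hypothesis JJ : forall h, J (J h) = - h.
Hypothesis bJ : forall h v, b (J h) (J v) = b h v.
Hypothesis G_fourier : forall h,
  \int[P]_w cos (G h w) = expR (- b h h / 2) /\ \int[P]_w sin (G h w) = 0.

Let b0 v : b 0 v = 0.
Proof. by have := bDl (-1) 0 0 v; rewrite scaler0 addr0 => E; lra. Qed.

Let bZ (a : R) h v : b (a *: h) v = a * b h v.
Proof. by have := bDl a 0 h v; rewrite add0r b0 add0r. Qed.

Let bDr (a : R) h v u : b u (h + a *: v) = b u h + a * b u v.
Proof. by rewrite bC bDl !(bC u). Qed.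

Let b_pyth (a : R) h v : b h v = 0 ->
  b (h + a *: v) (h + a *: v) = b h h + a ^+ 2 * b v v.
Proof. by move=> hv; rewrite bDl !bDr (bC v h) hv; ring. Qed.

Let bvJ v : b v (J v) = 0.
Proof.
have := bJ v (J v); rewrite JJ -scaleN1r bC bZ => E; lra.
Qed.

Let J0 : J 0 = 0.
Proof. by have := JD (-1) 0 0; rewrite scaler0 addr0 scaleN1r subrr. Qed.

Let JZ (a : R) v : J (a *: v) = a *: J v.
Proof. by have := JD a 0 v; rewrite !add0r J0 add0r. Qed.

Local Notation indep := (fourier_indep P G b).

Lemma fourier_indep_sub d' (S : measurableType d') (U : Om -> S) (M M' : set V) :
  M' `<=` M -> indep U M -> indep U M'.
Proof. by move=> MM UM D mD h /MM; exact: UM. Qed.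

(** The map [J] plays the role of the multiplication by [- i], through which the
    real part of a complex Gaussian family determines the imaginary part. *)
Definition gaussC v w : C := (G v w +i* G (J v) w)%C.

Lemma cmeasurable_gaussC v : cmeasurable (gaussC v).
Proof. by apply/cmeasurableP; split => /=; exact: mG. Qed.

Section one_variable.
Context (W : Om -> C) (M : set V) (v : V).
Let U w := c2r (W w).
Hypothesis mW : cmeasurable W.
Hypothesis UM : indep U M.
Hypothesis v1 : b v v = 1.
Hypothesis M0 : M 0.
Hypothesis Mv : forall (a : R) h, M h -> M (h + a *: v).
Hypothesis MJv : forall (a : R) h, M h -> M (h + a *: J v).

Let step1 : indep (fun w => (U w, G v w)) [set h | M h /\ b h v = 0].
Proof. by apply: fourier_indep_step. Qed.

Let mUG : measurable_fun setT (fun w => (U w, G v w)).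
Proof. by apply: measurable_fun_pair. Qed.

Let Jv1 : b (J v) (J v) = 1. Proof. by rewrite bJ. Qed.

Let MJv' (a : R) h : M h /\ b h v = 0 ->
  M (h + a *: J v) /\ b (h + a *: J v) v = 0.
Proof. by move=> [Mh hv]; split; [exact: MJv|rewrite bDl hv (bC (J v)) bvJ mulr0 addr0]. Qed.

Let M0' : M 0 /\ b 0 v = 0. Proof. by []. Qed.

Lemma gaussC_law1 D E : measurable D -> measurable E ->
  P (U @^-1` D `&` G v @^-1` E) = (P (U @^-1` D) * gamma E)%E.
Proof. by move=> mD mE; apply: (@fourier_indep_law _ _ _ P V G b _ _ _ _ _ _ U M). Qed.

Lemma gaussC_law2 D E : measurable D -> measurable E ->
  P ((fun w => (U w, G v w)) @^-1` D `&` G (J v) @^-1` E) =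
  (P ((fun w => (U w, G v w)) @^-1` D) * gamma E)%E.
Proof.
move=> mD mE; apply: (@fourier_indep_law _ _ _ P V G b _ _ _ _ _ _ _
  [set h | M h /\ b h v = 0]) => //.
Qed.

Lemma gaussC_indep : indep (fun w => (U w, G v w, G (J v) w))
  [set h | M h /\ b h v = 0 /\ b h (J v) = 0].
Proof.
apply: fourier_indep_sub (fourier_indep_step _ _ _ _ mUG step1 _ _ _) => //.
by move=> h [Mh [h1 h2]].
Qed.

Lemma gaussC_wick_indep c m n :
  indep (fun w => c2r (W w * wick c m n (gaussC v w)))
    [set h | M h /\ b h v = 0 /\ b h (J v) = 0].
Proof.
have mg := @cmeasurable_wick_factor R c m n.
have := fourier_indep_comp mg gaussC_indep.
congr (indep _ _); apply/funext => w.
by rewrite /wick_factor /= c2rK.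
Qed.

End one_variable.

Lemma gaussC_law_unique (W : Om -> C) (M : set V) v u :
  cmeasurable W -> indep (fun w => c2r (W w)) M ->
  b v v = 1 -> b u u = 1 -> M 0 ->
  (forall (a : R) h, M h -> M (h + a *: v)) ->
  (forall (a : R) h, M h -> M (h + a *: J v)) ->
  (forall (a : R) h, M h -> M (h + a *: u)) ->
  (forall (a : R) h, M h -> M (h + a *: J u)) ->
  forall E, measurable E ->
  P [set w | E (c2r (W w), G v w, G (J v) w)] =
  P [set w | E (c2r (W w), G u w, G (J u) w)].
Proof.
move=> mW UM v1 u1 M0 Mv MJv Mu MJu E mE.
have mUG x : measurable_fun setT (fun w => (c2r (W w), G x w)).
  by apply: measurable_fun_pair.
apply: (rectangle_law_unique (mUG v) (mUG u)) => // D F mD mF.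
rewrite (gaussC_law2 mW UM) // (gaussC_law2 mW UM) //; congr (_ * _)%E.
apply: (rectangle_law_unique mW mW (mG v) (mG u) _ mD) => D' F' mD' mF'.
by rewrite (gaussC_law1 mW UM) // (gaussC_law1 mW UM).
Qed.

(** A rotation of the variable of index [v] is a rotation of [v] in the plane
    spanned by [v] and [J v], all of whose unit vectors give the same law. *)
Lemma gaussC_law_rot (W : Om -> C) (M : set V) v :
  cmeasurable W -> indep (fun w => c2r (W w)) M -> b v v = 1 -> M 0 ->
  (forall (a : R) h, M h -> M (h + a *: v)) ->
  (forall (a : R) h, M h -> M (h + a *: J v)) ->
  forall be E, measurable E ->
  P [set w | E (c2r (W w), (plane_rot be (G v w, G (J v) w)).1,
                (plane_rot be (G v w, G (J v) w)).2)] =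
  P [set w | E (c2r (W w), G v w, G (J v) w)].
Proof.
move=> mW UM v1 M0 Mv MJv be E mE.
pose u := cos be *: v + (- sin be) *: J v.
have Ju : J u = sin be *: v + cos be *: J v.
  by rewrite /u JD JZ JJ scalerN scaleNr opprK addrC.
have u1 : b u u = 1.
  rewrite /u bDl !bDr !bZ !(bC v (_ *: _)) !(bC (J v) (_ *: _)) !bZ bJ v1.
  by rewrite bvJ; have := cos2Dsin2 be; nra.
have Mu (a : R) h : M h -> M (h + a *: u).
  by move=> Mh; rewrite /u scalerDr addrA !scalerA; apply/MJv/Mv.
have MJu (a : R) h : M h -> M (h + a *: J u).
  by move=> Mh; rewrite Ju scalerDr addrA !scalerA; apply/MJv/Mv.
rewrite (gaussC_law_unique mW UM v1 u1 M0 Mv MJv Mu MJu mE).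
have mUV x y : measurable_fun setT x -> measurable_fun setT y ->
    measurable [set w | E (c2r (W w), x w, y w)].
  move=> mx my; have m1 : measurable_fun setT (fun w => (c2r (W w), x w, y w)).
    by apply: measurable_fun_pair => //; apply: measurable_fun_pair.
  by have := m1 measurableT _ mE; rewrite setTI.
have GZ (a : R) h : {ae P, forall w, G (a *: h) w = a * G h w}.
  have h1 := G_lin a 0 h; have h2 := G_lin (-1) 0 0.
  rewrite add0r in h1; rewrite scaler0 addr0 in h2.
  by apply: filterS2 h1 h2 => w -> ->; ring.
have H1 := G_lin (- sin be) (cos be *: v) (J v).
have H2 := G_lin (cos be) (sin be *: v) (J v).
have H3 := GZ (cos be) v; have H4 := GZ (sin be) v.
apply: ae_eq_measure.
- apply: (mUV (fun w => (plane_rot be (G v w, G (J v) w)).1) (fun w => (plane_rot be (G v w, G (J v) w)).2)).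
    by rewrite /plane_rot /=; apply: measurable_funB; apply: measurable_funM.
  by rewrite /plane_rot /=; apply: measurable_funD; apply: measurable_funM.
- exact: mUV.
apply: filterS2 (filterI H1 H2) (filterI H3 H4) => w [h1 h2] [h3 h4] /=.
by rewrite Ju /u h1 h2 h3 h4 mulNr.
Qed.

Definition revealed_compl (e : nat -> V) (s : seq nat) : set V :=
  [set h | forall k, k \in s -> b h (e k) = 0 /\ b h (J (e k)) = 0].

Let revealed_complD (e : nat -> V) (s : seq nat) l :
  (forall k l, k != l -> b (e k) (e l) = 0 /\ b (e k) (J (e l)) = 0) ->
  l \notin s -> forall (a : R) h, revealed_compl e s h ->
  revealed_compl e s (h + a *: e l) /\ revealed_compl e s (h + a *: J (e l)).
Proof.
move=> e0 ls a h Mh; split=> k ks; have [h1 h2] := Mh _ ks.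
  have [|h3 h4] := e0 l k; first by apply: contraNneq ls => ->.
  by rewrite !bDl h1 h2 h3 h4 !mulr0 addr0.
have [|h3 _] := e0 l k; first by apply: contraNneq ls => ->.
have [|_ h4] := e0 k l; first by apply: contraNneq ls => <-.
by rewrite !bDl h1 h2 bJ h3 (bC (J _)) h4 !mulr0 addr0.
Qed.

(** The variables are revealed one at a time: the Wick powers of those already
    seen are independent of the Gaussian variables orthogonal to them. *)
Lemma gaussC_prod_indep (e : nat -> V) c (m n : nat -> nat) (s : seq nat) :
  (forall k, b (e k) (e k) = 1) ->
  (forall k l, k != l -> b (e k) (e l) = 0 /\ b (e k) (J (e l)) = 0) ->
  uniq s ->
  let W w := \prod_(k <- s) wick c (m k) (n k) (gaussC (e k) w) in
  [/\ cmeasurable W, indep (fun w => c2r (W w)) (revealed_compl e s) &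
      P [set w | W w = 0] = 0%E].
Proof.
move=> e1 e0 us W; rewrite {}/W; elim: s us => [_|l s IHs /= /andP[ls us]].
  have WE : (fun w => \prod_(k <- [::]) wick c (m k) (n k) (gaussC (e k) w)) = (fun=> 1 : C).
    by apply/funext => w; rewrite big_nil.
  rewrite (_ : (fun w => c2r _) = fun=> c2r 1); last by apply/funext => w; rewrite big_nil.
  rewrite WE; split.
  - exact: cmeasurable_cst.
  - move=> D mD h _.
    have [h1 h2] := G_fourier h.
    have mcos : measurable_fun setT (fun w => cos (G h w)).
      by apply: measurableT_comp => //; exact: measurable_cos.
    have msin : measurable_fun setT (fun w => sin (G h w)).
      by apply: measurableT_comp => //; exact: measurable_sin.
    rewrite !RintegralZl//; last 2 first.
    + by apply: (@bounded_integrable _ _ _ P _ 1) => // w; rewrite sin_max.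
    + by apply: (@bounded_integrable _ _ _ P _ 1) => // w; rewrite cos_max.
    rewrite h1 h2 mulr0; split=> //; congr (_ * _).
    have [Dc|Dc] := pselect (D (c2r 1)).
      rewrite (_ : _ @^-1` _ = setT) ?probability_setT /=; first by rewrite indicE mem_set.
      by apply/seteqP; split.
    rewrite (_ : _ @^-1` _ = set0) ?measure0 /=; first by rewrite indicE memNset.
    by apply/seteqP; split.
  - rewrite (_ : [set w | _] = set0) ?measure0//; apply/seteqP; split => // w /=.
    by rewrite big_nil => /eqP; rewrite oner_eq0.
have [mW UM W0] := IHs us.
set Ws := (fun w => \prod_(k <- s) _) in mW.
have WE w : \prod_(k <- l :: s) wick c (m k) (n k) (gaussC (e k) w) =
  Ws w * wick c (m l) (n l) (gaussC (e l) w) by rewrite big_cons mulrC.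
set M := revealed_compl e s in UM.
have M0 : M 0 by move=> k _; rewrite !b0.
have Mv (a : R) h : M h -> M (h + a *: e l) by case/(revealed_complD e0 ls a).
have MJv (a : R) h : M h -> M (h + a *: J (e l)) by case/(revealed_complD e0 ls a).
under eq_fun do rewrite WE.
rewrite [X in indep X](_ : _ = fun w => c2r (Ws w * wick c (m l) (n l) (gaussC (e l) w))); last first.
  by apply/funext => w; rewrite WE.
rewrite [X in P X](_ : _ = [set w | Ws w * wick c (m l) (n l) (gaussC (e l) w) = 0]); last first.
  by apply/funext => w /=; rewrite WE.
split.
- by apply: cmeasurableM => //; apply: cmeasurable_wick; exact: cmeasurable_gaussC.
- apply: fourier_indep_sub (gaussC_wick_indep mW UM (e1 l) M0 Mv MJv c (m l) (n l)).
  move=> h Mh; split; first by move=> k ks; apply: Mh; rewrite inE ks orbT.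
  by apply: Mh; rewrite inE eqxx.
- apply: (wick_product_neq0 c (m l) (n l) mW (mG (e l)) (mG (J (e l)))) => //.
  by move=> D E mD mE; exact: (gaussC_law2 mW UM).
Qed.

(** The factor of index [l] is singled out and the others are revealed first. *)
Lemma gaussC_prod_density (e : nat -> V) c (m n : nat -> nat) (s : seq nat) l :
  (forall k, b (e k) (e k) = 1) ->
  (forall k l, k != l -> b (e k) (e l) = 0 /\ b (e k) (J (e l)) = 0) ->
  uniq s -> l \in s -> m l <> n l ->
  let W w := \prod_(k <- s) wick c (m k) (n k) (gaussC (e k) w) in
  forall N, measurable N -> (mu \x mu)%E N = 0%E -> P [set w | N (c2r (W w))] = 0%E.
Proof.
move=> e1 e0 us ls mn W N mN N0.
have [mW UM W0] := gaussC_prod_indep c m n e1 e0 (rem_uniq l us).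
set Ws := (fun w => \prod_(k <- rem l s) _) in mW UM W0.
have WE w : W w = Ws w * wick c (m l) (n l) (gaussC (e l) w).
  by rewrite /W (perm_big _ (perm_to_rem ls)) big_cons mulrC.
rewrite [X in P X](_ : _ = [set w | N (c2r (Ws w * wick c (m l) (n l) (gaussC (e l) w)))]); last first.
  by apply/funext => w /=; rewrite WE.
set M := revealed_compl e (rem l s) in UM.
have lrem : l \notin rem l s by rewrite mem_rem_uniq// inE eqxx.
have M0 : M 0 by move=> k _; rewrite !b0.
have Mv (a : R) h : M h -> M (h + a *: e l) by case/(revealed_complD e0 lrem a).
have MJv (a : R) h : M h -> M (h + a *: J (e l)) by case/(revealed_complD e0 lrem a).
apply: (@wick_product_density R _ _ P Ws (G (e l)) (G (J (e l)))) => //.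
- by move=> D E mD mE; exact: (gaussC_law1 mW UM).
- by move=> D E mD mE; exact: (gaussC_law2 mW UM).
- by move=> be E mE; exact: (gaussC_law_rot mW UM).
Qed.

End complex_gaussian_family.

(** * Complex Hermite polynomials are Wick powers *)

Section entire_series.
Context {R : realType}.
Implicit Types (c : nat -> R).

Lemma series_shift (u : nat -> R) l :
  series u @ \oo --> l -> series (fun n => u n.+1) @ \oo --> l - u 0%N.
Proof.
move=> ul; have -> : series (fun n => u n.+1) = fun n => series u n.+1 - u 0%N.
  apply/funext => n; rewrite /series /= big_nat_recl//= addrC addKr//.
by apply: cvgB; [rewrite cvg_shiftS|exact: cvg_cst].
Qed.

Lemma pseries_at0 c l : pseries c 0 @ \oo --> l -> l = c 0%N.
Proof.
rewrite -cvg_shiftS => h.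
have h0 : (fun n => pseries c 0 n.+1) @ \oo --> c 0%N.
  apply: cvg_near_cst; apply: nearW => n.
  rewrite /pseries /series /= big_nat_recl//= mulr1 big1 ?addr0// => i _.
  by rewrite exprS mul0r mulr0.
exact: cvg_unique h h0.
Qed.

Lemma entire_diffs c : (forall x, cvgn (pseries c x)) ->
  forall x, cvgn (pseries (pseries_diffs c) x).
Proof.
move=> hc x; apply: normed_cvg; rewrite /normed_series_of /=.
pose K : R := 2 * (`|x| + 1).
have K0 : 0 < K by rewrite mulr_gt0// ltr_wpDl.
have cK : cvgn [series `|c i| * K ^+ i]_i.
  apply: (@is_cvg_pseries_inside_norm _ c (K + 1)); first exact: hc.
  by rewrite !gtr0_norm ?ltrDl// ltr_wpDl// ltW.
have cK1 : cvgn [series `|c i.+1| * K ^+ i.+1]_i.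
  by apply/cvg_ex; eexists; exact: (series_shift cK).
have cK2 : cvgn [series K^-1 * (`|c i.+1| * K ^+ i.+1)]_i.
  exact: (is_cvg_seriesZ (k := K^-1) cK1).
apply: series_le_cvg cK2 => n //=.
  by rewrite mulr_ge0 ?invr_ge0 ?mulr_ge0 ?exprn_ge0// ltW.
have -> : K^-1 * (`|c n.+1| * K ^+ n.+1) = `|c n.+1| * K ^+ n.
  by rewrite exprS; field; rewrite gt_eqF.
rewrite normrM normrX /pseries_diffs normrM ger0_norm// (mulrC n.+1%:R) -mulrA ler_wpM2l//.
rewrite /K exprMn ler_pM ?exprn_ge0//.
  by rewrite -natrX ler_nat ltn_expl.
by rewrite lerXn2r ?nnegrE ?addr_ge0// lerDl.
Qed.

Lemma entire_is_derive c x : (forall x, cvgn (pseries c x)) ->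
  is_derive x (1 : R) (fun x => limn (pseries c x)) (limn (pseries (pseries_diffs c) x)).
Proof.
move=> hc; apply: (@pseries_snd_diffs _ c (`|x| + 1)).
- exact: hc.
- exact: entire_diffs.
- exact/entire_diffs/entire_diffs.
- by rewrite [ltRHS]ger0_norm ?addr_ge0// ltrDl.
Qed.

(** Differentiate term by term, and evaluate at 0. *)
Lemma entire_series_eq0 c : (forall x, pseries c x @ \oo --> (0 : R)) ->
  forall n, c n = 0.
Proof.
move=> hc n; elim: n c hc => [|n IHn] c hc.
  exact/esym/pseries_at0.
have cc x : cvgn (pseries c x) by apply/cvg_ex; exists 0; exact: hc.
suff : pseries_diffs c n = 0.
  by rewrite /pseries_diffs => /eqP; rewrite mulf_eq0 pnatr_eq0 /= => /eqP.
apply: IHn => x; have [_ ] := entire_is_derive x cc.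
rewrite (_ : (fun x => limn _) = cst 0); last by apply/funext => y; exact: cvg_lim (hc y).
rewrite derive_cst => h; rewrite [X in _ --> X]h.
exact: entire_diffs.
Qed.

(** The sum solves [F' = (b - 4 x) F]; the recursion compares coefficients. *)
Lemma gaussian_series_rec c b :
  (forall x, pseries c x @ \oo --> expR (b * x - 2 * x ^+ 2)) ->
  [/\ c 0%N = 1, c 1%N = b & forall n, n.+2%:R * c n.+2 = b * c n.+1 - 4 * c n].
Proof.
move=> hc.
pose sh (n : nat) : R := if n is n'.+1 then c n' else 0.
have hsh x : pseries sh x @ \oo --> x * expR (b * x - 2 * x ^+ 2).
  rewrite -cvg_shiftS (_ : (fun n => pseries sh x n.+1) = fun n => x * pseries c x n).
    by apply: cvgM; [exact: cvg_cst|exact: hc].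
  apply/funext => n; rewrite /pseries /series /= big_nat_recl//= mul0r add0r mulr_sumr.
  by apply: eq_bigr => i _; rewrite exprS mulrCA.
have cc x : cvgn (pseries c x) by apply/cvg_ex; eexists; exact: hc.
have hd x : pseries (pseries_diffs c) x @ \oo --> (b - 4 * x) * expR (b * x - 2 * x ^+ 2).
  have [_ ] := entire_is_derive x cc.
  rewrite (_ : (fun x => limn _) = fun x => expR (b * x - 2 * x ^+ 2)); last first.
    by apply/funext => y; exact: cvg_lim (hc y).
  move=> h; have -> : (b - 4 * x) * expR (b * x - 2 * x ^+ 2) = limn (pseries (pseries_diffs c) x).
    rewrite -h derive_val.
    by rewrite /GRing.scale /=; ring.
  exact: entire_diffs.
pose a n := pseries_diffs c n - b * c n + 4 * sh n.
have a0 : forall n, a n = 0.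
  apply: entire_series_eq0 => x.
  have -> : (0 : R) = (b - 4 * x) * expR (b * x - 2 * x ^+ 2) -
      b * expR (b * x - 2 * x ^+ 2) + 4 * (x * expR (b * x - 2 * x ^+ 2)) by ring.
  rewrite (_ : pseries a x = fun n => pseries (pseries_diffs c) x n - b * pseries c x n + 4 * pseries sh x n).
    apply: cvgD; first apply: cvgB.
    - exact: hd.
    - by apply: cvgM; [exact: cvg_cst|exact: hc].
    - by apply: cvgM; [exact: cvg_cst|exact: hsh].
  apply/funext => n; rewrite /pseries /series /= !mulr_sumr -sumrB -big_split /=.
  by apply: eq_bigr => i _; rewrite /a; ring.
have c0 : c 0%N = 1.
  by have := pseries_at0 (hc 0); rewrite mulr0 expr0n /= mulr0 subrr expR0.
split=> [//||n].
  by have := a0 0%N; rewrite /a /pseries_diffs /= c0 => E; lra.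
by have := a0 n.+1; rewrite /a /pseries_diffs /= => E; lra.
Qed.
End entire_series.

Section hermite.
Context {R : realType}.
Local Notation C := R[i].

(** Grouping the terms of the double series by their degree makes it a power
    series on each ray. *)
Definition degree_lt (N : nat) : seq (nat * nat) :=
  [seq (n - q, q)%N | n <- iota 0 N, q <- iota 0 n.+1].

Lemma mem_degree_lt N p q : ((p, q) \in degree_lt N) = (p + q < N)%N.
Proof.
apply/allpairsPdep/idP => [[n [k [+ + [-> ->]]]]|pq].
  by rewrite !mem_iota /= !add0n => nN kn; rewrite subnK.
exists (p + q)%N, q; rewrite !mem_iota /= !add0n ltnS leq_addl addnK; split=> //.
Qed.

Lemma uniq_degree_lt N : uniq (degree_lt N).
Proof.
apply: allpairs_uniq_dep; first exact: iota_uniq.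
  by move=> n _; exact: iota_uniq.
move=> [n q] [n' q'] /allpairsPdep[n1 [q1 [_ + [-> ->]]]] /allpairsPdep[n2 [q2 [_ + [-> ->]]]] /=.
rewrite !mem_iota /= !add0n !ltnS => h1 h2 [h3 h4].
by subst q2; rewrite -(subnK h1) h3 subnK.
Qed.

Lemma sum_degree_lt N (x : nat * nat -> C) :
  summability.partial_sum x (seq_fset tt (degree_lt N)) =
  \sum_(0 <= n < N) \sum_(q < n.+1) x ((n - q)%N, q : nat).
Proof.
rewrite /summability.partial_sum -(big_seq_fsetE _ _ xpredT x).
rewrite (perm_big (degree_lt N)); last first.
  apply: uniq_perm; [exact: fset_uniq|exact: uniq_degree_lt|].
  by move=> i; rewrite seq_fsetE.
rewrite /degree_lt big_allpairs_dep /= /index_iota subn0.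
by apply: eq_bigr => n _; rewrite -(big_mkord xpredT (fun q => x (n - q, q)%N)) /index_iota subn0.
Qed.

Lemma totally_degree_lt :
  (fun N => seq_fset tt (degree_lt N)) @ \oo --> summability.totally.
Proof.
move=> U [A _ AU].
exists (\sum_(i <- A) (i.1 + i.2).+1)%N => // N AN; apply: AU.
rewrite /mkset; apply/fsubsetP => -[p q] pqA; rewrite seq_fsetE mem_degree_lt.
apply: leq_trans AN; rewrite (big_rem _ pqA) /=; exact: leq_addr.
Qed.

Lemma cvg_ReIm (f : nat -> C) (l : C) : (f @ \oo --> (l : R[i]^o)) ->
  ((fun n => complex.Re (f n)) @ \oo --> complex.Re l) /\
  ((fun n => complex.Im (f n)) @ \oo --> complex.Im l).
Proof.
move=> /(@cvgrPdist_lt _ R[i]^o) fl; split; apply/cvgrPdist_lt => e e0.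
  have := fl e%:C%C; rewrite ltcR => /(_ e0); apply: filterS => n.
  by rewrite -ltcR; apply: le_lt_trans; have := normc_ge_Re (l - f n); rewrite raddfB.
have := fl e%:C%C; rewrite ltcR => /(_ e0); apply: filterS => n.
rewrite -ltcR; apply: le_lt_trans.
have := normc_ge_Re (((0 : R) +i* (-1))%C * (l - f n)).
have n1 : `|((0 : R) +i* (-1))%C| = 1 :> C.
  by rewrite normc_def /= expr0n add0r sqrrN expr1n sqrtr1.
rewrite normrM n1 mul1r; case: (l) (f n) => [a a'] [c c'] /=.
by rewrite mul0r mulN1r opprK add0r.
Qed.

Section wick_coef.
Variable z : C.

Definition wick_coef p q : C := wick 2 p q z / (p`! * q`!)%:R.

Let fact_neq0 n : (n`!)%:R != 0 :> C.
Proof. by rewrite pnatr_eq0 -lt0n fact_gt0. Qed.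

(** The coefficient of [r^n] in the generating function of the Wick powers along
    the ray [r zeta]. *)
Definition wick_hom (zeta : C) n : C :=
  \sum_(q < n.+1) zeta^* ^+ (n - q) * zeta ^+ q * wick_coef (n - q) q.

Let coef_recl p q : p.+1%:R * wick_coef p.+1 q =
  z * wick_coef p q - 2 * (if q is q'.+1 then wick_coef p q' else 0).
Proof.
have p0 : p.+1%:R != 0 :> C by rewrite pnatr_eq0.
rewrite /wick_coef /= factS; case: q => [|q] /=.
  rewrite muln0 mul0r fact0 !natrM.
  move: (p.+1%:R : C) p0 (p`!%:R : C) (fact_neq0 p) => a a0 a' a0'.
  by field; rewrite a0 a0'.
have q0 : q.+1%:R != 0 :> C by rewrite pnatr_eq0.
rewrite factS !natrM.
move: (p.+1%:R : C) p0 (p`!%:R : C) (fact_neq0 p) => a a0 a' a0'.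
move: (q.+1%:R : C) q0 (q`!%:R : C) (fact_neq0 q) => c c0 c' c0'.
by field; rewrite a0 a0' c0 c0'.
Qed.

Let coef_recr p q : q.+1%:R * wick_coef p q.+1 =
  z^* * wick_coef p q - 2 * (if p is p'.+1 then wick_coef p' q else 0).
Proof.
have q0 : q.+1%:R != 0 :> C by rewrite pnatr_eq0.
rewrite /wick_coef wickSr /= factS; case: p => [|p].
  rewrite muln0 mul0r fact0 !natrM.
  move: (q.+1%:R : C) q0 (q`!%:R : C) (fact_neq0 q) => c c0 c' c0'.
  by field; rewrite c0 c0'.
have p0 : p.+1%:R != 0 :> C by rewrite pnatr_eq0.
rewrite factS !natrM [p.+1.-1]/=.
move: (p.+1%:R : C) p0 (p`!%:R : C) (fact_neq0 p) => a a0 a' a0'.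
move: (q.+1%:R : C) q0 (q`!%:R : C) (fact_neq0 q) => c c0 c' c0'.
by field; rewrite a0 a0' c0 c0'.
Qed.

(** The recursions of the Wick powers in [m] and in [n], weighted by [m] and
    [n], add up to one on homogeneous parts. *)
Lemma wick_hom_rec zeta : let b := zeta * z^* + zeta^* * z in
  [/\ wick_hom zeta 0 = 1, wick_hom zeta 1 = b &
    forall n, n.+2%:R * wick_hom zeta n.+2 =
      b * wick_hom zeta n.+1 - 4 * (zeta * zeta^*) * wick_hom zeta n].
Proof.
move=> b; split.
- by rewrite /wick_hom big_ord1 /wick_coef /= !expr0 !mul1r invr1.
- rewrite /wick_hom !big_ord_recl big_ord0 /wick_coef /= /bump /=.
  by rewrite !expr0 !expr1 !muln1 !muln0 !mul0r !invr1 /b; ring.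
move=> n; pose t m q : C := zeta^* ^+ (m - q) * zeta ^+ q.
have tS q : (q <= n)%N -> t n.+2 q.+1 = zeta * zeta^* * t n q.
  by move=> qn; rewrite /t subSS subSn// !exprS; ring.
have l1 : \sum_(q < n.+3) t n.+2 q * ((n.+2 - q)%:R * wick_coef (n.+2 - q) q) =
    zeta^* * z * wick_hom zeta n.+1 - 2 * (zeta * zeta^*) * wick_hom zeta n.
  rewrite big_ord_recr /= subnn mul0r mulr0 addr0.
  transitivity (\sum_(q < n.+2) zeta^* * z * (t n.+1 q * wick_coef (n.+1 - q) q) -
     \sum_(q < n.+2) 2 * (if q : nat is q'.+1 then t n.+2 q * wick_coef (n - q') q' else 0)).
    rewrite -sumrB; apply: eq_bigr => -[q qn] _ /=; rewrite ltnS in qn.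
    rewrite subSn// coef_recl {1}/t subSn// exprS.
    by case: q qn => [|q] qn /=; rewrite ?subSS /t ?subSS ?subSn// ?exprS; ring.
  congr (_ - _); first by rewrite -mulr_sumr.
  rewrite big_ord_recl /= mulr0 add0r /wick_hom mulr_sumr; apply: eq_bigr => -[q qn] _ /=.
  by rewrite /bump leq0n add1n add0n tS// /t; ring.
have l2 : \sum_(q < n.+3) t n.+2 q * (q%:R * wick_coef (n.+2 - q) q) =
    zeta * z^* * wick_hom zeta n.+1 - 2 * (zeta * zeta^*) * wick_hom zeta n.
  rewrite big_ord_recl /= mul0r mulr0 add0r.
  transitivity (\sum_(q < n.+2) zeta * z^* * (t n.+1 q * wick_coef (n.+1 - q) q) -
     \sum_(q < n.+2) 2 * (if (n.+1 - q)%N is p.+1 then t n.+2 q.+1 * wick_coef p q else 0)).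
    rewrite -sumrB; apply: eq_bigr => -[q qn] _ /=; rewrite ltnS in qn.
    rewrite /bump /= add1n subSS coef_recr.
    have -> : t n.+2 q.+1 = zeta * t n.+1 q by rewrite /t subSS exprS; ring.
    by case: (n.+1 - q)%N => [|p]; ring.
  congr (_ - _); first by rewrite -mulr_sumr.
  rewrite big_ord_recr /= subnn mulr0 addr0 /wick_hom mulr_sumr; apply: eq_bigr => -[q qn] _ /=.
  by rewrite subSn// tS// /t; ring.
rewrite /wick_hom -/(wick_hom zeta _) mulr_sumr.
transitivity (\sum_(q < n.+3) t n.+2 q * ((n.+2 - q)%:R * wick_coef (n.+2 - q) q) +
    \sum_(q < n.+3) t n.+2 q * (q%:R * wick_coef (n.+2 - q) q)).
  rewrite -big_split; apply: eq_bigr => -[q qn] _ /=; rewrite ltnS in qn.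
  by rewrite -mulrDr -mulrDl -natrD subnK// mulrCA.
by rewrite l1 l2 /b /wick_hom; ring.
Qed.

End wick_coef.

(** Along a ray [lambda = r zeta] the generating function is a real exponential
    series in [r]; its coefficients obey the recursion of the Wick powers, and
    those of degree [n] are recovered from their values on the unit circle. *)
Lemma hermite_wick (J : nat -> nat -> C -> C) p q z : is_complex_hermite J ->
  J p q z = wick 2 p q z.
Proof.
move=> hJ.
pose J_coef p q : C := J p q z / (p`! * q`!)%:R.
pose J_hom (zeta : C) n : C := \sum_(q < n.+1) zeta^* ^+ (n - q) * zeta ^+ q * J_coef (n - q)%N q.
have hom_eq zeta n : zeta * zeta^* = 1 -> J_hom zeta n = wick_hom z zeta n.
  move=> z1; pose b : R := complex.Re (zeta * z^* + zeta^* * z).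
  have bE : zeta * z^* + zeta^* * z = b%:C%C.
    by rewrite /b; case: (zeta) (z) => [x y] [x' y'] /=; apply/eqP; rewrite eq_complex /= eqxx /=; apply/eqP; ring.
  have conv r : (fun N => \sum_(0 <= n < N) r%:C%C ^+ n * J_hom zeta n) @ \oo -->
      ((expR (b * r - 2 * r ^+ 2))%:C%C : R[i]^o).
    have rC : (r%:C%C)^* = r%:C%C :> C by apply/eqP; rewrite eq_complex /= oppr0 !eqxx.
    have := @cvg_comp _ _ _ _ _ _ _ _ totally_degree_lt (hJ (r%:C%C * zeta) z).
    have -> : cexp (r%:C%C * zeta * z^* + (r%:C%C * zeta)^* * z - 2 * `|r%:C%C * zeta| ^+ 2) =
        (expR (b * r - 2 * r ^+ 2))%:C%C.
      rewrite (_ : _ - _ = (b * r - 2 * r ^+ 2)%:C%C); first by rewrite /cexp /= cos0 sin0 mulr1.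
      rewrite normCK rmorphM /= rC.
      have -> : r%:C%C * zeta * z^* + r%:C%C * zeta^* * z = b%:C%C * r%:C%C by rewrite -bE; ring.
      have -> : r%:C%C * zeta * (r%:C%C * zeta^*) = r%:C%C ^+ 2 * (zeta * zeta^*) by ring.
      by rewrite z1 mulr1 !expr2 rmorphB !rmorphM /= rmorph_nat.
    rewrite (_ : _ \o _ = fun N => \sum_(0 <= n < N) r%:C%C ^+ n * J_hom zeta n)//.
    apply/funext => N /=; rewrite sum_degree_lt; apply: eq_bigr => m _.
    rewrite /J_hom mulr_sumr; apply: eq_bigr => -[k km] _ /=; rewrite ltnS in km.
    rewrite /J_coef rmorphM /= rC !exprMn.
    have -> : r%:C%C ^+ m = r%:C%C ^+ (m - k) * r%:C%C ^+ k :> C by rewrite -exprD subnK.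
    ring.
  have ReM (x : R) (w : C) : complex.Re (x%:C%C * w) = x * complex.Re w.
    by case: w => ? ? /=; rewrite mul0r subr0.
  have ImM (x : R) (w : C) : complex.Im (x%:C%C * w) = x * complex.Im w.
    by case: w => ? ? /=; rewrite mul0r addr0.
  pose a m := complex.Re (J_hom zeta m); pose a' m := complex.Im (J_hom zeta m).
  have [ha0 ha1 ha] : [/\ a 0%N = 1, a 1%N = b & forall n, n.+2%:R * a n.+2 = b * a n.+1 - 4 * a n].
    apply: gaussian_series_rec => r; have [h _] := cvg_ReIm (conv r).
    rewrite (_ : pseries a r = fun N => complex.Re (\sum_(0 <= n < N) r%:C%C ^+ n * J_hom zeta n))//.
    apply/funext => N; rewrite /pseries /series /= raddf_sum; apply: eq_bigr => m _.
    by rewrite /= -rmorphXn ReM mulrC.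
  have ha' : forall n, a' n = 0.
    apply: entire_series_eq0 => r; have [_ h] := cvg_ReIm (conv r).
    rewrite (_ : pseries a' r = fun N => complex.Im (\sum_(0 <= n < N) r%:C%C ^+ n * J_hom zeta n))//.
    apply/funext => N; rewrite /pseries /series /= raddf_sum; apply: eq_bigr => m _.
    by rewrite /= -rmorphXn ImM mulrC.
  have JE m : J_hom zeta m = (a m)%:C%C.
    by apply/eqP; rewrite eq_complex /= eqxx /=; exact/eqP/ha'.
  have [w0 w1 w2] := wick_hom_rec z zeta.
  suff : J_hom zeta n = wick_hom z zeta n /\ J_hom zeta n.+1 = wick_hom z zeta n.+1 by case.
  elim: n => [|n [IH1 IH2]]; first by rewrite !JE ha0 ha1 w0 w1 bE.
  split=> //; have n2 : n.+2%:R != 0 :> C by rewrite pnatr_eq0.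
  apply: (mulfI n2); rewrite w2 -IH1 -IH2 !JE z1 mulr1 bE.
  have -> : n.+2%:R = n.+2%:R%:C%C :> C by rewrite rmorph_nat.
  by rewrite -rmorphM ha rmorphB !rmorphM /= rmorph_nat.
pose n := (p + q)%N.
pose D k := J_coef (n - k)%N k - wick_coef z (n - k) k.
pose Q : {poly C} := \poly_(k < n.+1) D k.
have rootQ zeta : zeta * zeta^* = 1 -> root Q (zeta ^+ 2).
  move=> z1; rewrite /root horner_poly; apply/eqP.
  have := hom_eq zeta n z1; move/eqP; rewrite -subr_eq0 /J_hom /wick_hom -sumrB => /eqP h.
  transitivity (zeta ^+ n * 0); last by rewrite mulr0.
  rewrite -[X in _ = _ * X]h mulr_sumr; apply: eq_bigr => -[k kn] _ /=; rewrite ltnS in kn.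
  have -> : zeta ^+ n = zeta ^+ (n - k) * zeta ^+ k by rewrite -exprD subnK.
  have : (zeta * zeta^*) ^+ (n - k) = 1 by rewrite z1 expr1n.
  rewrite exprMn -exprM mulnC exprM expr2; move=> e.
  transitivity ((J_coef (n - k)%N k - wick_coef z (n - k) k) * (zeta ^+ k * zeta ^+ k) *
     (zeta ^+ (n - k) * zeta^* ^+ (n - k))); first by rewrite e mulr1.
  by ring.
have Q0 : Q = 0.
  apply/eqP; apply: contraT => Qn0.
  pose th (k : nat) : R := k.+1%:R^-1.
  pose s := mkseq (fun k => cis (th k)) (size Q).
  have := max_poly_roots (rs := s) Qn0.
  rewrite size_mkseq ltnn => ->//.
    apply/allP => x /mapP[k _ ->].
    have -> : cis (th k) = cis (th k / 2) ^+ 2.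
      by rewrite cisX; congr cis; field.
    apply: rootQ; exact: cis_unit.
  rewrite mkseq_uniq// => k k' [ck _].
  have thi m : th m \in `[0, pi].
    rewrite in_itv /= invr_ge0 ler0n /=; apply: le_trans (_ : 1 <= _).
      by rewrite invf_le1 ?ltr0n// ler1n.
    by apply: le_trans (pi_ge2 R); rewrite ler1n.
  have /invr_inj/eqP := cos_inj (thi k) (thi k') ck.
  by rewrite eqr_nat => /eqP[].
have kq : (q < n.+1)%N by rewrite ltnS leq_addl.
have := congr1 (fun P : {poly C} => P`_q) Q0.
rewrite /= coef_poly kq coef0 /D addnK => /eqP; rewrite subr_eq0 => /eqP.
move/(congr1 (fun x => x * (p`! * q`!)%:R)).
rewrite /J_coef /wick_coef !divfK //; by rewrite pnatr_eq0 -lt0n muln_gt0 !fact_gt0.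
Qed.

End hermite.

(** * Gaussian variables *)

Section gaussian_variables.
Context d (Om : measurableType d) (R : realType) (P : probability Om R).
Notation mu := (@lebesgue_measure R).

Lemma gaussian_law_moments (U : {RV P >-> R}) : has_centered_gaussian_law P U ->
  exists s : R, [/\ (\int[P]_w (U w ^+ 2)%:E = (s ^+ 2)%:E)%E,
    forall t, \int[P]_w cos (t * U w) = expR (- (s ^+ 2 * t ^+ 2) / 2) &
    forall t, \int[P]_w sin (t * U w) = 0].
Proof.
move=> [s hs]; exists s.
have mU : measurable_fun setT (U : Om -> R) by exact: measurable_funPT.
have mcos := @measurable_cosZ R; have msin := @measurable_sinZ R.
have cosb t (x : R) : `|cos (t * x)| <= 1 by rewrite cos_max.
have sinb t (x : R) : `|sin (t * x)| <= 1 by rewrite sin_max.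
have [s0|s0] := eqVneq s 0.
  have U0 : {ae P, forall w, U w = 0}.
    exists (U @^-1` [set~ 0]); split.
    - by rewrite -[X in measurable X]setTI; apply: mU => //; exact: measurableC.
    - have := hs [set~ 0] (measurableC (measurable_set1 _)); rewrite s0 eqxx /pushforward => ->.
      by rewrite diracE memNset//= => /(_ erefl).
    - by move=> w.
  have Pf (f : R -> R) : measurable_fun setT f -> \int[P]_w f (U w) = f 0.
    move=> mf; rewrite (_ : \int[P]_w f (U w) = \int[P]_w (f 0)).
      transitivity (fine ((f 0)%:E * P setT)%E); last by rewrite (probability_setT P) mule1.
      by rewrite -integral_cst.
    apply: ae_eq_Rintegral => //; first exact: measurableT_comp.
    by apply: filterS U0 => w ->.
  split.
  - rewrite s0 expr0n /=; transitivity (\int[P]_(w in setT) (0 : \bar R))%E; last exact: integral0.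
    apply: ae_eq_integral => //.
      by apply/measurable_EFinP; exact: measurable_funX.
    by apply: filterS U0 => w /= -> _; rewrite expr0n.
  - by move=> t; rewrite (Pf (fun x => cos (t * x)))// mulr0 cos0 s0 expr0n /= mul0r oppr0 mul0r expR0.
  - by move=> t; rewrite (Pf (fun x => sin (t * x)))// mulr0 sin0.
have dE : forall D, measurable D -> distribution P U D = normal_prob 0 s D.
  by move=> D mD; have := hs D mD; rewrite (negPf s0).
have Pf (f : R -> R) : measurable_fun setT f -> (forall x, `|f x| <= 1) ->
    \int[P]_w f (U w) = \int[mu]_x (f x * normal_pdf 0 s x).
  move=> mf f1.
  have mU' : measurable_fun setT (U : Om -> measurableTypeR R) := mU.
  have [m [mD mI]] := law_measure P mU'.
  rewrite (mI f 1)//.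
  apply: (@Rintegral_density _ _ _ m mu (normal_pdf 0 s) f 1) => //.
  - by move=> x; exact: normal_pdf_ge0.
  - exact: measurable_normal_pdf.
  - exact: integrable_normal_pdf.
  - by move=> D mD'; rewrite -/(normal_prob 0 s D) -dE// mD.
split; last 2 first.
- by move=> t; rewrite (Pf (fun x => cos (t * x)))// gaussian_cos.
- by move=> t; rewrite (Pf (fun x => sin (t * x)))// gaussian_sin.
have m2 : measurable_fun setT (fun x : R => (x ^+ 2)%:E).
  by apply/measurable_EFinP; exact: measurable_funX.
have mU' : measurable_fun setT (U : Om -> measurableTypeR R) := mU.
have [m [mD _]] := law_measure P mU'.
transitivity (\int[m]_x (x ^+ 2)%:E)%E.
  pose nu : {measure set (measurableTypeR R) -> \bar R} :=
    measure_function_pushforward__canonical__measure_function_Measure P mU'.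
  transitivity (\int[nu]_x (x ^+ 2)%:E)%E; last first.
    by apply: eq_measure_integral => D mD' _; exact/esym/mD.
  by rewrite /nu ge0_integral_pushforward// => x; rewrite lee_fin sqr_ge0.
rewrite (@ge0_integral_density _ _ _ m mu (normal_pdf 0 s)).
- transitivity (\int[mu]_x ((x - 0) ^+ 2 * normal_pdf 0 s x)%:E)%E.
    by apply: eq_integral => x _; rewrite subr0 EFinM.
  rewrite -[LHS]fineK; first by congr EFin; exact: gaussian_moment2.
  apply: integrable_fin_num => //.
  apply: (@affine_phi_integrable _ 0 s s0 (fun u => (u - 0) ^+ 2) 1).
    by apply: measurable_funX; exact: measurable_funD.
  by move=> u; rewrite mul1r ger0_norm ?sqr_ge0// lerDr.
- by move=> x; exact: normal_pdf_ge0.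
- exact: measurable_normal_pdf.
- by move=> D mD'; rewrite mD//; exact: dE.
- exact: m2.
- by move=> x; rewrite lee_fin sqr_ge0.
Qed.

Lemma indep_expectation (U V : Om -> R) (f g : R -> R) (a c : R) :
  measurable_fun setT U -> measurable_fun setT V ->
  (forall A B, measurable A -> measurable B ->
    P (U @^-1` A `&` V @^-1` B) = (P (U @^-1` A) * P (V @^-1` B))%E) ->
  measurable_fun setT f -> measurable_fun setT g ->
  (forall x, `|f x| <= a) -> (forall x, `|g x| <= c) ->
  \int[P]_w (f (U w) * g (V w)) = (\int[P]_w f (U w)) * \int[P]_w g (V w).
Proof.
move=> mU mV UV mf mg fa gc.
have mUV : measurable_fun setT (fun w => (U w, V w)) by apply: measurable_fun_pair.
have [mx [mxD mxI]] := law_measure P mU; have [my [myD myI]] := law_measure P mV.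
have [n [nD nI]] := law_measure P mUV.
pose phi (z : R * R) := f z.1 * g z.2.
have mphi : measurable_fun setT phi.
  by apply: measurable_funM; apply: measurableT_comp.
have phib z : `|phi z| <= a * c by rewrite /phi normrM ler_pM.
rewrite (nI phi (a * c))// (mxI f a)// (myI g c)//.
have nE D : measurable D -> (mx \x my)%E D = n D.
  apply: product_measure_unique => A B mA mB.
  transitivity (P ((fun w => (U w, V w)) @^-1` (A `*` B))); first exact: (nD _ (measurableX mA mB)).
  transitivity (P (U @^-1` A) * P (V @^-1` B))%E; first exact: UV.
  by congr (_ * _)%E; [exact/esym/mxD|exact/esym/myD].
have iphi : (mx \x my)%E.-integrable setT (EFin \o phi).
  have /integrableP[h1 h2] := @bounded_integrable _ _ _ n phi (a * c) mphi phib.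
  apply/integrableP; split=> //; rewrite (eq_measure_integral n)// => D mD _; exact: nE.
transitivity (\int[(mx \x my)%E]_z phi z).
  congr fine; apply: eq_measure_integral => D mD _; exact/esym/nE.
rewrite {1}/Rintegral -(integral12_prod_meas1 iphi).
transitivity (fine (\int[mx]_x (f x * \int[my]_y g y)%:E)).
  congr fine; apply: eq_integral => x _; rewrite /phi /fubini_F /=.
  under eq_integral do rewrite EFinM.
  have ig : my.-integrable setT (EFin \o g) by exact: (@bounded_integrable _ _ _ my g c).
  rewrite integralZl// EFinM; congr (_ * _)%E.
  by rewrite /Rintegral fineK// integrable_fin_num.
rewrite -/(Rintegral _ _ _) RintegralZr//; exact: (@bounded_integrable _ _ _ mx f a).
Qed.

End gaussian_variables.

Section isonormal_processes.
Context {R : realType} (H : completeNormedModType R) (ip : {dot H for @idfun R}).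
Context d (Om : measurableType d) (P : probability Om R).

Lemma dotDl (a : R) h g v : ip (h + a *: g) v = ip h v + a * ip g v.
Proof. by rewrite linearDl linearZl_LR. Qed.

Lemma dotC h g : ip h g = ip g h.
Proof. by rewrite hermC expr0 mul1r. Qed.

Section one_process.
Variable X : H -> {RV P >-> R}.
Hypothesis X_iso : isonormal ip X.

Lemma isonormal_moments h :
  [/\ (\int[P]_w (X h w ^+ 2)%:E = (ip h h)%:E)%E,
    forall t, \int[P]_w cos (t * X h w) = expR (- (ip h h * t ^+ 2) / 2) &
    forall t, \int[P]_w sin (t * X h w) = 0].
Proof.
have [hX hE] := X_iso.
have hg : has_centered_gaussian_law P (X h).
  have := hX 1%N (fun=> 1) (fun=> h); congr (has_centered_gaussian_law _ _).
  by apply/funext => w; rewrite big_ord1 mul1r.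
have [s [s2 hc hs]] := gaussian_law_moments hg.
have := hE h h; rewrite unlock /=.
rewrite (_ : (\int[P]_w _ = \int[P]_w (X h w ^+ 2)%:E)%E); last first.
  by apply: eq_integral => w _; rewrite expr2.
by rewrite s2 => -[<-].
Qed.

Let mX h : measurable_fun setT (X h : Om -> R). Proof. exact: measurable_funPT. Qed.

Lemma isonormal_integrable h g :
  P.-integrable setT (fun w => (X h w * X g w)%:E).
Proof.
have sq k : P.-integrable setT (fun w => (X k w ^+ 2)%:E).
  apply/integrableP; split; first by apply/measurable_EFinP; exact: measurable_funX.
  under eq_integral do rewrite gee0_abs ?lee_fin ?sqr_ge0//.
  by have [-> _ _] := isonormal_moments k; rewrite ltry.
apply: (le_integrable measurableT _ _ (integrableD measurableT (sq h) (sq g))).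
  by apply/measurable_EFinP; exact: measurable_funM.
move=> w _; rewrite -EFinD !abse_EFin lee_fin.
rewrite [leRHS]ger0_norm ?addr_ge0 ?sqr_ge0// ler_norml.
have := sqr_ge0 (X h w + X g w); have := sqr_ge0 (X h w - X g w).
have := sqr_ge0 (X h w); have := sqr_ge0 (X g w); rewrite !expr2 => *.
by apply/andP; split; nra.
Qed.

Lemma isonormal_cov h g : \int[P]_w (X h w * X g w) = ip h g.
Proof. by have [_ /(_ h g)] := X_iso; rewrite unlock /Rintegral => ->. Qed.

Let int3 (a : R) (A B D : Om -> R) : P.-integrable setT (EFin \o A) ->
  P.-integrable setT (EFin \o B) -> P.-integrable setT (EFin \o D) ->
  P.-integrable setT (EFin \o (fun w => A w - (B w + a * D w))) /\
  \int[P]_w (A w - (B w + a * D w)) = \int[P]_w A w - (\int[P]_w B w + a * \int[P]_w D w).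
Proof.
move=> iA iB iD.
have iaD : P.-integrable setT (EFin \o (fun w => a * D w)).
  rewrite (_ : _ \o _ = fun w => a%:E * (EFin \o D) w)%E; first exact: integrableZl.
  by apply/funext => w.
have iBD : P.-integrable setT (EFin \o (fun w => B w + a * D w)).
  exact: (integrableD measurableT iB iaD).
split; first exact: (integrableB measurableT iA iBD).
by rewrite RintegralB// RintegralD// RintegralZl.
Qed.

(** The covariance shows that the difference of the two sides has mean square
    zero. *)
Lemma isonormal_linear (a : R) h v :
  {ae P, forall w, X (h + a *: v) w = X h w + a * X v w}.
Proof.
pose U w := X (h + a *: v) w - (X h w + a * X v w).
have mU : measurable_fun setT U.
  by apply: measurable_funB => //; apply: measurable_funD => //; exact: measurable_funM.
have U0 g : P.-integrable setT (fun w => (U w * X g w)%:E) /\ \int[P]_w (U w * X g w) = 0.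
  have [h1 h2] := int3 a (isonormal_integrable (h + a *: v) g) (isonormal_integrable h g) (isonormal_integrable v g).
  rewrite !isonormal_cov dotDl subrr in h2.
  have E : (fun w => X (h + a *: v) w * X g w - (X h w * X g w + a * (X v w * X g w))) = fun w => U w * X g w.
    by apply/funext => w; rewrite /U; ring.
  by split; [have := h1; rewrite E|have := h2; rewrite E].
have [h1 h2] := int3 a (U0 (h + a *: v)).1 (U0 h).1 (U0 v).1.
rewrite !(U0 _).2 mulr0 addr0 subrr in h2.
have E : (fun w => U w * X (h + a *: v) w - (U w * X h w + a * (U w * X v w))) = fun w => U w ^+ 2.
  by apply/funext => w; rewrite /U; ring.
rewrite E in h1 h2.
have : (\int[P]_w `|(U w ^+ 2)%:E| = 0)%E.
  under eq_integral do rewrite gee0_abs ?lee_fin ?sqr_ge0//.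
  by rewrite -[LHS]fineK ?integrable_fin_num//; congr EFin.
have mU2 : measurable_fun setT (fun w => (U w ^+ 2)%:E).
  by apply/measurable_EFinP; exact: measurable_funX.
move/(ae_eq_integral_abs P measurableT mU2).1; apply: filterS => w /(_ I) [] /eqP.
by rewrite sqrf_eq0 subr_eq0 => /eqP.
Qed.

End one_process.

Lemma isonormal_indep X Y : independent_families (P := P) X Y -> forall (h g : H) A B,
  measurable A -> measurable B ->
  P (X h @^-1` A `&` Y g @^-1` B) = (P (X h @^-1` A) * P (Y g @^-1` B))%E.
Proof.
move=> XY h g A B mA mB; apply: XY; apply: sub_gen_smallest.
  by exists h, A.
by exists g, B.
Qed.

Section two_processes.
Variables X Y : H -> {RV P >-> R}.
Hypotheses (X_iso : isonormal ip X) (Y_iso : isonormal ip Y).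
Hypothesis XY : independent_families X Y.

(** The real part of the complex isonormal process, which determines it: the
    imaginary part at [h] is the real part at [- i h]. *)
Definition isoG (h : H * H) w : R := (Num.sqrt 2)^-1 * (X h.1 w - Y h.2 w).

Definition iso_cov (h v : H * H) : R := (ip h.1 v.1 + ip h.2 v.2) / 2.

Definition mul_Ni (h : H * H) : H * H := (h.2, - h.1).

Lemma measurable_isoG h : measurable_fun setT (isoG h).
Proof. by apply: measurable_funM => //; apply: measurable_funB. Qed.

Lemma isoG_lin (a : R) h v : {ae P, forall w, isoG (h + a *: v) w = isoG h w + a * isoG v w}.
Proof.
apply: filterS2 (isonormal_linear X_iso a h.1 v.1) (isonormal_linear Y_iso a h.2 v.2) => w h1 h2.
by rewrite /isoG /= h1 h2; ring.
Qed.

Lemma iso_covDl (a : R) h v u : iso_cov (h + a *: v) u = iso_cov h u + a * iso_cov v u.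
Proof. by rewrite /iso_cov /= !dotDl; ring. Qed.

Lemma iso_covC h v : iso_cov h v = iso_cov v h.
Proof. by rewrite /iso_cov (dotC h.1) (dotC h.2). Qed.

Lemma mul_NiD (a : R) h v : mul_Ni (h + a *: v) = mul_Ni h + a *: mul_Ni v.
Proof. by rewrite /mul_Ni /= opprD -scalerN. Qed.

Lemma iso_cov_mul_Ni h v : iso_cov (mul_Ni h) (mul_Ni v) = iso_cov h v.
Proof.
rewrite /iso_cov /mul_Ni /= addrC; congr ((_ + _) / _).
have N x y : ip (- x) y = - ip x y.
  by have := dotDl (-1) 0 x y; rewrite add0r scaleN1r linear0l add0r mulN1r.
by rewrite N dotC N opprK dotC.
Qed.

Lemma isoG_fourier h : \int[P]_w cos (isoG h w) = expR (- iso_cov h h / 2) /\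
  \int[P]_w sin (isoG h w) = 0.
Proof.
pose t : R := (Num.sqrt 2)^-1.
have t2 : t ^+ 2 = 2^-1 by rewrite exprVn sqr_sqrtr.
have mcos := measurable_cosZ t; have msin := measurable_sinZ t.
have cosb (x : R) : `|cos (t * x)| <= 1 by rewrite cos_max.
have sinb (x : R) : `|sin (t * x)| <= 1 by rewrite sin_max.
have [_ Xc Xs] := isonormal_moments X_iso h.1; have [_ Yc Ys] := isonormal_moments Y_iso h.2.
have mX : measurable_fun setT (X h.1 : Om -> R) by exact: measurable_funPT.
have mY : measurable_fun setT (Y h.2 : Om -> R) by exact: measurable_funPT.
have ind (f g : R -> R) := @indep_expectation _ _ _ P (X h.1) (Y h.2) f g 1 1 mX mY (@isonormal_indep X Y XY h.1 h.2).
have int (f g : R -> R) : measurable_fun setT f -> measurable_fun setT g ->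
    (forall x, `|f x| <= 1) -> (forall x, `|g x| <= 1) ->
    P.-integrable setT (EFin \o (fun w => f (X h.1 w) * g (Y h.2 w))).
  move=> mf mg f1 g1; apply: (@bounded_integrable _ _ _ P _ 1).
    by apply: measurable_funM; apply: measurableT_comp.
  by move=> w; rewrite normrM mulr_ile1.
split.
- transitivity (\int[P]_w (cos (t * X h.1 w) * cos (t * Y h.2 w) + sin (t * X h.1 w) * sin (t * Y h.2 w))).
    by apply: eq_Rintegral => w _; rewrite /isoG mulrBr cosB.
  rewrite RintegralD//; last 2 first.
  + exact: (int (fun x => cos (t * x)) (fun x => cos (t * x))).
  + exact: (int (fun x => sin (t * x)) (fun x => sin (t * x))).
  rewrite (ind (fun x => cos (t * x)) (fun x => cos (t * x)))//.
  rewrite (ind (fun x => sin (t * x)) (fun x => sin (t * x)))//.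
  rewrite Xc Yc Xs mul0r addr0 -expRD t2 /iso_cov; congr expR; lra.
- transitivity (\int[P]_w (sin (t * X h.1 w) * cos (t * Y h.2 w) - cos (t * X h.1 w) * sin (t * Y h.2 w))).
    by apply: eq_Rintegral => w _; rewrite /isoG mulrBr sinB.
  rewrite RintegralB//; last 2 first.
  + exact: (int (fun x => sin (t * x)) (fun x => cos (t * x))).
  + exact: (int (fun x => cos (t * x)) (fun x => sin (t * x))).
  rewrite (ind (fun x => sin (t * x)) (fun x => cos (t * x)))//.
  rewrite (ind (fun x => cos (t * x)) (fun x => sin (t * x)))//.
  by rewrite Xs Ys mul0r mulr0 subrr.
Qed.

Lemma complex_isonormal_ReIm (h : complexification H) w :
  complex_isonormal X Y h w = (isoG h w +i* ((Num.sqrt 2)^-1 * (X h.2 w + Y h.1 w)))%C.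
Proof.
apply/eqP; rewrite eq_complex /complex_isonormal /complexify /isoG /=.
have s0 : Num.sqrt 2 != 0 :> R by rewrite gt_eqF// sqrtr_gt0.
have s2 : Num.sqrt 2 ^+ 2 + 0 ^+ 2 != 0 :> R by rewrite expr0n addr0 sqrf_eq0.
by apply/andP; split; apply/eqP; move: (Num.sqrt 2 : R) s0 s2 => s s0 s2; field; rewrite s0 -?expr2.
Qed.

Lemma complex_isonormalE (h : complexification H) :
  {ae P, forall w, complex_isonormal X Y h w = gaussC isoG mul_Ni h w}.
Proof.
have := isonormal_linear Y_iso (-1) 0 h.1; have := isonormal_linear Y_iso (-1) 0 0.
rewrite scaler0 !add0r scaleN1r; apply: filterS2 => w h1 h2.
have Y0 : Y 0 w = 0 by lra.
by rewrite complex_isonormal_ReIm /gaussC /isoG /= h2 Y0 add0r mulN1r opprK.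
Qed.

Lemma isonormal_wick_density (e : nat -> complexification H) (m n : nat -> nat)
    (s : seq nat) l :
  (forall k l, k != l -> cplx_dot ip (e k) (e l) = 0) ->
  (forall k, cplx_norm ip (e k) = Num.sqrt 2) ->
  uniq s -> l \in s -> m l <> n l ->
  forall N : set (R * R), measurable N -> (@lebesgue_measure R \x @lebesgue_measure R)%E N = 0%E ->
  P [set w | N (c2r (\prod_(k <- s) wick 2 (m k) (n k) (gaussC isoG mul_Ni (e k) w)))] = 0%E.
Proof.
move=> e0 e1 us ls mn; apply: gaussC_prod_density ls mn => //.
- exact: measurable_isoG.
- exact: isoG_lin.
- exact: iso_covDl.
- exact: iso_covC.
- exact: mul_NiD.
- exact: iso_cov_mul_Ni.
- exact: isoG_fourier.
- move=> k; have := e1 k; rewrite /cplx_norm /= => /(congr1 (fun x => x ^+ 2)).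
  rewrite !sqr_sqrtr//; first by rewrite /iso_cov => ->; rewrite divff.
  have ip0 h : 0 <= ip h h.
    rewrite -lee_fin; have [<- _ _] := isonormal_moments X_iso h.
    by apply: integral_ge0 => w _; rewrite lee_fin sqr_ge0.
  by rewrite addr_ge0.
- move=> k k' kk'; have /eqP := e0 k k' kk'; rewrite eq_complex /= => /andP[/eqP h1 /eqP h2].
  rewrite /iso_cov h1 mul0r; split=> //=.
  have N x y : ip y (- x) = - ip y x.
    by have := dotDl (-1) 0 x y; rewrite add0r scaleN1r linear0l add0r mulN1r dotC (dotC x).
  by rewrite N -[X in X / _]opprK opprD opprK addrC h2 oppr0 mul0r.
Qed.

End two_processes.

End isonormal_processes.

(** * Geometry of the complexification *)

Section complexification_geometry.
Context {R : realType} (H : completeNormedModType R) (ip : {dot H for @idfun R}).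
Hypothesis ip_norm : norm_from_dot ip.
Local Notation HC := (complexification H).
Local Notation C := R[i].
Local Notation dot := (cplx_dot ip).
Implicit Types (x y z : HC) (a : C).

Lemma cplx_dotDl a x y z : dot (a *: x + y) z = a * dot x z + dot y z.
Proof.
have D r (f g h : H) : ip (r *: f + g) h = r * ip f h + ip g h.
  by rewrite addrC (dotDl ip) addrC.
have DB r s (f g h k : H) : ip (r *: f - s *: g + h) k = r * ip f k - s * ip g k + ip h k.
  by rewrite -addrA -scaleNr !D; ring.
have DD r s (f g h k : H) : ip (r *: f + s *: g + h) k = r * ip f k + s * ip g k + ip h k.
  by rewrite -addrA D D; ring.
apply/eqP; rewrite eq_complex; case: a x y => [a a'] [f g] [f' g'] /=.
by rewrite !DB !DD; apply/andP; split; apply/eqP; ring.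
Qed.

Lemma cplx_dotC x y : dot x y = (dot y x)^*.
Proof.
apply/eqP; rewrite eq_complex /= !(dotC ip y.1) !(dotC ip y.2) eqxx /=.
by rewrite opprB.
Qed.

Definition nrm2 x : R := ip x.1 x.1 + ip x.2 x.2.

Lemma nrm2E x : nrm2 x = `|x.1| ^+ 2 + `|x.2| ^+ 2.
Proof. by rewrite /nrm2 -!ip_norm. Qed.

Lemma nrm2_ge0 x : 0 <= nrm2 x. Proof. by rewrite nrm2E addr_ge0 ?sqr_ge0. Qed.

Lemma cplx_dot_nrm2 x : dot x x = (nrm2 x)%:C%C.
Proof. by apply/eqP; rewrite eq_complex /= eqxx /= dotC subrr. Qed.

Lemma nrm2_eq0 x : nrm2 x = 0 -> x = 0.
Proof.
rewrite nrm2E => /eqP; rewrite paddr_eq0 ?sqr_ge0// !sqrf_eq0 !normr_eq0.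
by case: x => f g /= /andP[/eqP-> /eqP->].
Qed.

Lemma cplx_dot0l x : dot 0 x = 0.
Proof. by have := cplx_dotDl (-1) 0 0 x; rewrite scaler0 addr0 mulN1r addNr. Qed.

Lemma cplx_dotZl a x z : dot (a *: x) z = a * dot x z.
Proof. by have := cplx_dotDl a x 0 z; rewrite addr0 cplx_dot0l addr0. Qed.

Lemma cplx_dotAl x y z : dot (x + y) z = dot x z + dot y z.
Proof. by have := cplx_dotDl 1 x y z; rewrite scale1r mul1r. Qed.

Lemma cplx_dotAr x y z : dot z (x + y) = dot z x + dot z y.
Proof. by rewrite cplx_dotC cplx_dotAl rmorphD /= -!cplx_dotC. Qed.

Lemma cplx_dotZr a x z : dot z (a *: x) = a^* * dot z x.
Proof. by rewrite cplx_dotC cplx_dotZl rmorphM /= -!cplx_dotC. Qed.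

Lemma nrm2Z a x : nrm2 (a *: x) = sqmod a * nrm2 x.
Proof.
have : (nrm2 (a *: x))%:C%C = (sqmod a * nrm2 x)%:C%C :> C.
  by rewrite -cplx_dot_nrm2 cplx_dotZl cplx_dotZr cplx_dot_nrm2 mulrA -sqmodE -rmorphM.
by case.
Qed.

Lemma nrm2_pyth x y : dot x y = 0 -> nrm2 (x + y) = nrm2 x + nrm2 y.
Proof.
move=> xy; have : (nrm2 (x + y))%:C%C = (nrm2 x + nrm2 y)%:C%C :> C.
  rewrite -cplx_dot_nrm2 cplx_dotAl !cplx_dotAr xy (cplx_dotC y x) xy conjC0.
  by rewrite addr0 add0r !cplx_dot_nrm2 -rmorphD.
by case.
Qed.

Lemma nrm2B x y : nrm2 (x - y) = nrm2 (y - x).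
Proof. by rewrite -opprB -scaleN1r nrm2Z /sqmod /= oppr0 sqrrN expr1n expr0n addr0 mul1r. Qed.

Lemma cplx_dot_CauchySchwarz x y : sqmod (dot x y) <= nrm2 x * nrm2 y.
Proof.
have [y0|y0] := eqVneq (nrm2 y) 0.
  rewrite (nrm2_eq0 y0) cplx_dotC cplx_dot0l conjC0 /sqmod /= expr0n addr0.
  by rewrite mulr_ge0// nrm2_ge0.
pose c := dot x y / (nrm2 y)%:C%C.
have yC : (nrm2 y)%:C%C != 0 :> C by rewrite eq_complex /= eqxx andbT.
have cy : dot (x - c *: y) (c *: y) = 0.
  rewrite cplx_dotZr cplx_dotAl -scaleNr cplx_dotZl cplx_dot_nrm2 /c.
  by rewrite mulNr divfK// subrr mulr0.
have := nrm2_pyth cy; rewrite subrK nrm2Z => xE.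
have : sqmod c * nrm2 y <= nrm2 x by rewrite xE lerDr nrm2_ge0.
have -> : sqmod c = sqmod (dot x y) / nrm2 y ^+ 2.
  have : sqmod (c * (nrm2 y)%:C%C) = sqmod (dot x y) by rewrite /c divfK.
  rewrite sqmodM => <-; rewrite {3}/sqmod /= expr0n addr0.
  by rewrite mulfK// sqrf_eq0.
have yp : 0 < nrm2 y by rewrite lt_neqAle eq_sym y0 nrm2_ge0.
have -> : sqmod (dot x y) / nrm2 y ^+ 2 * nrm2 y = sqmod (dot x y) / nrm2 y by field.
by rewrite ler_pdivrMr.
Qed.

Section expansion.
Variable xi : nat -> HC.
Hypothesis xi_cons : complete_orthonormal ip xi.

Let xi1 k : nrm2 (xi k) = 1.
Proof.
have [_ /(_ k)] := xi_cons; rewrite /cplx_norm /= -/(nrm2 _) => /(congr1 (fun r : R => r ^+ 2)).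
by rewrite sqr_sqrtr ?nrm2_ge0// expr1n.
Qed.

Lemma cplx_dot_orthonormal k l : dot (xi k) (xi l) = (k == l)%:R.
Proof.
have [->|kl] := eqVneq k l; first by rewrite cplx_dot_nrm2 xi1.
by have [[/(_ k l kl)]] := xi_cons.
Qed.

Definition expansion y N : HC := \sum_(k < N) dot y (xi k) *: xi k.

Let dot_expansion y N l : dot (expansion y N) (xi l) = if (l < N)%N then dot y (xi l) else 0.
Proof.
rewrite /expansion (big_morph (fun x => dot x (xi l)) (fun x z => cplx_dotAl x z (xi l)) (cplx_dot0l _)).
under eq_bigr do rewrite cplx_dotZl cplx_dot_orthonormal.
case: ifP => lN; last first.
  rewrite big1// => -[k kN] _ /=; case: eqVneq; last by rewrite mulr0.
  by move=> kl; move: lN; rewrite -kl kN.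
rewrite (bigD1 (Ordinal lN))//= eqxx mulr1 big1 ?addr0// => k kl.
by rewrite (_ : _ == _ = false) ?mulr0//; apply: contraNF kl => /eqP kl; apply/eqP/val_inj.
Qed.

Let nrm2_expansionB y M N : (N <= M)%N ->
  nrm2 (expansion y M - expansion y N) = \sum_(N <= k < M) sqmod (dot y (xi k)).
Proof.
move=> /subnK <-; elim: (M - N)%N => [|n IH]; first by rewrite add0n subrr big_geq// /nrm2 !linear0l addr0.
rewrite addSn big_nat_recr ?leq_addl//= -IH {1}/expansion big_ord_recr /= -/(expansion y _).
rewrite addrAC (@nrm2_pyth (_ - _) (_ *: _)) ?nrm2Z ?xi1 ?mulr1//.
by rewrite cplx_dotZr cplx_dotAl -scaleN1r cplx_dotZl !dot_expansion ltnn ltnNge leq_addl /= mulr0 addr0 mulr0.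
Qed.

Let bessel y N : \sum_(0 <= k < N) sqmod (dot y (xi k)) <= nrm2 y.
Proof.
have e0 : expansion y 0 = 0 by rewrite /expansion big_ord0.
have := nrm2_expansionB y (leq0n N); rewrite e0 subr0 => <-.
have : dot (y - expansion y N) (expansion y N) = 0.
  rewrite cplx_dotC {1}/expansion.
  rewrite (big_morph (fun x => dot x _) (fun x z => cplx_dotAl x z _) (cplx_dot0l _)).
  rewrite big1 ?conjC0// => k _.
  have dk : dot (y - expansion y N) (xi k) = 0.
    by rewrite cplx_dotAl -scaleN1r cplx_dotZl dot_expansion ltn_ord mulN1r subrr.
  by rewrite cplx_dotZl (cplx_dotC (xi k)) dk conjC0 mulr0.
by move/nrm2_pyth; rewrite subrK => ->; rewrite lerDr nrm2_ge0.
Qed.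

(** Bessel's inequality makes the expansion converge, and completeness
    identifies the limit. *)
Lemma expansion_close y (r : R) : 0 < r -> exists N, nrm2 (y - expansion y N) < r.
Proof.
move=> r0; pose u k := sqmod (dot y (xi k)).
have u0 k : 0 <= u k by exact: sqmod_ge0.
have cu : cvgn (series u).
  apply: nondecreasing_is_cvgn.
    by apply/nondecreasing_seqP => n; rewrite /series /= big_nat_recr//= lerDl.
  by exists (nrm2 y) => _ [n _ <-]; exact: bessel.
have cauchy (e : R) : 0 < e -> exists N, forall n m, (N <= n)%N -> (N <= m)%N ->
    nrm2 (expansion y n - expansion y m) < e.
  move=> e0; have /cvgrPdist_lt /(_ e e0) [N _ hN] := cu.
  have ndu : nondecreasing_seq (series u).
    by apply/nondecreasing_seqP => n; rewrite /series /= big_nat_recr//= lerDl.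
  have le n m : (N <= n)%N -> (n <= m)%N -> nrm2 (expansion y m - expansion y n) < e.
    move=> Nn nm; rewrite nrm2_expansionB//.
    have -> : \sum_(n <= k < m) u k = series u m - series u n by rewrite sub_series_geq.
    have := hN n Nn; rewrite /= ger0_norm ?subr_ge0; last exact: nondecreasing_cvgn_le.
    by apply: le_lt_trans; rewrite lerD2r; exact: nondecreasing_cvgn_le.
  exists N => n m Nn Nm; have [nm|mn] := leqP n m; first by rewrite nrm2B; exact: le.
  by apply: le => //; exact: ltnW.
have complete (f : nat -> H) :
    (forall n m, `|f n - f m| ^+ 2 <= nrm2 (expansion y n - expansion y m)) -> cvgn f.
  move=> fle; apply: cauchy_cvg; apply: cauchy_exP => e e0.
  have [N hN] := cauchy (e ^+ 2) (exprn_gt0 2 e0).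
  exists (f N); exists N => // n /= Nn; rewrite -ball_normE /=.
  rewrite -(@ltr_pXn2r _ 2) ?nnegrE//; last exact: ltW.
  by apply: le_lt_trans (fle _ _) _; exact: hN.
have c1 : cvgn (fun n => (expansion y n).1 : H).
  by apply: complete => n m; rewrite nrm2E /= lerDl sqr_ge0.
have c2 : cvgn (fun n => (expansion y n).2 : H).
  by apply: complete => n m; rewrite nrm2E /= lerDr sqr_ge0.
pose y' : HC := (lim ((fun n => (expansion y n).1 : H) @ \oo), lim ((fun n => (expansion y n).2 : H) @ \oo)).
have close (e : R) : 0 < e -> \forall n \near \oo, nrm2 (y' - expansion y n) < e.
  move=> e0; have e2 : 0 < Num.sqrt (e / 2) by rewrite sqrtr_gt0 divr_gt0.
  have /cvgrPdist_lt /(_ _ e2) h1 := c1; have /cvgrPdist_lt /(_ _ e2) h2 := c2.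
  apply: filterS2 h1 h2 => n h1 h2; rewrite nrm2E /=.
  have s2 : Num.sqrt (e / 2) ^+ 2 = e / 2 by rewrite sqr_sqrtr// divr_ge0 ?ltW.
  have sq (g : R) : 0 <= g -> g < Num.sqrt (e / 2) -> g ^+ 2 < e / 2.
    by move=> g0 gs; rewrite -s2 ltrXn2r.
  have := ltrD (sq _ (normr_ge0 _) h1) (sq _ (normr_ge0 _) h2).
  by rewrite -splitr.
have yy' : y = y'.
  apply/eqP; rewrite -subr_eq0; apply/eqP; have [[_ tot] _] := xi_cons; apply: tot => l.
  apply/eqP; rewrite -sqmod_eq0; apply/eqP/le_anti; rewrite sqmod_ge0 andbT.
  apply/ler_addgt0Pr => e e0; rewrite add0r.
  have [N _ hN] := close e e0; pose n := maxn N l.+1.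
  have := hN n (leq_maxl _ _) => /ltW; apply: le_trans.
  have -> : dot (y - y') (xi l) = dot (expansion y n - y') (xi l).
    by rewrite !cplx_dotAl dot_expansion leq_maxr.
  rewrite nrm2B; apply: le_trans (cplx_dot_CauchySchwarz _ _) _.
  by rewrite xi1 mulr1 nrm2B.
have [N _ hN] := close r r0; exists N; rewrite {1}yy'; apply: hN; exact: leqnn.
Qed.

End expansion.
End complexification_geometry.

(** * Almost surely linear maps into random variables *)

Section dfwith_lift.
Context (A : Type).

Lemma dfwith_same n (u : 'I_n -> A) i : dfwith u i (u i) = u.
Proof. by apply/funext => j; case: dfwithP. Qed.

Lemma dfwith_lift_eq n (u : 'I_n -> A) i (y : A) : dfwith u i y \o lift i = u \o lift i.
Proof. by apply/funext => j; rewrite /= dfwithout// neq_lift. Qed.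

Lemma dfwith_lift n (u : 'I_n -> A) h i (y : A) :
  dfwith u (lift h i) y \o lift h = dfwith (u \o lift h) i y.
Proof.
apply/funext => j /=; have [->|ij] := eqVneq i j; first by rewrite !dfwithin.
by rewrite !dfwithout//; apply: contra ij => /eqP /lift_inj ->.
Qed.

End dfwith_lift.

Section summable_ae.
Context d (Om : measurableType d) (R : realType) (P : probability Om R).

(** The sum of the variables has a finite expectation, hence is almost surely
    finite. *)
Lemma summable_ae_cvg0 (f : nat -> Om -> R) (c : R) :
  (forall n, measurable_fun setT (f n)) -> (forall n w, 0 <= f n w) ->
  (forall n, (\int[P]_w (f n w)%:E <= (c * 2^-1 ^+ n)%:E)%E) ->
  {ae P, forall w, f n w @[n --> \oo] --> (0 : R)}.
Proof.
move=> mf f0 fc.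
have c0 : 0 <= c.
  have := fc 0%N; rewrite expr0 mulr1 -lee_fin; apply: le_trans.
  by apply: integral_ge0 => w _; rewrite lee_fin.
pose F w := (\sum_(0 <= n <oo) (f n w)%:E)%E.
have mF n : measurable_fun setT (fun w => (f n w)%:E) by exact/measurable_EFinP.
have iF : P.-integrable setT F.
  apply/integrableP; split.
    by apply: ge0_emeasurable_sum => // n w _ _; rewrite lee_fin.
  have F0 w : (0 <= F w)%E by apply: nneseries_ge0 => n _ _; rewrite lee_fin.
  under eq_integral do rewrite gee0_abs//.
  rewrite /F integral_nneseries//; last by move=> n w _; rewrite lee_fin.
  apply: (@le_lt_trans _ _ (c * 2)%:E); last exact: ltry.
  apply: lime_le; first by apply: is_cvg_nneseries => n _ _; apply: integral_ge0 => w _; rewrite lee_fin.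
  apply: nearW => N; apply: (@le_trans _ _ (\sum_(0 <= n < N) (c * 2^-1 ^+ n)%:E)%E).
    by apply: lee_sum => n _; exact: fc.
  rewrite sumEFin lee_fin -mulr_sumr ler_wpM2l//.
  have -> : \sum_(0 <= n < N) 2^-1 ^+ n = 2 - 2 * 2^-1 ^+ N :> R.
    elim: N => [|N IH]; first by rewrite big_geq// expr0 mulr1 subrr.
    by rewrite big_nat_recr//= IH exprS; field.
  by rewrite lerBlDr lerDl mulr_ge0// exprn_ge0.
have := integrable_ae measurableT iF; apply: filterS => w /(_ I) Ffin.
apply: cvg_series_cvg_0; apply: nondecreasing_is_cvgn.
  by apply/nondecreasing_seqP => n; rewrite /series /= big_nat_recr//= lerDl.
exists (fine (F w)) => _ [n _ <-]; rewrite -lee_fin fineK//= /series /= -sumEFin.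
by apply: nneseries_lim_ge => k _; rewrite lee_fin.
Qed.

End summable_ae.

Section lin_ae.
Context {R : realType} (H : completeNormedModType R) (ip : {dot H for @idfun R}).
Hypothesis ip_norm : norm_from_dot ip.
Context d (Om : measurableType d) (P : probability Om R).
Local Notation HC := (complexification H).
Local Notation C := R[i].

(** The exceptional null set may depend on the vectors. Continuity is tested on
    rapidly decreasing sequences, along which convergence in mean square entails
    almost sure convergence. [theta] is the identity or the conjugation. *)
Record lin_ae (theta : C -> C) (phi : HC -> Om -> C) : Prop := {
  lin_ae_lin : forall (a : C) (x y : HC),
    {ae P, forall w, phi (a *: x + y) w = theta a * phi x w + phi y w} ;
  lin_ae_cvg : forall y : nat -> HC, (forall n, nrm2 ip (y n) <= 2^-1 ^+ n) ->
    {ae P, forall w, sqmod (phi (y n) w) @[n --> \oo] --> (0 : R)} }.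

Variable theta : C -> C.

Lemma lin_ae0 : lin_ae theta (fun _ _ => 0).
Proof.
split=> [a x y|y _]; apply: nearW => w; first by rewrite mulr0 addr0.
by rewrite /sqmod /= expr0n addr0; exact: cvg_cst.
Qed.

Lemma lin_aeM (A : Om -> C) phi : lin_ae theta phi ->
  lin_ae theta (fun y w => A w * phi y w).
Proof.
move=> [h1 h2]; split=> [a x y|y /h2].
  by apply: filterS (h1 a x y) => w ->; ring.
apply: filterS => w h; rewrite (_ : (fun n => _) = fun n => sqmod (A w) * sqmod (phi (y n) w)).
  have -> : (0 : R) = sqmod (A w) * 0 by rewrite mulr0.
  by apply: cvgM => //; exact: cvg_cst.
by apply/funext => n; rewrite sqmodM.
Qed.

Lemma lin_aeD phi psi : lin_ae theta phi -> lin_ae theta psi ->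
  lin_ae theta (fun y w => phi y w + psi y w).
Proof.
move=> [h1 h2] [g1 g2]; split=> [a x y|y yn].
  by apply: filterS2 (h1 a x y) (g1 a x y) => w -> ->; ring.
apply: filterS2 (h2 _ yn) (g2 _ yn) => w h g.
apply: (@squeeze_cvgr _ _ _ _ (cst 0) (fun n => 2 * sqmod (phi (y n) w) + 2 * sqmod (psi (y n) w))).
- by apply: nearW => n; rewrite sqmod_ge0 sqmodD.
- exact: cvg_cst.
- rewrite -[X in _ --> X](addr0 0) -{1}(mulr0 2) -{2}(mulr0 2).
  by apply: cvgD; apply: cvgM => //; exact: cvg_cst.
Qed.

Lemma lin_aeB phi psi : lin_ae theta phi -> lin_ae theta psi ->
  lin_ae theta (fun y w => phi y w - psi y w).
Proof.
move=> h g; have := lin_aeD h (lin_aeM (fun=> -1) g).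
by congr lin_ae; apply/funext => y; apply/funext => w; rewrite mulN1r.
Qed.

Lemma lin_ae_sum n (F : 'I_n -> HC -> Om -> C) : (forall i, lin_ae theta (F i)) ->
  lin_ae theta (fun y w => \sum_(i < n) F i y w).
Proof.
elim: n F => [|n IH] F hF.
  have := lin_ae0; congr lin_ae; apply/funext => y; apply/funext => w.
  by rewrite big_ord0.
have := lin_aeD (IH _ (fun i => hF (widen_ord (leqnSn n) i))) (hF ord_max).
by congr lin_ae; apply/funext => y; apply/funext => w; rewrite big_ord_recr.
Qed.

Variable xi : nat -> HC.
Hypothesis xi_cons : complete_orthonormal ip xi.

(** Such a map is determined by its values on an orthonormal system: the tail
    of the expansion of a vector tends to zero rapidly along a subsequence. *)
Lemma lin_ae_basis phi : lin_ae theta phi ->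
  (forall k, {ae P, forall w, phi (xi k) w = 0}) ->
  forall y, {ae P, forall w, phi y w = 0}.
Proof.
move=> [h1 h2] phi0 y.
have tail N : {ae P, forall w, phi (y - expansion ip xi y N) w = phi y w}.
  elim: N => [|N IH].
    by apply: nearW => w; rewrite /expansion big_ord0 subr0.
  pose a := - cplx_dot ip y (xi N).
  have := h1 a (xi N) (y - expansion ip xi y N).
  have -> : a *: xi N + (y - expansion ip xi y N) = y - expansion ip xi y N.+1.
    by rewrite /a /expansion big_ord_recr /= opprD [RHS]addrA [LHS]addrC scaleNr.
  by apply: filterS3 IH (phi0 N) => w -> -> ->; rewrite mulr0 add0r.
have pick n : exists N, nrm2 ip (y - expansion ip xi y N) < 2^-1 ^+ n.
  by apply: expansion_close => //; rewrite exprn_gt0// invr_gt0.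
pose N n := projT1 (cid (pick n)).
have hN n : nrm2 ip (y - expansion ip xi y (N n)) <= 2^-1 ^+ n.
  by apply: ltW; exact: projT2 (cid (pick n)).
apply: filterS2 (h2 _ hN) (ae_foralln tail) => w hc ht.
move: hc; rewrite (_ : (fun n => _) = cst (sqmod (phi y w))); last first.
  by apply/funext => n; rewrite ht.
move=> hc; apply/eqP; rewrite -sqmod_eq0; apply/eqP.
by apply: (cvg_unique _ (cvg_cst (sqmod (phi y w))) hc).
Qed.

(** The arguments are changed one at a time from basis vectors into arbitrary
    ones. *)
Lemma lin_ae_multilinear n (Phi : ('I_n -> HC) -> Om -> C) :
  (forall u i, lin_ae theta (fun y => Phi (dfwith u i y))) ->
  (forall ka : 'I_n -> nat, {ae P, forall w, Phi (xi \o ka) w = 0}) ->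
  forall u, {ae P, forall w, Phi u w = 0}.
Proof.
move=> Plin P0.
(* the arguments with index at least [m] are basis vectors *)
suff step m : forall u, (forall i : 'I_n, (m <= i)%N -> exists k, u i = xi k) ->
    {ae P, forall w, Phi u w = 0}.
  by move=> u; apply: (step n) => i; rewrite leqNgt ltn_ord.
elim: m => [|m IH] u hu.
  have /choice[ka kaE] := fun i => hu i (leq0n _).
  by have -> : u = xi \o ka by apply/funext => i; exact: kaE.
have [nm|mn] := leqP n m.
  by apply: IH => i mi; have := leq_trans nm mi; rewrite leqNgt ltn_ord.
pose i0 := Ordinal mn.
have := @lin_ae_basis _ (Plin u i0) _ (u i0); rewrite dfwith_same; apply => k.
apply: IH => i mi; have [<-|ii] := eqVneq i0 i; first by exists k; rewrite dfwithin.
rewrite dfwithout//; apply: hu; rewrite ltn_neqAle mi andbT.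
by apply: contra ii => /eqP e; apply/eqP/val_inj.
Qed.

End lin_ae.

Section lin_ae_instances.
Context {R : realType} (H : completeNormedModType R) (ip : {dot H for @idfun R}).
Hypothesis ip_norm : norm_from_dot ip.
Context d (Om : measurableType d) (P : probability Om R).
Local Notation HC := (complexification H).
Local Notation C := R[i].
Local Notation lin_ae := (lin_ae ip P).

Lemma sqmod_conj (z : C) : sqmod z^* = sqmod z.
Proof. by case: z => a b; rewrite /sqmod /= sqrrN. Qed.

Lemma lin_ae_conj phi : lin_ae id phi -> lin_ae (@Num.conj C) (fun y w => (phi y w)^*).
Proof.
move=> [h1 h2]; split=> [a x y|y /h2].
  by apply: filterS (h1 a x y) => w ->; rewrite rmorphD rmorphM.
apply: filterS => w; rewrite (_ : (fun n => sqmod (phi (y n) w)^*) = fun n => sqmod (phi (y n) w))//.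
by apply/funext => n; rewrite sqmod_conj.
Qed.

Lemma geometric_cvg0 (c : R) (u : nat -> R) : (forall n, 0 <= u n <= c * 2^-1 ^+ n) ->
  u @ \oo --> (0 : R).
Proof.
move=> uc; apply: (@squeeze_cvgr _ _ _ _ (cst 0) (fun n => c * 2^-1 ^+ n)).
- exact: nearW.
- exact: cvg_cst.
- rewrite -[X in _ --> X](mulr0 c); apply: cvgM; first exact: cvg_cst.
  by apply: cvg_expr; rewrite ger0_norm ?invr_ge0// invf_lt1// ltr1n.
Qed.

Lemma lin_ae_dotl v : lin_ae id (fun y _ => cplx_dot ip y v).
Proof.
split=> [a x y|y yn]; apply: nearW => w; first by rewrite cplx_dotDl.
apply: (@geometric_cvg0 (nrm2 ip v)) => n; rewrite sqmod_ge0 /=.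
apply: le_trans (cplx_dot_CauchySchwarz ip_norm _ _) _.
by rewrite mulrC ler_wpM2l// nrm2_ge0.
Qed.

Lemma lin_ae_dotr v : lin_ae (@Num.conj C) (fun y _ => cplx_dot ip v y).
Proof.
split=> [a x y|y yn]; apply: nearW => w; first by rewrite cplx_dotAr cplx_dotZr.
apply: (@geometric_cvg0 (nrm2 ip v)) => n; rewrite sqmod_ge0 /=.
apply: le_trans (cplx_dot_CauchySchwarz ip_norm _ _) _.
by rewrite ler_wpM2l// nrm2_ge0.
Qed.

Section isonormal_instance.
Variables X Y : H -> {RV P >-> R}.
Hypotheses (X_iso : isonormal ip X) (Y_iso : isonormal ip Y).
Local Notation Z := (complex_isonormal X Y).

Let mX h : measurable_fun setT (X h : Om -> R). Proof. exact: measurable_funPT. Qed.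
Let mY h : measurable_fun setT (Y h : Om -> R). Proof. exact: measurable_funPT. Qed.

Lemma cmeasurable_isonormal h : cmeasurable (Z h).
Proof.
apply/cmeasurableP; split.
  under eq_fun do rewrite complex_isonormal_ReIm /=.
  exact: measurable_isoG.
under eq_fun do rewrite complex_isonormal_ReIm /=.
by apply: measurable_funM => //; apply: measurable_funD.
Qed.

Let L4 (W : H -> {RV P >-> R}) (a b : R) f g h : isonormal ip W ->
  {ae P, forall w, W (a *: f + b *: g + h) w = a * W f w + b * W g w + W h w}.
Proof.
move=> hW; have h1 := isonormal_linear hW a (b *: g + h) f.
have h2 := isonormal_linear hW b h g.
rewrite addrC addrA in h1; rewrite addrC in h2.
apply: filterS2 h1 h2 => w -> ->; ring.
Qed.

Lemma isonormal_second_moment y : (\int[P]_w (sqmod (Z y w))%:E <= (2 * nrm2 ip y)%:E)%E.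
Proof.
have msq (W : H -> {RV P >-> R}) h : measurable_fun setT (fun w => (W h w ^+ 2)%:E).
  by apply/measurable_EFinP; apply: measurable_funX; exact: measurable_funPT.
apply: (@le_trans _ _ (\int[P]_w ((X y.1 w ^+ 2)%:E + (Y y.2 w ^+ 2)%:E + ((X y.2 w ^+ 2)%:E + (Y y.1 w ^+ 2)%:E)))%E).
  apply: ge0_le_integral => //.
  - by move=> w _; rewrite lee_fin sqmod_ge0.
  - by apply/measurable_EFinP; exact: (measurable_sqmod (cmeasurable_isonormal y)).
  - by apply: emeasurable_funD; apply: emeasurable_funD.
  - move=> w _; rewrite -!EFinD lee_fin complex_isonormal_ReIm /isoG /sqmod /= !exprMn exprVn sqr_sqrtr//.
    have := sqr_ge0 (X y.1 w + Y y.2 w); have := sqr_ge0 (X y.2 w - Y y.1 w).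
    by rewrite !expr2; lra.
have [x1 _ _] := isonormal_moments X_iso y.1; have [x2 _ _] := isonormal_moments X_iso y.2.
have [y1 _ _] := isonormal_moments Y_iso y.1; have [y2 _ _] := isonormal_moments Y_iso y.2.
have sq0 (W : H -> {RV P >-> R}) h w : (0 <= (W h w ^+ 2)%:E)%E by rewrite lee_fin sqr_ge0.
have IE (W W' : H -> {RV P >-> R}) h h' :
    (\int[P]_w ((W h w ^+ 2)%:E + (W' h' w ^+ 2)%:E) =
     \int[P]_w (W h w ^+ 2)%:E + \int[P]_w (W' h' w ^+ 2)%:E)%E.
  by rewrite ge0_integralD.
rewrite ge0_integralD//.
- by rewrite !IE x1 x2 y1 y2 -!EFinD lee_fin /nrm2; lra.
- by move=> w _; exact: adde_ge0.
- by apply: emeasurable_funD.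
- by move=> w _; exact: adde_ge0.
- by apply: emeasurable_funD.
Qed.

Lemma lin_ae_isonormal : lin_ae id Z.
Proof.
split=> [a x y|y yn].
  apply: filterS2 (filterI (L4 (complex.Re a) (- complex.Im a) x.1 x.2 y.1 X_iso)
                           (L4 (complex.Re a) (complex.Im a) x.2 x.1 y.2 X_iso))
                  (filterI (L4 (complex.Re a) (- complex.Im a) x.1 x.2 y.1 Y_iso)
                           (L4 (complex.Re a) (complex.Im a) x.2 x.1 y.2 Y_iso)).
  move=> w [h1 h2] [h3 h4]; rewrite !complex_isonormal_ReIm /isoG /= -!scaleNr h1 h2 h3 h4.
  by case: a {h1 h2 h3 h4} => [a a'] /=; apply/eqP; rewrite eq_complex /=; apply/andP; split; apply/eqP; ring.
apply: (@summable_ae_cvg0 _ _ _ P (fun n w => sqmod (Z (y n) w)) 2).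
- by move=> n; exact: (measurable_sqmod (cmeasurable_isonormal (y n))).
- by move=> n w; exact: sqmod_ge0.
- move=> n; apply: le_trans (isonormal_second_moment _) _.
  by rewrite lee_fin ler_wpM2l.
Qed.

End isonormal_instance.

End lin_ae_instances.

(** * Wick products *)

Section wick_products.
Context {R : realType} (H : completeNormedModType R) (ip : {dot H for @idfun R}).
Hypothesis ip_norm : norm_from_dot ip.
Context d (Om : measurableType d) (P : probability Om R).
Local Notation HC := (complexification H).
Local Notation C := R[i].
Local Notation lin_ae := (lin_ae ip P).
Variable Z : HC -> Om -> C.

(** The Wick product of the [Z (u i)] and of the conjugates of the [Z (v j)]:
    each [Z (u i)] is either kept or contracted with some conjugate. *)
Fixpoint wick_prod p q : ('I_p -> HC) -> ('I_q -> HC) -> Om -> C :=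
  if p is p'.+1 then fun u v w =>
    Z (u ord0) w * wick_prod (u \o lift ord0) v w -
    \sum_(j < q) cplx_dot ip (u ord0) (v j) *
                 wick_prod (u \o lift ord0) (v \o lift j) w
  else fun _ v w => \prod_(j < q) (Z (v j) w)^*.

Hypothesis Z_lin : lin_ae id Z.

Lemma lin_ae_wick_l p q (u : 'I_p -> HC) (v : 'I_q -> HC) i :
  lin_ae id (fun y => wick_prod (dfwith u i y) v).
Proof.
elim: p q u v i => [|p IH] q u v i; first by case: i.
have [i' iE|iE] := unliftP ord0 i; subst i.
  have e0 y : dfwith u (lift ord0 i') y ord0 = u ord0 by rewrite dfwithout// eq_sym neq_lift.
  rewrite (_ : (fun y => _) = fun y w => Z (u ord0) w * wick_prod (dfwith (u \o lift ord0) i' y) v w -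
      \sum_(j < q) cplx_dot ip (u ord0) (v j) * wick_prod (dfwith (u \o lift ord0) i' y) (v \o lift j) w).
    apply: lin_aeB; first exact: lin_aeM.
    by apply: lin_ae_sum => j; exact: (lin_aeM (fun=> _)).
  by apply/funext => y; apply/funext => w /=; rewrite dfwith_lift e0.
rewrite (_ : (fun y => _) = fun y w => wick_prod (u \o lift ord0) v w * Z y w -
    \sum_(j < q) wick_prod (u \o lift ord0) (v \o lift j) w * cplx_dot ip y (v j)).
  apply: lin_aeB; first exact: lin_aeM.
  by apply: lin_ae_sum => j; apply: lin_aeM; exact: lin_ae_dotl.
apply/funext => y; apply/funext => w /=; rewrite dfwith_lift_eq dfwithin mulrC.
by congr (_ - _); apply: eq_bigr => j _; rewrite mulrC.
Qed.

Lemma lin_ae_wick_r p q (u : 'I_p -> HC) (v : 'I_q -> HC) i :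
  lin_ae (@Num.conj C) (fun y => wick_prod u (dfwith v i y)).
Proof.
elim: p q u v i => [|p IH] q u v i.
  rewrite (_ : (fun y => _) = fun y w => (\prod_(j < q | j != i) (Z (v j) w)^*) * (Z y w)^*).
    by apply: lin_aeM; exact: lin_ae_conj.
  apply/funext => y; apply/funext => w /=; rewrite (bigD1 i)//= dfwithin mulrC; congr (_ * _).
  by apply: eq_bigr => j ji; rewrite dfwithout// eq_sym.
rewrite /=; apply: lin_aeB; first exact: lin_aeM.
apply: lin_ae_sum => j; have [i' iE|iE] := unliftP j i; subst i.
  rewrite (_ : (fun y => _) = fun y w => cplx_dot ip (u ord0) (v j) *
      wick_prod (u \o lift ord0) (dfwith (v \o lift j) i' y) w).
    exact: (lin_aeM (fun=> _)).
  apply/funext => y; apply/funext => w; rewrite dfwith_lift dfwithout//.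
  by rewrite eq_sym neq_lift.
rewrite (_ : (fun y => _) = fun y w => wick_prod (u \o lift ord0) (v \o lift j) w *
    cplx_dot ip (u ord0) y).
  by apply: lin_aeM; exact: lin_ae_dotr.
by apply/funext => y; apply/funext => w; rewrite dfwith_lift_eq dfwithin mulrC.
Qed.

Definition mult n (ka : 'I_n -> nat) k := (\sum_(i < n) (ka i == k))%N.

Lemma mult_lift n (ka : 'I_n -> nat) j k :
  mult ka k = ((ka j == k) + mult (ka \o lift j) k)%N.
Proof. by rewrite /mult (bigD1_ord j). Qed.

(** On an orthogonal system only equal indices contract, so that the Wick
    product factorizes into Wick powers. *)
Lemma wick_prod_orthogonal (b : nat -> HC) c N p q (ka : 'I_p -> nat) (la : 'I_q -> nat) w :
  (forall k l, cplx_dot ip (b k) (b l) = if k == l then c%:R else 0) ->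
  (forall i, (ka i < N)%N) -> (forall j, (la j < N)%N) ->
  wick_prod (b \o ka) (b \o la) w =
  \prod_(k < N) wick c (mult ka k) (mult la k) (Z (b k) w).
Proof.
move=> bo; elim: p q ka la => [|p IH] q ka la kN lN.
  rewrite /=; transitivity (\prod_(k < N) ((Z (b k) w)^* ^+ mult la k)); last first.
    by apply: eq_bigr => k _; rewrite /mult big_ord0.
  transitivity (\prod_(j < q) \prod_(k < N) (Z (b k) w)^* ^+ (la j == k)).
    apply: eq_bigr => j _; rewrite (bigD1 (Ordinal (lN j)))//= eqxx expr1 big1 ?mulr1// => k kj.
    rewrite (_ : la j == k = false) ?expr0//; apply: contraNF kj => /eqP jk.
    by apply/eqP/val_inj.
  rewrite exchange_big; apply: eq_bigr => k _ /=.
  by rewrite /mult prodrXr.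
pose k0 := Ordinal (kN ord0); pose K : 'I_p -> nat := ka \o lift ord0.
have KN i : (K i < N)%N by exact: kN.
have mk k : mult ka k = ((ka ord0 == k) + mult K k)%N by exact: mult_lift.
pose rest := \prod_(k < N | k != k0) wick c (mult K k) (mult la k) (Z (b k) w).
have kE k : k != k0 -> ka ord0 == k = false.
  by move=> kk; apply: contraNF kk => /eqP kk; apply/eqP/val_inj.
rewrite /= -/K (IH q K la KN lN) [in RHS](bigD1 k0)//= mk eqxx add1n /=.
have -> : \prod_(k < N | k != k0) wick c (mult ka k) (mult la k) (Z (b k) w) = rest.
  by apply: eq_bigr => k kk; rewrite mk kE.
rewrite (bigD1 k0)//= -/rest.
have sumE : \sum_(j < q) cplx_dot ip (b (ka ord0)) (b (la j)) *
    wick_prod (b \o K) ((b \o la) \o lift j) w =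
    \sum_(j < q) (la j == ka ord0)%:R *
      (c%:R * (wick c (mult K k0) (mult la k0).-1 (Z (b (ka ord0)) w) * rest)).
  apply: eq_bigr => j _; rewrite bo eq_sym; have [jk|jk] := eqVneq (la j) (ka ord0); last by rewrite !mul0r.
  rewrite mul1r; congr (_ * _).
  rewrite (IH q.-1 K (la \o lift j) KN); last by move=> j'; exact: lN.
  have lk k : mult la k = ((ka ord0 == k) + mult (la \o lift j) k)%N.
    by rewrite -jk; exact: mult_lift.
  rewrite (bigD1 k0)//= lk eqxx add1n /=; congr (_ * _).
  by apply: eq_bigr => k kk; rewrite lk kE.
rewrite sumE -mulr_suml -natr_sum -/(mult la (ka ord0)) natrM.
by rewrite /=; ring.
Qed.

End wick_products.

(** * Symmetrized tensors *)

Section symmetrized_tensors.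
Context {R : realType} (H : completeNormedModType R) (ip : {dot H for @idfun R}).
Hypothesis ip_norm : norm_from_dot ip.
Local Notation HC := (complexification H).
Local Notation C := R[i].
Context (p q : nat) (T : completeNormedModType C) (dotT : {dot T for @Num.conj C}).
Context (tens : ('I_(p + q) -> HC) -> T).
Hypothesis tens_power : is_tensor_power ip dotT tens.
Implicit Types (u : 'I_p -> HC) (v : 'I_q -> HC).

Lemma symm_tensor_in u v : symm_tensor_space tens (symm_tensor tens u v).
Proof.
apply: subset_closure; exists 1%N, (fun=> 1), (fun=> symm_tensor tens u v).
by split; [move=> _; exists u, v|rewrite big_ord1 scale1r].
Qed.

Lemma fcat_lshift (A : Type) (u : 'I_p -> A) (v : 'I_q -> A) i : fcat u v (lshift q i) = u i.
Proof. by rewrite /fcat (unsplitK (inl i)). Qed.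

Lemma fcat_rshift (A : Type) (u : 'I_p -> A) (v : 'I_q -> A) i : fcat u v (rshift p i) = v i.
Proof. by rewrite /fcat (unsplitK (inr i)). Qed.

Lemma fcat_dfwith_l u v (s : 'S_p) i (z : HC) :
  fcat (fun i' => dfwith u i z (s i')) v =
  dfwith (fcat (fun i' => u (s i')) v) (lshift q ((s^-1)%g i)) z.
Proof.
apply/funext => j; have [k ->|k ->] := split_ordP j.
  rewrite fcat_lshift; have [E|ik] := eqVneq i (s k).
    by rewrite E permK !dfwithin.
  rewrite !dfwithout ?fcat_lshift//.
  by rewrite (inj_eq (@lshift_inj _ _)); apply: contra ik => /eqP <-; rewrite permKV.
by rewrite fcat_rshift dfwithout ?fcat_rshift// eq_lrshift.
Qed.

Lemma fcat_dfwith_r u v (t : 'S_q) i (z : HC) :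
  fcat u (fun i' => dfwith v i z (t i')) =
  dfwith (fcat u (fun i' => v (t i'))) (rshift p ((t^-1)%g i)) z.
Proof.
apply/funext => j; have [k ->|k ->] := split_ordP j.
  by rewrite fcat_lshift dfwithout ?fcat_lshift// eq_rlshift.
rewrite fcat_rshift; have [E|ik] := eqVneq i (t k).
  by rewrite E permK !dfwithin.
rewrite !dfwithout ?fcat_rshift//.
by rewrite (inj_eq (@rshift_inj _ _)); apply: contra ik => /eqP <-; rewrite permKV.
Qed.

Lemma symm_tensor_linear_l u v i (a : C) x y :
  symm_tensor tens (dfwith u i (a *: x + y)) v =
  a *: symm_tensor tens (dfwith u i x) v + symm_tensor tens (dfwith u i y) v.
Proof.
rewrite /symm_tensor scalerA mulrC -scalerA -scalerDr; congr (_ *: _).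
rewrite scaler_sumr -big_split; apply: eq_bigr => s _ /=.
rewrite scaler_sumr -big_split; apply: eq_bigr => t _ /=.
by rewrite !fcat_dfwith_l (tensor_linear tens_power).
Qed.

Lemma symm_tensor_linear_r u v i (a : C) x y :
  symm_tensor tens u (dfwith v i (a *: x + y)) =
  a *: symm_tensor tens u (dfwith v i x) + symm_tensor tens u (dfwith v i y).
Proof.
rewrite /symm_tensor scalerA mulrC -scalerA -scalerDr; congr (_ *: _).
rewrite scaler_sumr -big_split; apply: eq_bigr => s _ /=.
rewrite scaler_sumr -big_split; apply: eq_bigr => t _ /=.
by rewrite !fcat_dfwith_r (tensor_linear tens_power).
Qed.

Lemma symm_tensor_perm u v (s : 'S_p) (t : 'S_q) :
  symm_tensor tens (fun i => u (s i)) (fun j => v (t j)) = symm_tensor tens u v.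
Proof.
rewrite /symm_tensor; congr (_ *: _); rewrite [RHS](reindex_inj (mulIg s)).
apply: eq_bigr => s' _; rewrite [RHS](reindex_inj (mulIg t)); apply: eq_bigr => t' _.
by congr (tens (fcat _ _)); apply/funext => i; rewrite permM.
Qed.

(** All tensors in the average have the same norm. *)
Lemma symm_tensor_norm_le u v :
  `|symm_tensor tens u v| ^+ 2 <= ((\prod_i nrm2 ip (u i)) * \prod_j nrm2 ip (v j))%:C%C.
Proof.
set B := _ * _.
have tB (s : 'S_p) (t : 'S_q) : `|tens (fcat (fun i => u (s i)) (fun j => v (t j)))| ^+ 2 = B%:C%C.
  rewrite (tensor_norm tens_power) (tensor_dot tens_power) big_split_ord /=.
  under eq_bigr do rewrite fcat_lshift cplx_dot_nrm2.
  under [X in _ * X]eq_bigr do rewrite fcat_rshift cplx_dot_nrm2.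
  rewrite -!rmorph_prod -rmorphM; congr (_ %:C)%C; rewrite /B; congr (_ * _).
    by rewrite [RHS](reindex_inj (@perm_inj _ s)).
  by rewrite [RHS](reindex_inj (@perm_inj _ t)).
set n0 := `|tens (fcat (fun i => u ((1%g : 'S_p) i)) (fun j => v ((1%g : 'S_q) j)))|.
have tn (s : 'S_p) (t : 'S_q) : `|tens (fcat (fun i => u (s i)) (fun j => v (t j)))| = n0.
  apply: (@pexpIrn _ 2 _ _ _ (normr_ge0 _) (normr_ge0 _)) => //.
  exact: (etrans (tB s t) (esym (tB 1%g 1%g))).
have pq0 : (p`! * q`!)%:R != 0 :> C by rewrite pnatr_eq0 -lt0n muln_gt0 !fact_gt0.
rewrite -(tB 1%g 1%g) lerXn2r ?nnegrE// /symm_tensor normrZ normfV normr_nat.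
rewrite mulrC ler_pdivrMr ?ltr0n ?muln_gt0 ?fact_gt0//.
apply: le_trans (ler_norm_sum _ _ _) _.
apply: (@le_trans _ _ (\sum_(s : 'S_p) \sum_(t : 'S_q) n0)).
  apply: ler_sum => s _; apply: le_trans (ler_norm_sum _ _ _) _.
  by apply: ler_sum => t _; rewrite tn.
by rewrite !sumr_const !card_Sn -mulrnA mulr_natr mulnC.
Qed.

End symmetrized_tensors.

Arguments symm_tensor_in {R H p q T} tens u v.

Lemma normc_sqmod {R : realType} (z : R[i]) : complex.Re (`|z| ^+ 2) = sqmod z.
Proof.
case: z => a b; rewrite /sqmod normc_def /= expr2 /= mul0r subr0 -expr2 sqr_sqrtr//.
by rewrite addr_ge0 ?sqr_ge0.
Qed.

Lemma cplx_conj_lin {R : realType} (H : lmodType R) (a : R[i]) (x y : complexification H) :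
  cplx_conj (a *: x + y) = a^* *: cplx_conj x + cplx_conj y.
Proof.
case: a x y => [a a'] [f g] [f' g']; congr pair => /=.
  by rewrite scalerN scaleNr opprK.
by rewrite scalerN scaleNr !opprD.
Qed.

Section wiener_ito.
Context {R : realType} (H : completeNormedModType R) (ip : {dot H for @idfun R}).
Hypothesis ip_norm : norm_from_dot ip.
Context d (Om : measurableType d) (P : probability Om R).
Local Notation HC := (complexification H).
Local Notation C := R[i].
Variables X Y : H -> {RV P >-> R}.
Hypotheses (X_iso : isonormal ip X) (Y_iso : isonormal ip Y).
Local Notation Z := (complex_isonormal X Y).
Variable J : nat -> nat -> C -> C.
Hypothesis J_hermite : is_complex_hermite J.
Context (p q : nat) (T : completeNormedModType C) (dotT : {dot T for @Num.conj C}).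
Context (tens : ('I_(p + q) -> HC) -> T).
Hypothesis tens_power : is_tensor_power ip dotT tens.
Variable xi : nat -> HC.
Hypothesis xi_cons : complete_orthonormal ip xi.
Variable I : T -> Om -> C.
Hypothesis I_ito : is_wiener_ito P J Z tens xi I.
Implicit Types (u : 'I_p -> HC) (v : 'I_q -> HC).
Local Notation lin_ae := (lin_ae ip P).
Local Notation symm := (symm_tensor tens).

Let nrm2_conj y : nrm2 ip (cplx_conj y) = nrm2 ip y.
Proof. by rewrite !(nrm2E ip_norm) /= normrN. Qed.

Let cvgI (t : nat -> T) (c : R) : (forall n, symm_tensor_space tens (t n)) ->
  (forall n, `|t n| ^+ 2 <= (c * 2^-1 ^+ n)%:C%C) ->
  {ae P, forall w, sqmod (I (t n) w) @[n --> \oo] --> (0 : R)}.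
Proof.
move=> ts tc.
have pq0 : (0 : R) <= (p`! * q`!)%:R by exact: ler0n.
apply: (@summable_ae_cvg0 _ _ _ P (fun n w => sqmod (I (t n) w)) ((p`! * q`!)%:R * c)).
- move=> n; apply: measurable_sqmod; apply/cmeasurableP.
  exact: (wiener_ito_measurable I_ito (ts n)).
- by move=> n w; exact: sqmod_ge0.
move=> n; have := wiener_ito_isometry I_ito (ts n); rewrite unlock.
under eq_integral do rewrite normc_sqmod.
move=> ->; rewrite lee_fin.
have := tc n; rewrite lecE /= => /andP[_].
have -> : (p`! * q`!)%:R = (p`! * q`!)%:R%:C%C :> C by rewrite rmorph_nat.
have -> (r : R) (z : C) : complex.Re (r%:C%C * z) = r * complex.Re z.
  by case: z => ? ? /=; rewrite mul0r subr0.
by move=> h; rewrite -mulrA ler_wpM2l.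
Qed.

Let prod_dfwith n (u : 'I_n -> HC) i y :
  \prod_j nrm2 ip (dfwith u i y j) = nrm2 ip y * \prod_(j | j != i) nrm2 ip (u j).
Proof.
rewrite (bigD1 i)//= dfwithin; congr (_ * _); apply: eq_bigr => j ji.
by rewrite dfwithout// eq_sym.
Qed.

Let prod_ge0 n (u : 'I_n -> HC) (Q : pred 'I_n) : 0 <= \prod_(j | Q j) nrm2 ip (u j).
Proof. by apply: prodr_ge0 => j _; exact: nrm2_ge0. Qed.

Lemma lin_ae_wiener_ito_l u v i : lin_ae id (fun y => I (symm (dfwith u i y) v)).
Proof.
split=> [a x y|y yn].
  have := wiener_ito_linear I_ito a (symm_tensor_in tens (dfwith u i x) v)
    (symm_tensor_in tens (dfwith u i y) v).
  by rewrite -(symm_tensor_linear_l tens_power).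
apply: (cvgI (c := \prod_(j | j != i) nrm2 ip (u j) * \prod_j nrm2 ip (v j))).
  by move=> n; exact: symm_tensor_in.
move=> n; apply: (le_trans (symm_tensor_norm_le tens_power (dfwith u i (y n)) v)).
rewrite lecR prod_dfwith -mulrA mulrC ler_wpM2l// mulr_ge0//.
Qed.

Lemma lin_ae_wiener_ito_r u v i :
  lin_ae (@Num.conj C) (fun y => I (symm u (fun j => cplx_conj (dfwith v i y j)))).
Proof.
have cE y : (fun j => cplx_conj (dfwith v i y j)) =
    dfwith (fun j => cplx_conj (v j)) i (cplx_conj y).
  apply/funext => j; have [->|ij] := eqVneq i j; first by rewrite !dfwithin.
  by rewrite !dfwithout.
split=> [a x y|y yn].
  have := wiener_ito_linear I_ito a^* (symm_tensor_in tens u (fun j => cplx_conj (dfwith v i x j)))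
    (symm_tensor_in tens u (fun j => cplx_conj (dfwith v i y j))).
  by rewrite !cE -(symm_tensor_linear_r tens_power) -cplx_conj_lin.
apply: (cvgI (c := \prod_j nrm2 ip (u j) * \prod_(j | j != i) nrm2 ip (cplx_conj (v j)))).
  by move=> n; exact: symm_tensor_in.
move=> n; rewrite cE.
apply: (le_trans (symm_tensor_norm_le tens_power u (dfwith _ i (cplx_conj (y n))))).
rewrite lecR prod_dfwith nrm2_conj mulrCA mulrC ler_wpM2l//.
by rewrite mulr_ge0// prod_ge0.
Qed.

Let multi_index_perm n (ka : 'I_n -> nat) N : (forall i, (ka i < N)%N) ->
  exists s : 'S_n, forall i : 'I_n, multi_index N (mult ka) i = ka (s i).
Proof.
move=> kN.
have : perm_eq (flatten [seq nseq (mult ka k) k | k <- iota 0 N]) (mktuple ka).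
  apply/seq.permP => a; rewrite count_flatten -map_comp sumnE big_map.
  transitivity (\sum_(k < N) (a k * mult ka k))%N.
    rewrite -(big_mkord xpredT (fun k => a k * mult ka k)%N) /index_iota subn0.
    by apply: eq_bigr => k _; rewrite /= count_nseq.
  rewrite -sum1_count big_tuple [RHS]big_mkcond /=.
  under eq_bigr do rewrite /mult big_distrr /=.
  rewrite exchange_big /=; apply: eq_bigr => i _; rewrite tnth_mktuple.
  rewrite (bigD1 (Ordinal (kN i)))//= eqxx muln1 big1 ?addn0; first by case: (a _).
  move=> k kk; rewrite (_ : ka i == k = false) ?muln0//.
  by apply: contraNF kk => /eqP e; apply/eqP/val_inj.
move=> /tuple_permP[s sE]; exists s => i.
rewrite /multi_index sE (nth_map i) ?size_enum_ord// nth_ord_enum tnth_mktuple.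
by [].
Qed.

Let sum_mult n (ka : 'I_n -> nat) N : (forall i, (ka i < N)%N) ->
  (\sum_(k < N) mult ka k)%N = n.
Proof.
move=> kN; rewrite /mult exchange_big /=.
transitivity (\sum_(i < n) 1)%N; last by rewrite sum1_card card_ord.
apply: eq_bigr => i _; rewrite (bigD1 (Ordinal (kN i)))//= eqxx big1 ?addn0// => k kk.
by rewrite (_ : ka i == k = false)//; apply: contraNF kk => /eqP e; apply/eqP/val_inj.
Qed.

(** Once the indices are sorted, both sides are products of Hermite
    polynomials. *)
Lemma wiener_ito_basis (ka : 'I_p -> nat) (la : 'I_q -> nat) :
  {ae P, forall w, I (symm (xi \o ka) (fun j => cplx_conj (xi (la j)))) w =
                   wick_prod ip Z (xi \o ka) (xi \o la) w}.
Proof.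
pose N := (\max_i (ka i).+1 + \max_j (la j).+1)%N.
have kN i : (ka i < N)%N by apply: leq_trans (leq_addr _ _); exact: (leq_bigmax i).
have lN j : (la j < N)%N by apply: leq_trans (leq_addl _ _); exact: (leq_bigmax j).
have [s sE] := multi_index_perm kN; have [t tE] := multi_index_perm lN.
have := wiener_ito_hermite I_ito (sum_mult kN) (sum_mult lN).
rewrite (_ : (fun i : 'I_p => xi (multi_index N (mult ka) i)) = fun i => (xi \o ka) (s i)); last first.
  by apply/funext => i; rewrite sE.
rewrite (_ : (fun i : 'I_q => cplx_conj (xi (multi_index N (mult la) i))) =
    fun j => (fun j => cplx_conj (xi (la j))) (t j)); last first.
  by apply/funext => i; rewrite tE.
have -> := symm_tensor_perm tens (xi \o ka) (fun j => cplx_conj (xi (la j))) s t.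
apply: filterS => w ->.
rewrite (wick_prod_orthogonal (c := 1) Z w _ kN lN); last first.
  by move=> k l; rewrite (cplx_dot_orthonormal ip_norm xi_cons); case: eqP.
apply: eq_bigr => k _.
set s2 : C := (Num.sqrt 2)%:C%C.
have s2r : s2^* = s2 by apply/eqP; rewrite eq_complex /= oppr0 !eqxx.
have s22 : s2 * s2 = 2.
  by rewrite /s2 -rmorphM -expr2 sqr_sqrtr// rmorph_nat.
rewrite (hermite_wick _ _ _ J_hermite) (wick_scale _ _ _ s2r s22) mulKf//.
rewrite expf_neq0//; apply/eqP => s20; move: s22; rewrite s20 mul0r => /esym/eqP.
by rewrite pnatr_eq0.
Qed.

(** Both sides are linear and continuous in each argument and agree on the
    orthonormal system. *)
Lemma wiener_ito_wick u v :
  {ae P, forall w, I (symm u (fun j => cplx_conj (v j))) w = wick_prod ip Z u v w}.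
Proof.
have Zl : lin_ae id Z := lin_ae_isonormal X_iso Y_iso.
suff H0 : {ae P, forall w, I (symm u (fun j => cplx_conj (v j))) w - wick_prod ip Z u v w = 0}.
  by apply: filterS H0 => w /eqP; rewrite subr_eq0 => /eqP.
apply: (lin_ae_multilinear ip_norm xi_cons (Phi := fun v w =>
  I (symm u (fun j => cplx_conj (v j))) w - wick_prod ip Z u v w)) => [v' i|la].
  exact: lin_aeB (lin_ae_wiener_ito_r u v' i) (lin_ae_wick_r ip_norm Zl u v' i).
apply: (lin_ae_multilinear ip_norm xi_cons (Phi := fun u w =>
  I (symm u (fun j => cplx_conj (xi (la j)))) w - wick_prod ip Z u (xi \o la) w)) => [u' i|ka].
  exact: lin_aeB (lin_ae_wiener_ito_l u' _ i) (lin_ae_wick_l ip_norm Zl u' _ i).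
by apply: filterS (wiener_ito_basis ka la) => w ->; rewrite subrr.
Qed.

End wiener_ito.

(** * Absolute continuity *)

Section absolute_continuity.
Context {R : realType} d (Om : measurableType d) (P : probability Om R).
Notation mu := (@lebesgue_measure R).

Lemma absolutely_continuous_of_ae (F1 F2 : {RV P >-> R}) (F : Om -> R[i]) :
  cmeasurable F -> {ae P, forall w, (F1 w +i* F2 w)%C = F w} ->
  (forall N, measurable N -> (mu \x mu)%E N = 0%E -> P [set w | N (c2r (F w))] = 0%E) ->
  absolutely_continuous_law2 P F1 F2.
Proof.
move=> mF FE H; apply/null_content_dominatesP => N mN N0; rewrite -[RHS](H N mN N0).
rewrite /pushforward.
apply: ae_eq_measure.
- have m12 : measurable_fun setT (fun w => (F1 w, F2 w)) by apply: measurable_fun_pair.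
  by rewrite -[X in measurable X]setTI; exact: m12.
- by rewrite -[X in measurable X]setTI; exact: mF.
- by apply: filterS FE => w E /=; rewrite -E.
Qed.

(** A line is a null set of the plane. *)
Lemma not_absolutely_continuous_real (F1 F2 : {RV P >-> R}) :
  {ae P, forall w, F2 w = 0} -> ~ absolutely_continuous_law2 P F1 F2.
Proof.
move=> F20 /null_content_dominatesP H.
have mL : measurable ([set: R] `*` [set (0 : R)]) by exact: measurableX.
have L0 : (mu \x mu)%E ([set: R] `*` [set (0 : R)]) = 0%E.
  pose O : set R := [set 0].
  have -> : (mu \x mu)%E ([set: R] `*` [set (0 : R)]) = (mu setT * mu O)%E.
    exact: product_measure1E.
  have -> : mu O = 0%E by exact: lebesgue_measure_set1.
  by rewrite mule0.
have := H _ mL L0; rewrite /pushforward.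
have <- : P setT = P ((fun w => (F1 w, F2 w)) @^-1` ([set: R] `*` [set 0])).
  apply: ae_eq_measure => //.
    have m12 : measurable_fun setT (fun w => (F1 w, F2 w)) by apply: measurable_fun_pair.
    by rewrite -[X in measurable X]setTI; exact: m12.
  by apply: filterS F20 => w F2w /=; rewrite F2w; apply/propext; split.
by rewrite probability_setT => /eqP; rewrite onee_eq0.
Qed.

End absolute_continuity.

Lemma mult_tnth n (t : n.-tuple nat) k : mult (tnth t) k = count_mem k t.
Proof.
rewrite /mult -sum1_count big_tuple [RHS]big_mkcond /=.
by apply: eq_bigr => i _; case: (_ == _).
Qed.

Lemma sorted_count_eq (s t : seq nat) : sorted leq s -> sorted leq t ->
  (forall k, count_mem k s = count_mem k t) -> s = t.
Proof.
move=> ss st st'; apply: (sorted_eq leq_trans anti_leq) => //.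
by apply/allP => k _ /=; rewrite st'.
Qed.

Lemma wick_real_prod {R : realType} c N (m : nat -> nat) (z : nat -> R[i]) :
  complex.Im (\prod_(l < N) wick c (m l) (m l) (z l)) = 0.
Proof.
have : (\prod_(l < N) wick c (m l) (m l) (z l))^* = \prod_(l < N) wick c (m l) (m l) (z l).
  by rewrite rmorph_prod; apply: eq_bigr => l _; exact: wick_conj.
case: (\prod_(l < N) _) => a b /= [] h.
by lra.
Qed.

Local Open Scope complex_scope.

Theorem corollary3p10
  (R : realType)
  (H : completeNormedModType R) (ip : {dot H for @idfun R})
  (ip_norm : norm_from_dot ip) (H_separable : separable H)
  (d : measure_display) (Omega : measurableType d) (P : probability Omega R)
  (X Y : H -> {RV P >-> R})
  (X_isonormal : isonormal ip X) (Y_isonormal : isonormal ip Y)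
  (XY_independent : independent_families X Y)
  (J : nat -> nat -> R[i] -> R[i]) (J_hermite : is_complex_hermite J)
  (p q : nat)
  (T : completeNormedModType R[i]) (dotT : {dot T for @Num.conj R[i]})
  (tens : ('I_(p + q) -> complexification H) -> T)
  (tens_power : is_tensor_power ip dotT tens)
  (xi : nat -> complexification H) (xi_cons : complete_orthonormal ip xi)
  (I : T -> Omega -> R[i])
  (I_wiener_ito : is_wiener_ito P J (complex_isonormal X Y) tens xi I)
  (e : nat -> complexification H)
  (e_complete : complete_orthogonal ip e)
  (e_norm : forall k, cplx_norm ip (e k) = Num.sqrt 2)
  (k : p.-tuple nat) (j : q.-tuple nat)
  (k_sorted : sorted leq k) (j_sorted : sorted leq j)
  (F1 F2 : {RV P >-> R})
  (F_def : forall w, wiener_ito_tensor tens I (fun i => e (tnth k i))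
             (fun i => cplx_conj (e (tnth j i))) w = F1 w +i* F2 w) :
  absolutely_continuous_law2 P F1 F2 <->
  p <> q \/
  (p = q /\ exists l : nat, (l < p)%N /\ nth 0%N k l <> nth 0%N j l).
Proof.
pose ka := tnth k; pose la := tnth j.
pose N := (\max_(i < p) (ka i).+1 + \max_(i < q) (la i).+1)%N.
have kN i : (ka i < N)%N by apply: leq_trans (leq_addr _ _); exact: (leq_bigmax i).
have lN i : (la i < N)%N by apply: leq_trans (leq_addl _ _); exact: (leq_bigmax i).
have e_dot a b : cplx_dot ip (e a) (e b) = if a == b then 2%:R else 0.
  have [->|ab] := eqVneq a b; last by have [h _] := e_complete; exact: h.
  rewrite cplx_dot_nrm2; have := e_norm b; rewrite /cplx_norm /= -/(nrm2 _ _).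
  move=> /(congr1 (fun r : R => r ^+ 2)); rewrite !sqr_sqrtr ?(nrm2_ge0 ip_norm)// => ->.
  by rewrite rmorph_nat.
pose Z' := gaussC (isoG X Y) (@mul_Ni R H).
pose G w := \prod_(l <- iota 0 N) wick 2 (mult ka l) (mult la l) (Z' (e l) w).
have FG : {ae P, forall w, F1 w +i* F2 w = G w}.
  have h1 := wiener_ito_wick ip_norm X_isonormal Y_isonormal J_hermite tens_power
    xi_cons I_wiener_ito (e \o ka) (e \o la).
  have h2 : {ae P, forall w, forall l, complex_isonormal X Y (e l) w = Z' (e l) w}.
    by apply: ae_foralln => l; exact: (complex_isonormalE X Y_isonormal).
  apply: filterS2 h1 h2 => w h1 h2; rewrite -F_def [LHS]h1.
  rewrite (wick_prod_orthogonal (c := 2) _ w e_dot kN lN) /G.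
  rewrite -[in RHS](subn0 N) -/(index_iota 0 N) big_mkord.
  by apply: eq_bigr => l _; rewrite h2.
have mG : cmeasurable G.
  rewrite /G; elim: (iota 0 N) => [|l s IHs].
    by under [X in cmeasurable X]eq_fun do rewrite big_nil; exact: cmeasurable_cst.
  under [X in cmeasurable X]eq_fun do rewrite big_cons.
  apply: cmeasurableM => //; apply: cmeasurable_wick; apply: cmeasurable_gaussC.
  exact: measurable_isoG.
split=> [ac|neq].
- apply: contrapT => /not_orP[/contrapT pq no]; apply: (not_absolutely_continuous_real _ ac).
  have kj : val k = val j.
    apply: (@eq_from_nth _ 0%N); first by rewrite !size_tuple.
    move=> l; rewrite size_tuple => lp; apply: contrapT => kl; apply: no; split=> //.
    by exists l.
  have mE l : mult ka l = mult la l by rewrite !mult_tnth kj.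
  apply: filterS FG => w E; rewrite -[F2 w]/(complex.Im (F1 w +i* F2 w)) E /G.
  under eq_bigr do rewrite mE.
  rewrite -[in LHS](subn0 N) -/(index_iota 0 N) big_mkord.
  exact: (wick_real_prod 2 N (mult la) (fun l => Z' (e l) w)).
- apply: (absolutely_continuous_of_ae mG FG).
  have [l ml] : exists l, mult ka l <> mult la l.
    apply: contrapT => no.
    have kj : val k = val j.
      apply: sorted_count_eq => // l; rewrite -!mult_tnth; apply: contrapT => ne.
      by apply: no; exists l.
    have pq : p = q by rewrite -(size_tuple k) -(size_tuple j) [in LHS]kj.
    by case: neq => [//|[_ [l [_]]]]; rewrite kj.
  have lIN : l \in iota 0 N.
    rewrite mem_iota add0n /=; apply: contraPT ml => lN'.
    have zero n (t : 'I_n -> nat) : (forall i, (t i < N)%N) -> mult t l = 0%N.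
      move=> tN; rewrite /mult big1// => i _; apply/eqP; rewrite eqb0.
      by apply: contraNneq lN' => <-.
    by rewrite !zero.
  apply: (isonormal_wick_density X_isonormal Y_isonormal XY_independent) lIN ml => //.
  + by move=> a b ab; rewrite e_dot (negPf ab).
  + exact: iota_uniq.
Qed.
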